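(* Let $\mathcal{X}$ be a non-empty $\delta$-well spaced subset of $\mathbb{R}/\mathbb{Z}$, let $N\ge1$ and let $(u_p)_{p\le N}$ be complex numbers indexed by primes $p\le N$. Then $$\sum_{x\in\mathcal{X}}\Bigl|\sum_{p\le N}u_pe(xp)\Bigr|^2\le(4e^\gamma+o(1))\frac{N+\delta^{-1}}{\log N}\log(2|\mathcal{X}|)\sum_{p\le N}|u_p|^2,$$ where $o(1)$ is a function tending to $0$ as $N$ and $|\mathcal{X}|$ tend to infinity. When $N\ge 10^4$, the inequality holds with the constant $4e^\gamma+o(1)$ replaced by $19$. Moreover, the constant $4e^\gamma+o(1)$ cannot in general be replaced by anything smaller than $\tfrac12+o(1)$.
   Context: $e(x)=e^{2\pi i x}$, $\gamma$ is Euler's constant. A set $\mathcal{X}\subset\mathbb{R}/\mathbb{Z}$ is $\delta$-well spaced if any two distinct points of it are at distance $\ge\delta$ in $\mathbb{R}/\mathbb{Z}$ (distance to nearest integer of the difference). *)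

(* Defs.v *)
From HB Require Import structures.
From mathcomp Require Import all_boot all_order all_algebra.
From mathcomp Require Import generic_quotient ring_quotient finmap.
From mathcomp Require Import all_classical all_reals all_analysis.
From mathcomp Require Import complex ring lra.
Set Implicit Arguments.
Unset Strict Implicit.
Unset Printing Implicit Defensive.
Import Order.TTheory GRing.Theory Num.Theory.
Import numFieldNormedType.Exports.
Local Open Scope ring_scope.
Local Open Scope classical_set_scope.
Local Open Scope quotient_scope.

(* [Num.int_num_subdef] is the predicate underlying [Num.int], which carries
   the closure properties required by the quotient construction. *)
Definition RmodZ (R : realType) : Type :=
  Quotient.quot (@Num.int_num_subdef R : {pred R}).

(* With [f] the fractional part of [t], the distance from [t] to the nearest
   integer is the smaller of [f] and [1 - f]. *)
Definition dist_int (R : realType) (t : R) : R :=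
  Num.min (t - (Num.floor t)%:~R) (1 - (t - (Num.floor t)%:~R)).

Definition dist_RmodZ (R : realType) (x y : RmodZ R) : R :=
  dist_int (repr (x - y)).

Definition well_spaced (R : realType) (delta : R) (X : set (RmodZ R)) : Prop :=
  forall x y, X x -> X y -> x <> y -> delta <= dist_RmodZ x y.

Definition e (R : realType) (t : R) : R[i] :=
  Complex (cos (2 * pi * t)) (sin (2 * pi * t)).

(* [e] has period 1, so evaluating it at a representative is legitimate, see
   [e_RmodZ_pi]. *)
Definition e_RmodZ (R : realType) (x : RmodZ R) : R[i] := e (repr x).

Definition euler_gamma (R : realType) : R :=
  limn (fun n => series harmonic n - ln n%:R).

(* [N] is a real number, and the sums range over the primes [p <= N].
   [x *+ p] is the multiple of [x] by [p] in the group R/Z; the set [X] is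
   finite as soon as it is [delta]-well spaced for some [delta > 0], see
   [well_spaced_finite]. *)
Definition primes_large_sieve (R : realType) (N delta : R)
    (X : set (RmodZ R)) (u : nat -> R[i]) (C : R) : Prop :=
  \sum_(x \in X) Normc.normc
      (\sum_(0 <= p < (Num.truncn N).+1 | prime p) u p * e_RmodZ (x *+ p)) ^+ 2
  <= C * ((N + delta^-1) / ln N) * ln (2 * (#|` fset_set X|)%:R)
     * \sum_(0 <= p < (Num.truncn N).+1 | prime p) Normc.normc (u p) ^+ 2.

(* The inequality holds with the constant [c + o(1)], where [o(1)] depends only
   on [N] and [|X|] and tends to 0 as both tend to infinity. *)
Definition asymptotic_constant (R : realType) (c : R) : Prop :=
  exists eps : R -> nat -> R,
    (eps z.1 z.2 @[z --> filter_prod +oo%R \oo] --> (0 : R)) /\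
    forall (N delta : R) (X : set (RmodZ R)) (u : nat -> R[i]),
      1 <= N -> 0 < delta -> X !=set0 -> well_spaced delta X ->
      primes_large_sieve N delta X u (c + eps N #|` fset_set X|).

Lemma dist_int_le (R : realType) (t : R) (m : int) : dist_int t <= `|t - m%:~R|.
Proof.
rewrite /dist_int ge_min.
have /andP[h1 h2] := floor_itv t.
have [mf|fm] := leP m (Num.floor t).
  have : m%:~R <= (Num.floor t)%:~R :> R by rewrite ler_int.
  move=> mf'; rewrite ger0_norm ?subr_ge0 ?(le_trans mf') //.
  by rewrite lerD2l lerN2 mf'.
have : (Num.floor t + 1)%:~R <= m%:~R :> R by rewrite ler_int lezD1.
move=> fm'; rewrite ltr0_norm; last by rewrite subr_lt0 (lt_le_trans h2).
by apply/orP; right; move: fm'; rewrite intrD; lra.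
Qed.

Lemma dist_int_attained (R : realType) (t : R) :
  exists m : int, dist_int t = `|t - m%:~R|.
Proof.
have /andP[h1 h2] := floor_itv t; rewrite intrD in h2.
rewrite /dist_int; case: leP => _.
  by exists (Num.floor t); rewrite ger0_norm ?subr_ge0.
by exists (Num.floor t + 1); rewrite intrD ler0_norm; lra.
Qed.

Lemma RmodZ_eqP (R : realType) (s t : R) :
  reflect (exists m : int, s - t = m%:~R) (\pi_(RmodZ R) s == \pi_(RmodZ R) t).
Proof. by rewrite -Quotient.idealrBE; exact: intrP. Qed.

Lemma repr_pi_RmodZ (R : realType) (t : R) :
  exists m : int, repr (\pi_(RmodZ R) t) = t + m%:~R.
Proof.
have /RmodZ_eqP[m hm] : \pi_(RmodZ R) (repr (\pi_(RmodZ R) t)) == \pi_(RmodZ R) t.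
  by rewrite reprK.
by exists m; rewrite -hm; ring.
Qed.

Lemma dist_RmodZ_pi (R : realType) (s t : R) :
  dist_RmodZ (\pi_(RmodZ R) s) (\pi_(RmodZ R) t) = dist_int (s - t).
Proof.
rewrite /dist_RmodZ.
have -> : \pi_(RmodZ R) s - \pi_(RmodZ R) t = \pi_(RmodZ R) (s - t).
  by rewrite !piE.
have [m ->] := repr_pi_RmodZ (s - t).
have hm : (m%:~R : R) \is a Num.int by exact: intr_int.
rewrite /dist_int (floorDrz (s - t) hm) intrD (floorK hm).
by rewrite opprD addrACA subrr addr0.
Qed.

Lemma e_RmodZ_pi (R : realType) (t : R) : e_RmodZ (\pi_(RmodZ R) t) = e t.
Proof.
have eD (s : R) (n : nat) : e (s + n%:R) = e s.
  rewrite /e mulrDr.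
  have -> : 2 * pi * n%:R = pi *+ 2 *+ n :> R by rewrite -mulr_natr; ring.
  by rewrite (periodicn (@cosD2pi R)) (periodicn (@sinD2pi R)).
rewrite /e_RmodZ; have [m ->] := repr_pi_RmodZ t.
case: m => n; first exact: eD.
by rewrite NegzE intrN -(eD (t - n.+1%:R) n.+1) subrK.
Qed.

Lemma e_RmodZ_mulrn (R : realType) (t : R) (n : nat) :
  e_RmodZ (\pi_(RmodZ R) t *+ n) = e (t * n%:R).
Proof.
rewrite -e_RmodZ_pi mulr_natr; congr e_RmodZ.
by elim: n => [|n IH]; rewrite ?mulr0n ?piE// !mulrS IH !piE.
Qed.

Lemma well_spaced_finite (R : realType) (delta : R) (X : set (RmodZ R)) :
  0 < delta -> well_spaced delta X -> finite_set X.
Proof.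
move=> d0 wX.
pose fr (x : RmodZ R) : R := repr x - (Num.floor (repr x))%:~R.
have fr_itv x : 0 <= fr x < 1.
  by have := floor_itv (repr x); rewrite /fr intrD => /andP[? ?]; lra.
have pi_fr x : \pi_(RmodZ R) (fr x) = x.
  rewrite -[RHS]reprK; apply/eqP/RmodZ_eqP; exists (- Num.floor (repr x)).
  by rewrite /fr intrN; ring.
pose M := (Num.truncn delta^-1).+1.
have M0 : 0 < M%:R :> R by rewrite ltr0n.
have dM : M%:R^-1 < delta.
  rewrite invf_plt ?posrE//.
  have di : 0 <= delta^-1 by rewrite invr_ge0 ltW.
  by have /andP[] := truncn_itv di.
pose cell x := Num.truncn (M%:R * fr x).
have cellP x : (cell x)%:R <= M%:R * fr x < (cell x).+1%:R.
  by apply: truncn_itv; apply: mulr_ge0 (ltW M0) _; case/andP: (fr_itv x).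
have inj : {in X &, injective cell}.
  move=> x y /set_mem Xx /set_mem Xy cxy; apply: contrapT => xy.
  have := wX x y Xx Xy xy; rewrite -{1}(pi_fr x) -{1}(pi_fr y) dist_RmodZ_pi.
  apply/negP; rewrite -ltNge; apply: le_lt_trans dM.
  apply: (le_trans (dist_int_le _ 0)); rewrite subr0.
  rewrite -(ler_pM2l M0) mulfV ?gt_eqF// -{1}(gtr0_norm M0) -normrM mulrBr.
  move: (cellP x) (cellP y); rewrite cxy -natr1 => /andP[? ?] /andP[? ?].
  by rewrite ler_norml; lra.
have : finite_set (cell @` X).
  apply: (sub_finite_set _ (finite_II M)) => _ [x Xx <-] /=.
  rewrite -(ltr_nat R); have /andP[h _] := cellP x; apply: (le_lt_trans h).
  by rewrite gtr_pMr//; case/andP: (fr_itv x).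
by move=> fin; rewrite -(eq_finite_set (inj_card_eq inj)).
Qed.

Lemma euler_gamma_cvg (R : realType) :
  series harmonic n - ln n%:R @[n --> \oo] --> euler_gamma R.
Proof.
pose a n : R := series harmonic n - ln n%:R.
suff : cvgn (fun n => a n.+1).
  move=> /cvg_ex[l hl]; rewrite /euler_gamma -/a; apply: (cvgP l).
  by rewrite -(cvg_shiftS a).
have lnS (m x : R) : -1 < x -> 0 < m -> ln (m * (1 + x)) - ln m <= x.
  move=> x1 m0; have x0 : 0 < 1 + x by rewrite -ltrBlDl sub0r.
  by rewrite lnM ?posrE// addrC addKr le_ln1Dx.
have hS n : series harmonic n.+1 = series harmonic n + n.+1%:R^-1 :> R.
  by rewrite seriesSr.
have n_gt0 n : 0 < n.+1%:R :> R by rewrite ltr0n.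
have h_ge n : ln n.+1%:R <= series harmonic n :> R.
  elim: n => [|n IH]; first by rewrite ln1 seriesEnat/= big_geq.
  have p : 0 < n.+1%:R^-1 :> R by rewrite invr_gt0.
  have := lnS n.+1%:R n.+1%:R^-1 (lt_trans (ltrN10 R) p) (n_gt0 n).
  rewrite mulrDr mulr1 mulfV ?pnatr_eq0// natr1 lerBlDr hS => h.
  by rewrite (le_trans h)// addrC lerD2r.
apply: nonincreasing_is_cvgn.
  apply/nonincreasing_seqP => n; rewrite /a hS.
  have p : - 1 < - n.+2%:R^-1 :> R by rewrite ltrN2 invf_lt1// ltr1n.
  have := lnS n.+2%:R (- n.+2%:R^-1) p (n_gt0 _).
  have -> : n.+2%:R * (1 - n.+2%:R^-1) = n.+1%:R :> R.
    by rewrite mulrBr mulr1 mulfV ?pnatr_eq0// -natr1 addrK.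
  move=> h; rewrite -addrA lerD2l.
  by move: h; rewrite lerNr opprB => h; rewrite lerBlDr (le_trans h)// addrC.
exists 0 => _ [n _ <-]; rewrite /a subr_ge0 hS.
by rewrite (le_trans (h_ge n))// lerDl invr_ge0 ltW.
Qed.

(* Main.v *)
Require Import Defs.
From mathcomp Require Import all_boot all_order all_algebra.
From mathcomp Require Import generic_quotient ring_quotient finmap.
From mathcomp Require Import all_classical all_reals all_analysis.
From mathcomp Require Import complex.
From mathcomp Require Import zify ring lra.
Import Order.TTheory GRing.Theory Num.Theory.
Local Open Scope ring_scope.
Set Implicit Arguments.
Unset Strict Implicit.
Unset Printing Implicit Defensive.

(**
The upper bounds are proved in dual form: for complex weights (c_x) one bounds the
sum over primes p <= N of |T(p)|^2, where T(n) = sum_x c_x e(n x).  The large sieve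
over all n < M costs M + O(1/delta); to gain the logarithm, let P be the product of
the primes in (z, Q] and let h be a combination of Ramanujan sums with nonnegative
weights of total mass G, which takes the value G at every n coprime to P.  Then G^2
times the sum over the primes in (Q, N] is at most the sum of |h(n) T(n)|^2, n < M.  Expanding
|h|^2 into additive characters of Z/P, the trivial character returns the large sieve,
and the others only see moduli with all prime factors larger than z, so they are
negligible as soon as z exceeds |X| by a small power.  Since G is about
log Q / (2 log z), one saves a factor log N / log |X|.  When N is at most a bounded
power of |X| the large sieve suffices, and when |X| is bounded so does Chebyshev.

For the lower bound, X is the set of fractions with squarefree denominator at most Q
and u is the indicator of the primes in (Q, N]: the same identity h = G, read
backwards with Cauchy-Schwarz, gives a lower bound of the size log Q for the ratio,
while log(2|X|) is about 2 log Q.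
*)

(** * Chebyshev-type estimates *)

(** No sharp asymptotics for primes are needed. As gamma >= 1/2, the constant 4 e^gamma is at least
    13/2, and the inequality is proved with 13/2 and no error term once |X| >= 1000^64. For smaller
    |X| the function o(1) may be as large as |X| log N, since it has to vanish only when |X| tends
    to infinity too. The room comes from the mass G: a bound 2 log z + 4 for the reciprocal sum over
    z-smooth numbers replaces Mertens' product, and for N a huge power of |X|, with z near |X| and Q
    near sqrt N, the sieve would lose only 4 log |X| / log N. The obstacle is the middle range: |X|
    Q^2 must stay a small power below N, which weakens the sieve when N is a moderate power of |X|,
    while the large sieve alone loses log N / log |X|. The crossover near N = |X|^(11/2) keeps both
    below 13/2, even with the factor 47/40 of the large sieve proved here. The lower bound asks for
    a suitable N for each Q only, so the prime number theorem is replaced by a statement on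
    infinitely many N. *)

Lemma prod_primes_dvdn (a b m : nat) :
  (forall p, prime p -> (a <= p < b)%N -> (p %| m)%N) ->
  (\prod_(a <= p < b | prime p) p %| m)%N.
Proof.
elim: b => [|b IH] H; first by rewrite big_geq.
have [ab|ab] := leqP a b; last by rewrite big_geq.
rewrite big_mkcond big_nat_recr //= -big_mkcond.
have {}IH : (\prod_(a <= p < b | prime p) p %| m)%N.
  by apply: IH => p pp /andP[ap pb]; apply: H => //; rewrite ap leqW.
case: ifP => pb; last by rewrite muln1.
rewrite Gauss_dvd ?IH /=; first by apply: H; rewrite // ab leqnn.
rewrite coprime_sym big_nat_cond; apply: (big_ind (fun x => coprime b x)).
- by rewrite coprimen1.
- by move=> x y; rewrite coprimeMr => -> ->.
move=> p /andP[/andP[_ lpb] pp]; rewrite prime_coprime // dvdn_prime2 //.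
by apply/eqP; lia.
Qed.

(** Erdős's induction. An even n > 2 adds no prime; for n = 2k + 1 the primes in (k + 1, n] divide
    the binomial coefficient of n and k, which is at most 4 ^ k because it occurs twice among the
    terms of (1 + 1) ^ n. *)
Lemma primorial_le (n : nat) : (\prod_(0 <= p < n.+1 | prime p) p <= 4 ^ n)%N.
Proof.
have [m] := ubnP n; elim: m n => // m IH n; rewrite ltnS => nm.
have [n2|n2] := leqP n 2.
  by move: n n2 {nm} => [|[|[|//]]] _; rewrite unlock.
have [odd_n|even_n] := boolP (odd n); last first.
  have np : ~~ prime n by apply: contra even_n => /even_prime[n'|//]; lia.
  case: n n2 nm even_n np => // n n2 nm _ np.
  rewrite big_mkcond big_nat_recr //= -big_mkcond (negPf np) muln1.
  by apply: leq_trans (IH n _) _; [lia|rewrite leq_exp2l].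
set k := n./2; have nE : n = k.*2.+1 by have := odd_double_half n; rewrite odd_n; lia.
have kn : (k.+1 <= n)%N by lia.
rewrite (big_cat_nat (n := k.+2)) //=.
have h1 := IH k.+1 ltac:(lia).
have h2 : (\prod_(k.+2 <= p < n.+1 | prime p) p <= 'C(n, k))%N.
  apply: dvdn_leq; first by rewrite bin_gt0; lia.
  apply: prod_primes_dvdn => p pp /andP[kp pn].
  have fact_nd l : (l < p)%N -> ~~ (p %| l`!)%N.
    by move=> lp; rewrite fact_prod big_nat_cond; elim/big_ind: _ => [|x y|i];
      [rewrite dvdn1; case: eqP pp => // ->|rewrite Euclid_dvdM // negb_or => -> ->|
       move=> /andP[/andP[i1 il] _]; rewrite gtnNdvd //; lia].
  have : (p %| 'C(n, k) * (k`! * (n - k)`!))%N.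
    by rewrite bin_fact; [rewrite dvdn_fact //; lia|lia].
  rewrite !Euclid_dvdM // (negPf (fact_nd _ _)) ?(negPf (fact_nd _ _)) ?orbF //; lia.
apply: leq_trans (leq_mul h1 h2) _.
have h3 : ('C(n, k) <= 4 ^ k)%N.
  have := Pascal 1 1 n; rewrite addn1 => e2.
  have kn' : (k < n)%N by lia.
  have : ('C(n,k) + 'C(n, k.+1) <= 2 ^ n)%N.
    rewrite e2 (bigD1 (Ordinal (ltnW (kn' : (k < n)%N) : (k < n.+1)%N))) //=.
    rewrite (bigD1 (Ordinal (kn' : (k.+1 < n.+1)%N))) //=; last by rewrite -val_eqE /=; lia.
    by rewrite !exp1n !muln1; lia.
  have -> : 'C(n, k.+1) = 'C(n,k) by rewrite -bin_sub; [congr binomial; lia|lia].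
  have -> : (2 ^ n = 2 * 4 ^ k)%N by rewrite nE expnS -mul2n expnM.
  lia.
have -> : (4 ^ n = 4 ^ k.+1 * 4 ^ k)%N by rewrite -expnD; congr expn; lia.
by rewrite leq_mul2l h3 orbT.
Qed.

Section RealType.
Variable R : realType.
Implicit Types (n p : nat).

Lemma ln_ge0n n : 0 <= ln n%:R :> R.
Proof.
by case: n => [|n]; [rewrite ln0|apply: ln_ge0; rewrite ler1n].
Qed.

Lemma ler_lnn m n : (0 < m)%N -> (m <= n)%N -> ln m%:R <= ln n%:R :> R.
Proof. by move=> m0 mn; rewrite ler_ln ?posrE ?ltr0n ?ler_nat //; lia. Qed.

Lemma ln_succ_sub n : (0 < n)%N -> n.+1%:R^-1 <= ln n.+1%:R - ln n%:R :> R.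
Proof.
move=> n0; have n0' : 0 < n%:R :> R by rewrite ltr0n.
have n1 : 0 < n.+1%:R :> R by rewrite ltr0n.
have := @le_ln1Dx R (- n.+1%:R^-1); rewrite ltrN2 invf_lt1 // ltr1n => /(_ n0).
have -> : 1 - n.+1%:R^-1 = n%:R / n.+1%:R :> R by rewrite -natr1; field; rewrite natr1; lra.
by rewrite ln_div ?posrE // => h; rewrite -lerN2 opprB.
Qed.

Lemma ln_succ_sub_le n : (0 < n)%N -> ln n.+1%:R - ln n%:R <= n%:R^-1 :> R.
Proof.
move=> n0; have n0' : 0 < n%:R :> R by rewrite ltr0n.
have n1 : 0 < n.+1%:R :> R by rewrite ltr0n.
have := @le_ln1Dx R (n%:R^-1); rewrite (lt_trans _ (_ : 0 < _)) ?invr_gt0 ?ltrN10 // => /(_ isT).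
have -> : 1 + n%:R^-1 = n.+1%:R / n%:R :> R by rewrite -natr1; field; lra.
by rewrite ln_div ?posrE //; lra.
Qed.

Lemma harmonic_ge n : ln n.+1%:R <= \sum_(1 <= k < n.+1) k%:R^-1 :> R.
Proof.
elim: n => [|n IH]; first by rewrite ln1 big_geq.
rewrite big_nat_recr //=; have := @ln_succ_sub_le n.+1 isT.
by move: (n.+1%:R^-1 : R) => i; lra.
Qed.

Lemma harmonic_le n : \sum_(1 <= k < n.+1) k%:R^-1 <= 1 + ln n%:R :> R.
Proof.
case: n => [|n]; first by rewrite big_geq // ln0 //; lra.
elim: n => [|n IH]; first by rewrite big_nat1 ln1 invr1; lra.
rewrite big_nat_recr //=; have := @ln_succ_sub n.+1 isT.
by move: (n.+2%:R^-1 : R) => i; lra.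
Qed.

Lemma ln_fact_ge n : n%:R * ln n%:R - n%:R <= ln n`!%:R :> R.
Proof.
elim: n => [|n IH]; first by rewrite mul0r subr0 ln_ge0n.
rewrite factS natrM lnM ?posrE ?ltr0n ?fact_gt0 //.
case: n IH => [|n] IH; first by rewrite fact0 ln1; lra.
have := @ln_succ_sub_le n.+1 isT.
have n0 : 0 < n.+1%:R :> R by rewrite ltr0n.
rewrite -(ler_pM2l n0) mulfV ?gt_eqF // => h.
by rewrite -(natr1 n.+1) in h *; lra.
Qed.

Lemma ln_fact_le n : ln n`!%:R <= n%:R * ln n%:R - n%:R + ln n%:R + 1 :> R.
Proof.
case: n => [|n]; first by rewrite fact0 ln1 ln0 //; lra.
elim: n => [|n IH]; first by rewrite ln1; lra.
rewrite factS natrM lnM ?posrE ?ltr0n ?fact_gt0 //.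
have := @ln_succ_sub n.+1 isT.
have n0 : 0 < n.+2%:R :> R by rewrite ltr0n.
rewrite -(ler_pM2l n0) mulfV ?gt_eqF // => h.
by rewrite -(natr1 n.+1) in h *; lra.
Qed.

Lemma ln_prod (I : Type) (r : seq I) (P : pred I) (F : I -> R) :
  (forall i, P i -> 0 < F i) ->
  ln (\prod_(i <- r | P i) F i) = \sum_(i <- r | P i) ln (F i).
Proof.
move=> F0; suff [] : 0 < \prod_(i <- r | P i) F i /\
  ln (\prod_(i <- r | P i) F i) = \sum_(i <- r | P i) ln (F i) by [].
elim/big_rec2: _ => [|i y x Pi [y0 <-]]; first by rewrite ln1.
by split; [apply: mulr_gt0 => //; exact: F0|rewrite lnM ?posrE //; exact: F0].
Qed.

Lemma theta_le n : \sum_(0 <= p < n.+1 | prime p) ln p%:R <= n%:R * ln 4 :> R.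
Proof.
rewrite -ln_prod => [|p /prime_gt0]; last by rewrite ltr0n.
rewrite -natr_prod.
rewrite (mulrC n%:R) mulr_natr -lnXn // -natrX ler_lnn ?primorial_le //.
by apply: prodn_cond_gt0 => p /prime_gt0.
Qed.

Lemma ln_primes n m : (0 < n)%N -> (n <= m)%N ->
  ln n%:R = \sum_(0 <= p < m.+1 | prime p) (logn p n)%:R * ln p%:R :> R.
Proof.
move=> n0 nm; rewrite -{1}(partnT n0) (widen_partn _ nm) natr_prod ln_prod => [|p _]; last first.
  by rewrite ltr0n; case: p => [|p]; rewrite ?expn_gt0 // lognE.
rewrite [RHS]big_mkcond /=; apply: eq_bigr => p _.
rewrite lognE; case: ifP => [/andP[pp _]|]; last by rewrite /= expn0 ln1; case: ifP; rewrite ?mul0r.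
by rewrite pp natrX lnXn ?ltr0n ?prime_gt0 // mulr_natl.
Qed.
End RealType.

(** * Numerical bounds for logarithms and for Euler's constant *)

Section LogBounds.
Variable R : realType.
Implicit Types (x y : R).

(** The trapezoid rule overestimates the integral of the convex function 1/t over [1, y]; its value
    is (y - 1)(1 + 1/y) / 2. *)
Lemma ln_le_trapezoid y : 1 <= y -> ln y <= (y - y^-1) / 2.
Proof.
move=> y1; rewrite -subr_ge0.
pose f z : R := (z - z^-1) / 2 - ln z.
have f1 : f 1 = 0 by rewrite /f invr1 ln1; lra.
have d (z : R) : 0 < z -> is_derive z 1 f ((1 - z^-1) ^+ 2 / 2).
  move=> z0; have := is_derive1_ln z0 => dl; rewrite /f.
  have zn : z != 0 by rewrite gt_eqF.
  have dv := @is_deriveV R (fun w => w) z 1 1 zn (is_derive_id _ _).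
  apply: is_derive_eq.
  by rewrite /GRing.scale /=; field.
rewrite -f1 -[leRHS]/(f y); apply: (@ger0_derive1_ndecry R f 1) => //.
- by move=> z; rewrite in_itv /= andbT => z1; have [] := d z (lt_trans ltr01 z1).
- move=> z; rewrite in_itv /= andbT => z1; rewrite derive1E.
  have [_ ->] := d z (lt_trans ltr01 z1).
  by rewrite divr_ge0 ?sqr_ge0.
- apply: derivable_within_continuous => z; rewrite in_itv /= andbT => z1.
  by have [] := d z (lt_le_trans ltr01 z1).
Qed.

(** The midpoint rule for the same integral, an underestimate by convexity. *)
Lemma ln_ge_midpoint y : 1 <= y -> 2 * (y - 1) / (y + 1) <= ln y.
Proof.
move=> y1; rewrite -subr_ge0.
pose f z : R := ln z - 2 * (z - 1) / (z + 1).
have f1 : f 1 = 0 by rewrite /f ln1; lra.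
have d (z : R) : 0 < z -> is_derive z 1 f ((z - 1) ^+ 2 / (z * (z + 1) ^+ 2)).
  move=> z0; have := is_derive1_ln z0 => dl; rewrite /f.
  have zn : z + 1 != 0 by rewrite gt_eqF //; lra.
  apply: is_derive_eq.
  rewrite /GRing.scale /=; field; apply/andP; split; lra.
rewrite -f1 -[leRHS]/(f y); apply: (@ger0_derive1_ndecry R f 1) => //.
- by move=> z; rewrite in_itv /= andbT => z1; have [] := d z (lt_trans ltr01 z1).
- move=> z; rewrite in_itv /= andbT => z1; rewrite derive1E.
  have [_ ->] := d z (lt_trans ltr01 z1).
  by rewrite divr_ge0 ?sqr_ge0 // mulr_ge0 ?sqr_ge0 //; lra.
- apply: derivable_within_continuous => z; rewrite in_itv /= andbT => z1.
  by have [] := d z (lt_le_trans ltr01 z1).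
Qed.

Lemma ln2_bounds : 69 / 100 <= ln (2 : R) <= 7 / 10.
Proof.
(* The errors of the two rules are cubic in y - 1, so four factors close to 1 give two digits. *)
have -> : ln (2 : R) = ln (5 / 4) + (ln (6 / 5) + (ln (7 / 6) + ln (8 / 7))).
  by rewrite -!lnM ?posrE; [congr ln; field|lra..].
have u4 : ln (5 / 4 : R) <= 9 / 40.
  apply: le_trans (@ln_le_trapezoid (5 / 4) ltac:(lra)) _.
  by rewrite invf_div; lra.
have l4 : 2 / 9 <= ln (5 / 4 : R).
  have := @ln_ge_midpoint (5 / 4) ltac:(lra).
  by have -> : 2 * (5 / 4 - 1) / (5 / 4 + 1) = 2 / 9 :> R by field.
have u5 : ln (6 / 5 : R) <= 11 / 60.
  apply: le_trans (@ln_le_trapezoid (6 / 5) ltac:(lra)) _.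
  by rewrite invf_div; lra.
have l5 : 2 / 11 <= ln (6 / 5 : R).
  have := @ln_ge_midpoint (6 / 5) ltac:(lra).
  by have -> : 2 * (6 / 5 - 1) / (6 / 5 + 1) = 2 / 11 :> R by field.
have u6 : ln (7 / 6 : R) <= 13 / 84.
  apply: le_trans (@ln_le_trapezoid (7 / 6) ltac:(lra)) _.
  by rewrite invf_div; lra.
have l6 : 2 / 13 <= ln (7 / 6 : R).
  have := @ln_ge_midpoint (7 / 6) ltac:(lra).
  by have -> : 2 * (7 / 6 - 1) / (7 / 6 + 1) = 2 / 13 :> R by field.
have u7 : ln (8 / 7 : R) <= 15 / 112.
  apply: le_trans (@ln_le_trapezoid (8 / 7) ltac:(lra)) _.
  by rewrite invf_div; lra.
have l7 : 2 / 15 <= ln (8 / 7 : R).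
  have := @ln_ge_midpoint (8 / 7) ltac:(lra).
  by have -> : 2 * (8 / 7 - 1) / (8 / 7 + 1) = 2 / 15 :> R by field.
by apply/andP; split; lra.
Qed.

Lemma expR_half_ge : 13 / 8 <= expR (1 / 2) :> R.
Proof.
have h : ln (13 / 8 : R) <= 1 / 2.
  (* The trapezoid rule at 13/8 itself exceeds 1/2; at 51/40, whose square is just above 13/8, it is
     precise enough. *)
  have : ln (13 / 8 : R) <= ln ((51 / 40) ^+ 2) by rewrite ler_ln ?posrE; lra.
  rewrite lnXn; last lra.
  have := @ln_le_trapezoid (51 / 40) ltac:(lra).
  by rewrite invf_div; move: (ln (51 / 40)) => a; lra.
by rewrite -(@lnK R (13 / 8)) ?posrE ?ler_expR //; lra.
Qed.

(** By the trapezoid rule the sequence H_n - ln n - 1 / (2 n) is nondecreasing, and its first value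
    is 1/2. *)
Lemma euler_gamma_ge_half : 1 / 2 <= euler_gamma R.
Proof.
have h n : 1 / 2 + (n.+1%:R * 2)^-1 <= series harmonic n.+1 - ln n.+1%:R :> R.
  elim: n => [|n IH].
    by rewrite seriesEnat /= big_nat1 /harmonic /= ln1; lra.
  have -> : series harmonic n.+2 = series harmonic n.+1 + n.+2%:R^-1 :> R by rewrite seriesSr.
  have n1 : 0 < n.+1%:R :> R by rewrite ltr0n.
  have n2E : n.+2%:R = n.+1%:R + 1 :> R by rewrite -natr1.
  have := @ln_le_trapezoid (n.+2%:R / n.+1%:R).
  have r1 : 1 <= n.+2%:R / n.+1%:R :> R by rewrite ler_pdivlMr // mul1r ler_nat.
  move=> /(_ r1); rewrite ln_div ?posrE ?ltr0n // invf_div.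
  have -> : (n.+2%:R / n.+1%:R - n.+1%:R / n.+2%:R) / 2 = (n.+1%:R * 2)^-1 + (n.+2%:R * 2)^-1 :> R.
    by rewrite n2E; field; apply/andP; split; lra.
  have -> : n.+2%:R^-1 = (n.+2%:R * 2)^-1 + (n.+2%:R * 2)^-1 :> R.
    by rewrite n2E; field; lra.
  move: IH; move: ((n.+1%:R * 2)^-1) ((n.+2%:R * 2)^-1) (series _ _) (ln _) (ln _) => *.
  lra.
apply: limr_ge; first exact: cvgP (@euler_gamma_cvg R).
near=> n; have n0 : (0 < n)%N by near: n; exact: nbhs_infty_gt.
have := h n.-1; rewrite prednK //; apply: le_trans.
by rewrite lerDl invr_ge0 mulr_ge0.
Unshelve. all: by end_near.
Qed.

(** All that is used of gamma: the upper bound is proved with 13/2 in place of 4 e^gamma. *)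
Lemma four_expR_euler_gamma_ge : 13 / 2 <= 4 * expR (euler_gamma R).
Proof.
have : expR (1 / 2) <= expR (euler_gamma R) by rewrite ler_expR euler_gamma_ge_half.
by have := expR_half_ge; lra.
Qed.

End LogBounds.

(** * An explicit upper bound of Mertens type *)

Section Mertens.
Variable R : realType.
Implicit Types (n p : nat).

(* A linear bound for the logarithm that is nearly optimal around x = 2 ^ k. *)
Lemma ln_le_scaled k (x : R) : 0 < x -> ln x <= k%:R * (7 / 10) + x / 2 ^+ k - 1.
Proof.
move=> x0; have p0 : 0 < 2 ^+ k :> R by rewrite exprn_gt0.
have -> : ln x = ln (2 ^+ k) + ln (x / 2 ^+ k).
  by rewrite ln_div ?posrE //; ring.
have h : ln (x / 2 ^+ k) <= x / 2 ^+ k - 1.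
  by have := @le_ln1Dx R (x / 2 ^+ k - 1);
    rewrite addrCA subrr addr0; apply; rewrite ltrBrDr addrC subrr divr_gt0.
have /andP[_ l2] := ln2_bounds R.
rewrite lnXn // -[_ *+ k]mulr_natl; have : k%:R * ln 2 <= k%:R * (7 / 10) :> R by rewrite ler_wpM2l.
lra.
Qed.

Lemma geom_pow_inv (p k : nat) : (1 < p)%N ->
  \sum_(1 <= i < k.+1) (p%:R ^+ i)^-1 = (1 - (p%:R ^+ k)^-1) / (p%:R - 1) :> R.
Proof.
move=> p1; have p1' : 1 < p%:R :> R by rewrite ltr1n.
elim: k => [|k IH]; first by rewrite big_geq // expr0 invr1 subrr mul0r.
rewrite big_nat_recr //= IH exprS.
have : p%:R ^+ k != 0 :> R by rewrite expf_neq0 // gt_eqF //; lra.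
move: (p%:R ^+ k) => w w0; field.
by rewrite w0; apply/andP; split; lra.
Qed.

(** Legendre's formula cut after k terms, each floor losing at most 1. *)
Lemma legendre_ge n p k : prime p -> (k <= n)%N ->
  n%:R * ((1 - (p%:R ^+ k)^-1) / (p%:R - 1)) - k%:R <= (logn p n`!)%:R :> R.
Proof.
move=> pp kn; rewrite logn_fact // -geom_pow_inv ?prime_gt1 //.
apply: le_trans (_ : (\sum_(1 <= i < k.+1) n %/ p ^ i)%:R <= _); last first.
  by rewrite ler_nat [leqRHS](big_cat_nat (n := k.+1)) //= leq_addr.
rewrite natr_sum mulr_sumr lerBlDr.
have -> : k%:R = \sum_(1 <= i < k.+1) 1 :> R by rewrite sumr_const_nat subn1.
rewrite -big_split /=; apply: ler_sum => i _.
have pi0 : 0 < p%:R ^+ i :> R by rewrite exprn_gt0 // ltr0n prime_gt0.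
rewrite ler_pdivrMr // natr1 -natrX -natrM ler_nat ltnW // -ltn_divLR //.
by rewrite expn_gt0 prime_gt0.
Qed.

(** For p <= sqrt n Legendre's formula is cut at the largest k with p ^ k <= n, and the loss is O(ln
    n). Beyond sqrt n it is cut at k = 1, and the neglected tail n ln p / (p (p - 1)) is
    summable. *)
Lemma mertens_term n p : prime p -> (p <= n)%N ->
  n%:R * (ln p%:R / (p%:R - 1)) <= (logn p n`!)%:R * ln p%:R + ln p%:R +
   (if (p ^ 2 <= n)%N then 2 * ln n%:R else n%:R * ln n%:R / (p%:R * (p%:R - 1))) :> R.
Proof.
move=> pp pn; have p1 : 1 < p%:R :> R by rewrite ltr1n prime_gt1.
have p2 : 2 <= p%:R :> R by rewrite (ler_nat R 2) prime_gt1.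
have lp : 0 <= ln p%:R :> R by exact: ln_ge0n.
have n0 : (0 < n)%N by apply: leq_trans pn; exact: prime_gt0.
have lpn : ln p%:R <= ln n%:R :> R by rewrite ler_lnn // prime_gt0.
case: ifP => h; last first.
  have := @legendre_ge n p 1 pp n0; rewrite expr1.
  have -> : n%:R * (ln p%:R / (p%:R - 1)) =
     (n%:R * ((1 - p%:R^-1) / (p%:R - 1)) - 1 + 1) * ln p%:R + n%:R * ln p%:R / (p%:R * (p%:R - 1)) :> R.
    by field; apply/andP; split; lra.
  move=> hl; apply: lerD; first by rewrite -[X in _ <= _ + X]mul1r -mulrDl; apply: ler_wpM2r => //; lra.
  rewrite ler_pM2r; last by rewrite invr_gt0 mulr_gt0; lra.
  by rewrite ler_pM2l // ltr0n.
pose k := trunc_log p n.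
have /andP[k1 k2] := trunc_log_bounds (prime_gt1 pp) n0.
have kn : (k <= n)%N by apply: leq_trans (ltnW (ltn_expl k (prime_gt1 pp))) k1.
have hl := @legendre_ge n p k pp kn.
have pk0 : 0 < p%:R ^+ k :> R by rewrite exprn_gt0 //; lra.
have t2 : n%:R * ((p%:R ^+ k)^-1 / (p%:R - 1)) <= 2 :> R.
  rewrite mulrA ler_pdivrMr; last by lra.
  rewrite ler_pdivrMr //; apply: le_trans (_ : p%:R ^+ k.+1 <= _).
    by rewrite -natrX ler_nat ltnW.
  by rewrite exprS ler_pM2r //; lra.
have kl : k%:R * ln p%:R <= ln n%:R :> R.
  rewrite mulr_natl -lnXn; last by lra.
  by rewrite -natrX ler_lnn // expn_gt0 prime_gt0.
have l2 : 2 * ln p%:R <= ln n%:R :> R.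
  rewrite mulr_natl -lnXn; last by lra.
  by rewrite -natrX ler_lnn // expn_gt0 prime_gt0.
have -> : n%:R * (ln p%:R / (p%:R - 1)) =
   (n%:R * ((1 - (p%:R ^+ k)^-1) / (p%:R - 1)) + n%:R * ((p%:R ^+ k)^-1 / (p%:R - 1))) * ln p%:R :> R.
  by ring.
apply: le_trans (_ : ((logn p n`!)%:R + k%:R + 2) * ln p%:R <= _).
  by apply: ler_wpM2r => //; lra.
by rewrite !mulrDl; lra.
Qed.

Lemma sum_inv_mul_pred (w n : nat) : (0 < w)%N ->
  \sum_(w.+1 <= m < n.+1) (m%:R * (m%:R - 1))^-1 <= w%:R^-1 :> R.
Proof.
move=> w0; have w0' : 0 < w%:R :> R by rewrite ltr0n.
have h m : (w <= m)%N -> \sum_(w.+1 <= i < m.+1) (i%:R * (i%:R - 1))^-1 = w%:R^-1 - m%:R^-1 :> R.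
  elim: m => [|m IH]; first by rewrite leqn0 => /eqP wE; rewrite wE in w0.
  rewrite leq_eqVlt => /orP[/eqP <-|wm]; first by rewrite big_geq // subrr.
  rewrite big_nat_recr //= IH //.
  have m0 : 0 < m%:R :> R by rewrite ltr0n; apply: leq_trans w0 _.
  by rewrite -natr1; field; apply/and3P; split; lra.
have [wn|wn] := leqP w n; last by rewrite big_geq ?invr_ge0 // ltnW.
by rewrite h // gerBl invr_ge0.
Qed.

(** The Legendre parts sum to at most ln n!, about n ln n - n, and theta(n) <= 1.4 n, so the other
    errors, of order sqrt n ln n, have room 0.6 n. The threshold 2601 = 51^2 is large enough for
    this; it is also the least z = |X|^2 used for the constant 19. *)
Lemma mertens_le n : (2601 <= n)%N ->
  \sum_(0 <= p < n.+1 | prime p) ln p%:R / (p%:R - 1) <= ln n%:R + 1 :> R.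
Proof.
move=> n2601; have n0 : (0 < n)%N by lia.
have n0' : 0 < n%:R :> R by rewrite ltr0n.
pose w := Num.truncn (Num.sqrt n%:R : R).
have w1 : (w ^ 2 <= n)%N.
  rewrite -(ler_nat R) natrX -[leRHS]sqr_sqrtr ?ler0n // ler_sqr ?nnegrE ?sqrtr_ge0 //.
  by rewrite truncn_le sqrtr_ge0.
have w2 : (n < w.+1 ^ 2)%N.
  rewrite -(ltr_nat R) natrX -[ltLHS]sqr_sqrtr ?ler0n // ltr_sqr ?nnegrE ?sqrtr_ge0 //.
  by have /andP[] := truncn_itv (sqrtr_ge0 (n%:R : R)).
have w51 : (51 <= w)%N by nia.
rewrite -(ler_pM2l n0') mulr_sumr.
apply: le_trans (_ : \sum_(0 <= p < n.+1 | prime p) ((logn p n`!)%:R * ln p%:R + ln p%:R +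
   (if (p ^ 2 <= n)%N then 2 * ln n%:R else n%:R * ln n%:R / (p%:R * (p%:R - 1)))) <= _).
  rewrite big_nat_cond [leRHS]big_nat_cond; apply: ler_sum => p /andP[/andP[_ pn] pp].
  exact: mertens_term.
rewrite !big_split /=.
have f1 : \sum_(0 <= p < n.+1 | prime p)
    (logn p n`!)%:R * ln p%:R <= n%:R * ln n%:R - n%:R + ln n%:R + 1 :> R.
  apply: le_trans (ln_fact_le R n).
  have nf : (n <= n`!)%N by apply: dvdn_leq; [exact: fact_gt0|rewrite dvdn_fact // n0 /=].
  rewrite (ln_primes R (fact_gt0 n) (leqnn _)) [leRHS](big_cat_nat (n := n.+1)) //= lerDl.
  by apply: sumr_ge0 => p _; rewrite mulr_ge0 // ln_ge0n.
have f2 := theta_le R n.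
have ln0' : 0 <= ln n%:R :> R by exact: ln_ge0n.
have f3 : \sum_(0 <= p < n.+1 | prime p)
    (if (p ^ 2 <= n)%N then 2 * ln n%:R else n%:R * ln n%:R / (p%:R * (p%:R - 1)))
    <= w%:R * (2 * ln n%:R) + n%:R * ln n%:R * w%:R^-1 :> R.
  have wn : (w.+1 <= n.+1)%N by nia.
  rewrite (big_cat_nat (n := w.+1)) //=; apply: lerD.
    rewrite big_mkcond big_nat_recl //= add0r.
    apply: le_trans (_ : \sum_(0 <= i < w) (2 * ln n%:R) <= _).
      apply: ler_sum_nat => p /andP[_ pw].
      have -> : (p.+1 ^ 2 <= n)%N by apply: leq_trans w1; rewrite leq_exp2r.
      by case: ifP => // _; rewrite mulr_ge0.
    by rewrite sumr_const_nat subn0 [leRHS]mulr_natl.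
  apply: le_trans (_ : n%:R * ln n%:R * \sum_(w.+1 <= m < n.+1) (m%:R * (m%:R - 1))^-1 <= _).
    rewrite mulr_sumr big_mkcond; apply: ler_sum_nat => p /andP[wp _].
    have p1 : 1 <= p%:R :> R by rewrite ler1n; apply: leq_trans wp.
    case: ifP => _; last by rewrite mulr_ge0 ?invr_ge0 ?mulr_ge0 // subr_ge0.
    case: ifP => // pn; exfalso.
    have : (w.+1 ^ 2 <= n)%N by apply: leq_trans pn; rewrite leq_exp2r.
    by rewrite leqNgt w2.
  by rewrite ler_wpM2l ?mulr_ge0 // sum_inv_mul_pred //; lia.
apply: le_trans (lerD (lerD f1 f2) f3) _.
have w51' : 51 <= w%:R :> R by rewrite (ler_nat R 51).
have w1' : w%:R ^+ 2 <= n%:R :> R by rewrite -natrX ler_nat.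
have w2' : n%:R <= (w%:R + 1) ^+ 2 :> R by rewrite natr1 -natrX ler_nat ltnW.
have l4 : ln 4 <= 14 / 10 :> R.
  have -> : 4 = 2 ^+ 2 :> R by lra.
  by rewrite lnXn //; have /andP[_] := ln2_bounds R; lra.
have lnw : ln n%:R <= (w%:R + 1) / 6 :> R.
  apply: le_trans (_ : ln ((w%:R + 1) ^+ 2) <= _).
    by rewrite ler_ln ?posrE ?exprn_gt0 //; lra.
  rewrite lnXn; last lra.
  by have := @ln_le_scaled 6 (w%:R + 1) ltac:(lra); lra.
have nw : n%:R * w%:R^-1 <= w%:R + 3 :> R by rewrite ler_pdivrMr; nra.
have k1 : ln n%:R * (1 + 2 * w%:R + n%:R * w%:R^-1) <= (w%:R + 1) / 6 * (3 * w%:R + 4) :> R.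
  by apply: ler_pM => //; lra.
have k2 : (w%:R + 1) / 6 * (3 * w%:R + 4) + 1 <= 6 / 10 * w%:R ^+ 2 :> R by nra.
have k3 : n%:R * ln 4 <= n%:R * (14 / 10) :> R by rewrite ler_pM2l.
by rewrite (mulrAC n%:R (ln n%:R)) ; move: k1 k3; move: (n%:R * w%:R^-1) => v; lra.
Qed.

End Mertens.

(** * The prime counting function *)

Section PrimeCounting.
Variable R : realType.
Implicit Types (n p : nat).

Definition prime_count n : R := \sum_(0 <= p < n.+1 | prime p) 1.

Lemma prime_countS n : prime_count n.+1 = prime_count n + (prime n.+1)%:R.
Proof. by rewrite /prime_count big_mkcond big_nat_recr //= -big_mkcond; case: ifP. Qed.

Lemma prime_count_ge0 n : 0 <= prime_count n.
Proof. exact: sumr_ge0. Qed.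

(** Primes up to y are counted trivially; each larger one contributes at least ln y to theta(n) <= n
    ln 4. *)
Lemma prime_count_le n (y : R) : 1 < y ->
  prime_count n <= y + n%:R * ln 4 / ln y.
Proof.
move=> y1; have ly : 0 < ln y by rewrite ln_gt0.
rewrite /prime_count (bigID (fun p => p%:R <= y)) /=; apply: lerD.
  have y0 : 0 <= y by lra.
  apply: le_trans (_ : \sum_(0 <= p < (Num.truncn y).+1 | prime p) 1 <= _).
    rewrite big_mkcond /=.
    have [ny|ny] := leqP n (Num.truncn y).
      rewrite [leRHS](big_cat_nat (n := n.+1)) //=.
      rewrite -[leLHS]addr0; apply: lerD; last exact: sumr_ge0.
      by rewrite [leRHS]big_mkcond; apply: ler_sum => p _; case: (prime p); case: (_ <= y).
    rewrite (big_cat_nat (n := (Num.truncn y).+1)) //=; last by rewrite ltnS ltnW.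
    rewrite [X in _ + X]big1_seq ?addr0; last first.
      move=> p /andP[_]; rewrite mem_index_iota => /andP[yp _].
      case: ifP => // /andP[_]; rewrite leNgt.
      have /andP[_ h] := truncn_itv y0; rewrite (lt_le_trans h) // ler_nat //.
    by rewrite [leRHS]big_mkcond; apply: ler_sum => p _; case: (prime p); case: (_ <= y).
  apply: le_trans (_ : (Num.truncn y)%:R <= _); last by rewrite truncn_le.
  rewrite big_mkcond big_nat_recl //= add0r.
  apply: le_trans (_ : \sum_(0 <= i < Num.truncn y) 1 <= _).
    by apply: ler_sum => i _; case: ifP.
  by rewrite sumr_const_nat subn0.
rewrite ler_pdivlMr // mulr_suml; apply: le_trans (theta_le R n).
rewrite [leLHS]big_mkcond [leRHS]big_mkcond /=; apply: ler_sum => p _.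
case: (prime p) => //=; case: ifP => [|_]; last exact: ln_ge0n.
by rewrite mul1r -ltNge => yp; rewrite ler_ln ?posrE; lra.
Qed.

(** The other half of Legendre's formula, with all floors dropped. It yields the lower bound ln n -
    1 for the sum of ln p / (p - 1). *)
Lemma ln_fact_le_sum n :
  ln n`!%:R <= n%:R * \sum_(0 <= p < n.+1 | prime p) ln p%:R / (p%:R - 1) :> R.
Proof.
rewrite (ln_primes R (fact_gt0 n) (leqnn _)) mulr_sumr.
have [n1|n1] := posnP n.
  rewrite n1 /= big_mkcond 2?big_nat_recl // big_geq //= !add0r big1 // => p _.
  by rewrite mul0r.
have nf : (n <= n`!)%N by apply: dvdn_leq; [exact: fact_gt0|rewrite dvdn_fact // n1 /=].
rewrite (big_cat_nat (n := n.+1)) //= [X in _ + X]big1_seq ?addr0; last first.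
  move=> p /andP[pp]; rewrite mem_index_iota => /andP[np _].
  rewrite logn_fact // big1_seq ?mul0r // => k; rewrite mem_index_iota => /andP[_ /andP[k1 _]].
  rewrite divn_small //; apply: leq_trans np _.
  by rewrite -{1}(expn1 p) leq_exp2l // prime_gt1.
rewrite big_mkcond [leRHS]big_mkcond /=; apply: ler_sum => p _; case: ifP => // pp.
have p1 : 1 < p%:R :> R by rewrite ltr1n prime_gt1.
rewrite mulrA ler_pdivlMr; last by lra.
rewrite mulrAC ler_wpM2r ?ln_ge0n // logn_fact //.
have h : (\sum_(1 <= k < n.+1) n %/ p ^ k)%:R <= n%:R * \sum_(1 <= k < n.+1) (p%:R ^+ k)^-1 :> R.
  rewrite natr_sum mulr_sumr; apply: ler_sum => k _.
  rewrite ler_pdivlMr ?exprn_gt0 //; last by lra.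
  by rewrite -natrX -natrM ler_nat leq_divM.
apply: le_trans (ler_wpM2r _ h) _; first by lra.
rewrite geom_pow_inv ?prime_gt1 // -mulrA divfK; last by rewrite gt_eqF //; lra.
rewrite ler_piMr // gerBl invr_ge0 exprn_ge0 //; lra.
Qed.

(** Substitute for the prime number theorem in the lower bound. If pi(n) <= (1 - k) n / ln n from n0
    on, partial summation bounds the sum of ln p / (p - 1) by (1 - k) ln n + O(1), against the lower
    bound ln n - 1. *)
Lemma prime_count_limsup (k : R) (n0 : nat) : 0 < k ->
  exists2 n, (n0 <= n)%N & (1 - k) * n%:R <= prime_count n * ln n%:R.
Proof.
move=> k0; apply: contrapT => H.
have {}H n : (n0 <= n)%N -> prime_count n * ln n%:R <= (1 - k) * n%:R.
  move=> hn; rewrite leNgt; apply/negP => h; apply: H; exists n => //; exact: ltW.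
pose m := maxn n0 2.
have m2 : (2 <= m)%N by rewrite /m; lia.
pose g n : R := ln n%:R / (n%:R - 1).
have gE n : (2 <= n)%N -> g n - g n.+1 <= ln n%:R / (n%:R * (n%:R - 1)).
  move=> n2; have n2' : 2 <= n%:R :> R by rewrite (ler_nat R 2).
  have ln1 : ln n%:R <= ln n.+1%:R :> R by rewrite ler_lnn //; lia.
  rewrite /g -(natr1 n) addrK lerBlDr; rewrite -(natr1 n) in ln1.
  have -> : ln n%:R / (n%:R - 1) = ln n%:R / (n%:R * (n%:R - 1)) + ln n%:R / n%:R :> R.
    by field; apply/andP; split; lra.
  by rewrite lerD2l ler_pM2r // invr_gt0; lra.
pose G n : R := \sum_(0 <= p < n.+1 | prime p) g p.
have GS n : G n.+1 = G n + (prime n.+1)%:R * g n.+1.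
  by rewrite /G big_mkcond big_nat_recr //= -big_mkcond; case: ifP; rewrite ?mul1r ?mul0r.
(* Partial summation as an induction: the count times the decrement of [g] is at most (1 - k) / (m +
   n - 1), whence the harmonic sum. *)
have up n : G (m + n)%N - prime_count (m + n) * g (m + n)%N <=
    G m - prime_count m * g m + (1 - k) * (\sum_(1 <= i < n.+1) i%:R^-1).
  elim: n => [|n IH]; first by rewrite addn0 big_geq // mulr0 addr0.
  have mn2 : (2 <= m + n)%N by lia.
  rewrite addnS GS prime_countS big_nat_recr //=.
  have mn2' : 2 <= (m + n)%:R :> R by rewrite (ler_nat R 2).
  have l0 : 0 < ln (m + n)%:R :> R by rewrite ln_gt0 //; lra.
  have h1 := H (m + n)%N ltac:(rewrite /m; lia).
  have h2 : prime_count (m + n) * (g (m + n)%N - g (m + n).+1) <= (1 - k) * ((m + n)%:R - 1)^-1.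
    apply: le_trans (ler_wpM2l (prime_count_ge0 _) (gE _ mn2)) _.
    rewrite mulrA ler_pdivrMr ?mulr_gt0 //; try lra.
    have -> : (1 - k) / ((m + n)%:R - 1) * ((m + n)%:R * ((m + n)%:R - 1)) = (1 - k) * (m + n)%:R :> R.
      by field; lra.
    exact: h1.
  have pc := prime_count_ge0 (m + n); have k1 : 0 <= 1 - k.
    have : 0 <= (1 - k) * (m + n)%:R by apply: le_trans h1; rewrite mulr_ge0 // ltW.
    by rewrite pmulr_lge0 //; lra.
  have h3 : ((m + n)%:R - 1)^-1 <= n.+1%:R^-1 :> R.
    rewrite lef_pV2 ?posrE ?ltr0n //; last by lra.
    rewrite lerBrDr natr1 ler_nat; lia.
  have {}h3 := ler_wpM2l k1 h3.
  rewrite mulrDr (mulrDl (prime_count _)) opprD; move: IH h2 h3.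
  rewrite mulrBr; move: ((1 - k) / ((m + n)%:R - 1)) ((1 - k) / n.+1%:R) => a c.
  move: (g (m + n).+1) ((prime (m + n).+1)%:R : R) => u v; lra.
(* The 3 collects the bound 2 for the count times [g] and the 1 lost in ln n - 1. *)
pose C := G m - prime_count m * g m + 3.
have fin n : (0 < n)%N -> ln (m + n)%:R <= C + (1 - k) * (1 + ln (m + n)%:R).
  move=> n0'; have := up n; have mn2 : (2 <= m + n)%N by lia.
  have mn2' : 2 <= (m + n)%:R :> R by rewrite (ler_nat R 2).
  have l0 : 0 < ln (m + n)%:R :> R by rewrite ln_gt0 //; lra.
  have h1 := H (m + n)%N ltac:(rewrite /m; lia).
  have k1 : 0 <= 1 - k.
    have : 0 <= (1 - k) * (m + n)%:R by apply: le_trans h1; rewrite mulr_ge0 ?prime_count_ge0 // ltW.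
    by rewrite pmulr_lge0 //; lra.
  have h2 : prime_count (m + n) * g (m + n)%N <= 2.
    rewrite /g mulrA ler_pdivrMr; last by lra.
    by apply: le_trans h1 _; nra.
  have h3 : \sum_(1 <= i < n.+1) i%:R^-1 <= 1 + ln (m + n)%:R :> R.
    apply: le_trans (harmonic_le R n) _; rewrite lerD2l ler_lnn //; lia.
  have {}h3 := ler_wpM2l k1 h3.
  have h4 := ln_fact_le_sum (m + n); have h5 := ln_fact_ge R (m + n).
  have h6 : ln (m + n)%:R - 1 <= G (m + n)%N.
    have p0 : 0 < (m + n)%:R :> R by lra.
    rewrite -(ler_pM2l p0) mulrBr mulr1; exact: le_trans h5 h4.
  by rewrite /C; lra.
pose x := (C + 1) / k.
pose N := (Num.truncn (expR `|x|)).+1.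
have N0 : (0 < N)%N by [].
have := fin N N0; have : `|x| < ln (m + N)%:R.
  rewrite -(expRK `|x|) ltr_ln ?posrE ?expR_gt0 ?ltr0n //; last by lia.
  have /andP[_ h] := truncn_itv (ltW (expR_gt0 `|x|)).
  by apply: lt_le_trans h _; rewrite ler_nat /N; lia.
have : x <= `|x| by exact: ler_norm.
rewrite /x; move: (ln _) `|_| => l w h1 h2 h3.
have : (C + 1) / k < l by lra.
by rewrite ltr_pdivrMr //; nra.
Qed.

End PrimeCounting.

(** * The dual large sieve *)

Section Trigo.
Variable R : realType.
Implicit Types (x u t : R).

Lemma sin_le x : 0 <= x -> sin x <= x.
Proof.
move=> x0; rewrite -subr_ge0.
have d y : derivable (fun z : R => z - sin z) y 1 by [].
have -> : 0 = (fun z : R => z - sin z) 0 by rewrite /= sin0 subr0.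
apply: (@ger0_derive1_ndecry R (fun z : R => z - sin z) 0) => //.
  move=> y _; rewrite derive1E derive_val.
  by rewrite subr_ge0 cos_le1.
by apply: derivable_within_continuous => y _.
Qed.

Lemma mulr_cos_le_sin x : 0 <= x <= pi -> x * cos x <= sin x.
Proof.
move=> /andP[x0 xpi]; rewrite -subr_ge0.
have -> : 0 = (fun z : R => sin z - z * cos z) 0 by rewrite /= sin0 mul0r subr0.
have d (y : R) : is_derive y 1 (fun z : R => sin z - z * cos z) (y * sin y).
  by apply: is_derive_eq; rewrite /GRing.scale /=; ring.
apply: (@ger0_derive1_ndecr R (fun z : R => sin z - z * cos z) 0 x) => //.
- move=> y; rewrite in_itv /= => /andP[y0 yx]; rewrite derive1E derive_val.
  by apply: mulr_ge0; rewrite ?ltW // sin_gt0_pi // y0 (lt_le_trans yx).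
- by apply: derivable_within_continuous => y _.
Qed.

(** Three half-angle steps from cos(pi/2) = 0 give sin(pi/16)^2 >= 0.038, and sin x <= x. The kernel
    estimates use it as 1 / pi^2 <= 100/961. *)
Lemma pi_ge31 : 31 / 10 <= pi :> R.
Proof.
have c0 (y : R) : - (pi / 2) <= y <= pi / 2 -> 0 <= cos y by exact: cos_ge0_pihalf.
have pi0 := pi_gt0 R.
have h1 : cos (pi / 2) = cos (pi / 4) ^+ 2 *+ 2 - 1 :> R.
  by rewrite -cos_mulr2n; congr cos; field.
have h2 : cos (pi / 4) = cos (pi / 8) ^+ 2 *+ 2 - 1 :> R.
  by rewrite -cos_mulr2n; congr cos; field.
have h3 : cos (pi / 8) = cos (pi / 16) ^+ 2 *+ 2 - 1 :> R.
  by rewrite -cos_mulr2n; congr cos; field.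
have g1 : 0 <= cos (pi / 4) :> R by apply: c0; lra.
have g2 : 0 <= cos (pi / 8) :> R by apply: c0; lra.
rewrite cos_pihalf in h1.
have k1 : cos (pi / 4) <= 7072 / 10000 :> R by nra.
have k2 : cos (pi / 8) <= 924 / 1000 :> R by move: h2 k1 g2; move: (cos _) (cos _) => a b; clear; nra.
have k3 : 38 / 1000 <= sin (pi / 16) ^+ 2 :> R by rewrite sin2cos2; move: h3 k2; clear; lra.
have k4 : 0 <= sin (pi / 16) :> R by apply: sin_ge0_pi; move: pi0; clear; lra.
have p16 : 0 <= pi / 16 :> R by move: pi0; clear; lra.
have k5 := sin_le p16.
by move: k3 k4 k5 pi0; clear; nra.
Qed.

(** This is u cos u <= sin u, squared. Read as 1 / sin^2 u <= 1 / u^2 + 1, it keeps the leading term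
    of the kernel exact. *)
Lemma sqr_le_sqr_sin u : 0 <= u <= pi / 2 -> u ^+ 2 <= sin u ^+ 2 * (1 + u ^+ 2).
Proof.
move=> /andP[u0 upi]; have pi0 := pi_gt0 R.
have h := @mulr_cos_le_sin u ltac:(apply/andP; split; lra).
have c0 : 0 <= cos u by apply: cos_ge0_pihalf; lra.
have : (u * cos u) ^+ 2 <= sin u ^+ 2 by rewrite ler_sqr ?nnegrE ?(le_trans _ h) // mulr_ge0.
rewrite exprMn cos2sin2; lra.
Qed.

End Trigo.

Section FiniteSums.
Variable R : realFieldType.

Lemma ler_sum_inj (I J : finType) (P : pred I) (f : I -> J) (G : J -> R) :
  {in P &, injective f} -> (forall j, 0 <= G j) ->
  \sum_(i | P i) G (f i) <= \sum_j G j.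
Proof.
move=> injf G0; pose A := [set i | P i]%SET.
have -> : \sum_(i | P i) G (f i) = \sum_(i in A) G (f i).
  by apply: eq_bigl => i; rewrite inE.
rewrite -(big_imset (h := f) (A := A) G) /=; last first.
  by move=> i j; rewrite !inE; exact: injf.
by rewrite [X in _ <= X](bigID [in f @: A]) /= lerDl sumr_ge0.
Qed.

(** Each positive k is the absolute value of at most two of the distinct integers f i, and 0 of at
    most one. *)
Lemma sum_int_inj_le (I : finType) (P : pred I) (f : I -> int) (J : nat) (g : nat -> R) :
  {in P &, injective f} -> (forall i, P i -> (`|f i| <= J)%N) -> (forall k, 0 <= g k) ->
  \sum_(i | P i) g `|f i|%N <= g 0%N + 2 * \sum_(1 <= k < J.+1) g k.
Proof.
move=> injf fJ g0.
pose h (i : I) : 'I_(J + J.+1) := insubd (rshift J ord0) (absz (f i + J%:Z)).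
have hE i : P i -> (h i : nat) = absz (f i + J%:Z).
  by move=> Pi; have := fJ i Pi => fi; rewrite /h val_insubd; case: ifP => //; lia.
pose G (k : 'I_(J + J.+1)) := g (absz ((k : nat)%:Z - J%:Z)).
have -> : \sum_(i | P i) g `|f i|%N = \sum_(i | P i) G (h i).
  apply: eq_bigr => i Pi; rewrite /G hE //; congr g.
  by have := fJ i Pi; lia.
have injh : {in P &, injective h}.
  move=> i j Pi Pj /(congr1 val) /=; rewrite !hE // => hij; apply: injf => //.
  by have := fJ i Pi; have := fJ j Pj; lia.
have G0 k : 0 <= G k by exact: g0.
apply: le_trans (ler_sum_inj injh G0) _.
rewrite big_split_ord /= big_ord_recl /= /G /= addn0 subrr mulr_natl mulr2n.
rewrite addrCA lerD2l big_add1 /= big_mkord; apply: lerD.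
  rewrite (reindex_inj rev_ord_inj) /= le_eqVlt; apply/orP; left; apply/eqP.
  by apply: eq_bigr => i _; congr g; have := ltn_ord i; lia.
rewrite le_eqVlt; apply/orP; left; apply/eqP.
by apply: eq_bigr => i _; congr g; rewrite /bump /=; lia.
Qed.

(** Schur's test: a i * a j is at most half the sum of the squares, and by symmetry both halves lead
    to row sums. *)
Lemma schur_bound (I : finType) (a : I -> R) (m : I -> I -> R) (B : R) :
  (forall i j, 0 <= m i j) -> (forall i j, m i j = m j i) ->
  (forall i, \sum_j m i j <= B) ->
  \sum_i \sum_j a i * a j * m i j <= B * \sum_i a i ^+ 2.
Proof.
move=> m0 mC mB.
have h : \sum_i \sum_j a i * a j * m i j <=
         \sum_i \sum_j (a i ^+ 2 * m i j + a j ^+ 2 * m j i) / 2.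
  apply: ler_sum => i _; apply: ler_sum => j _; rewrite (mC j i).
  have := m0 i j; move: (m i j) => x x0.
  have := mulr_ge0 (sqr_ge0 (a i - a j)) x0; nra.
apply: le_trans h _.
have -> : \sum_i \sum_j (a i ^+ 2 * m i j + a j ^+ 2 * m j i) / 2 =
          \sum_i a i ^+ 2 * \sum_j m i j.
  transitivity ((\sum_i \sum_j a i ^+ 2 * m i j + \sum_i \sum_j a j ^+ 2 * m j i) / 2).
    rewrite -big_split mulr_suml; apply: eq_bigr => i _ /=.
    by rewrite -big_split /= mulr_suml.
  rewrite [X in _ + X]exchange_big /= -mulr2n -[_ *+ 2]mulr_natr mulfK ?pnatr_eq0 //.
  by apply: eq_bigr => i _; rewrite mulr_sumr.
rewrite mulr_sumr; apply: ler_sum => i _; rewrite mulrC.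
by rewrite ler_wpM2r ?sqr_ge0.
Qed.

Lemma sqr_sum_le (I : finType) (a : I -> R) :
  (\sum_i a i) ^+ 2 <= #|I|%:R * \sum_i a i ^+ 2.
Proof.
rewrite expr2 mulr_suml.
have := @schur_bound I a (fun _ _ => 1) #|I|%:R.
move=> /(_ (fun _ _ => ler01) (fun _ _ => erefl)) h.
apply: le_trans (h _); last by move=> i; rewrite sumr_const.
apply: ler_sum => i _; rewrite mulr_sumr; apply: ler_sum => j _.
by rewrite mulr1.
Qed.

Lemma cauchy_schwarz (I : Type) (r : seq I) (P : pred I) (a b : I -> R) :
  (\sum_(i <- r | P i) a i * b i) ^+ 2 <=
  (\sum_(i <- r | P i) a i ^+ 2) * (\sum_(i <- r | P i) b i ^+ 2).
Proof.
set A := \sum_(i <- r | P i) a i ^+ 2; set B := \sum_(i <- r | P i) b i ^+ 2.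
set C := \sum_(i <- r | P i) a i * b i.
have B0 : 0 <= B by apply: sumr_ge0 => i _; exact: sqr_ge0.
have key s t : 0 <= s ^+ 2 * A - 2 * s * t * C + t ^+ 2 * B.
  have -> : s ^+ 2 * A - 2 * s * t * C + t ^+ 2 * B =
            \sum_(i <- r | P i) (s * a i - t * b i) ^+ 2.
    rewrite /A /B /C !mulr_sumr -sumrB -big_split /=.
    by apply: eq_bigr => i _; ring.
  by apply: sumr_ge0 => i _; exact: sqr_ge0.
have [B00|Bn0] := eqVneq B 0.
  (* If B = 0 the quadratic form is affine in t, and s = C, t = A + 1 already force C = 0. *)
  have := key C (A + 1); have A0 : 0 <= A by apply: sumr_ge0 => i _; exact: sqr_ge0.
  rewrite B00 !mulr0 addr0; have := sqr_ge0 C; nra.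
have Bp : 0 < B by rewrite lt_def Bn0.
have := key B C.
have -> : B ^+ 2 * A - 2 * B * C * C + C ^+ 2 * B = B * (A * B - C ^+ 2) by ring.
by rewrite pmulr_rge0 // subr_ge0.
Qed.

End FiniteSums.

Section Exponentials.
Variable R : realType.
Implicit Types (t s : R) (z : R[i]).
Local Notation nc := (@Normc.normc R).

Lemma nc_ge0 z : 0 <= nc z.
Proof. by case: z => a b; exact: sqrtr_ge0. Qed.

Lemma sqr_nc z : ((nc z) ^+ 2)%:C%C = z * conjc z.
Proof. by rewrite -sqr_normc normc_def rmorphXn /=; case: z. Qed.

Lemma ncJ z : nc (conjc z) = nc z.
Proof. by case: z => a b; rewrite /= sqrrN. Qed.

Lemma nc_real (x : R) : nc x%:C%C = `|x|.
Proof. by rewrite /= expr0n /= addr0 sqrtr_sqr. Qed.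

Lemma nc_sum (I : Type) (r : seq I) (P : pred I) (F : I -> R[i]) :
  nc (\sum_(i <- r | P i) F i) <= \sum_(i <- r | P i) nc (F i).
Proof.
elim/big_rec2: _ => [|i y z _ h]; first by rewrite Normc.normc0.
by apply: le_trans (le_normcD _ _) _; rewrite lerD2l.
Qed.

Lemma e0 : e (0 : R) = 1.
Proof. by rewrite /e mulr0 cos0 sin0. Qed.

Lemma eD s t : e (s + t) = e s * e t.
Proof.
apply/eqP; rewrite eq_complex /= mulrDr cosD sinD eqxx /=.
by rewrite addrC eqxx.
Qed.

Lemma eN t : e (- t) = conjc (e t).
Proof. by rewrite /e mulrN cosN sinN. Qed.

Lemma e_mulrn t n : e (n%:R * t) = e t ^+ n.
Proof.
elim: n => [|n IH]; first by rewrite mul0r e0 expr0.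
by rewrite -natr1 mulrDl mul1r eD IH exprSr.
Qed.

Lemma nc_e t : nc (e t) = 1.
Proof. by rewrite /= cos2Dsin2 sqrtr1. Qed.

Lemma e_nat n : e (n%:R : R) = 1.
Proof.
rewrite -(mulr1 n%:R) e_mulrn /e mulr1.
have -> : 2 * pi = pi *+ 2 :> R by rewrite mulr_natl.
by rewrite cos2pi sin2pi expr1n.
Qed.

Lemma e_int (m : int) : e (m%:~R : R) = 1.
Proof.
case: m => n; first exact: e_nat.
by rewrite NegzE mulrNz eN e_nat conjc1.
Qed.

Lemma nc_one_sub_e t : nc (1 - e t) = 2 * `|sin (pi * t)|.
Proof.
apply/eqP; rewrite -(@eqrXn2 _ 2) ?nc_ge0 ?mulr_ge0 //.
rewrite exprMn real_normK ?num_real // sin2cos2.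
have := cos2Dsin2 (2 * pi * t).
rewrite /e; have -> : 2 * pi * t = (pi * t) *+ 2 by rewrite -mulrA mulr_natl.
have := cos_mulr2n (pi * t).
move: (cos ((pi * t) *+ 2)) (sin ((pi * t) *+ 2)) (cos (pi * t)) => c s d cE csE.
rewrite /= sqr_sqrtr ?addr_ge0 ?sqr_ge0 //.
have -> : (1 - c) ^+ 2 + (0 - s) ^+ 2 = 1 - 2 * c + (c ^+ 2 + s ^+ 2) by ring.
by rewrite csE cE -mulr_natr; apply/eqP; ring.
Qed.

Lemma dist_int_le_half t : dist_int t <= 1 / 2.
Proof.
by rewrite /dist_int ge_min; case: (leP (t - _) (1/2)) => //= h; lra.
Qed.

Lemma normr_sin_dist_int t : `|sin (pi * t)| = sin (pi * dist_int t).
Proof.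
have pi0 := pi_gt0 R.
have [m mE] := dist_int_attained t.
have h : 2 * `|sin (pi * t)| = 2 * `|sin (pi * (t - m%:~R))|.
  by rewrite -!nc_one_sub_e eD eN e_int conjc1 mulr1.
have {}h : `|sin (pi * t)| = `|sin (pi * (t - m%:~R))| by lra.
rewrite h mE; have [p|p] := ger0P (t - m%:~R).
  have := dist_int_le_half t; rewrite mE ger0_norm // => p2.
  by rewrite ger0_norm // sin_ge0_pi //; apply/andP; split; nra.
have := dist_int_le_half t; rewrite mE ltr0_norm // => p2.
by rewrite mulrN sinN ler0_norm // -oppr_ge0 -sinN sin_ge0_pi //; apply/andP; split; nra.
Qed.

Definition dirichlet (M : nat) t : R[i] := \sum_(n < M) e (n%:R * t).

Lemma dirichletN M t : dirichlet M (- t) = conjc (dirichlet M t).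
Proof.
by rewrite /dirichlet rmorph_sum; apply: eq_bigr => n _; rewrite mulrN eN.
Qed.

Lemma dirichlet_le M t : nc (dirichlet M t) <= M%:R.
Proof.
apply: le_trans (nc_sum _ _ _) _.
by rewrite (eq_bigr (fun=> 1)) => [|n _]; rewrite ?nc_e // sumr_const card_ord.
Qed.

Lemma dirichlet_sin M t : nc (dirichlet M t) * `|sin (pi * t)| <= 1.
Proof.
have : nc (1 - e (M%:R * t)) <= 2.
  by rewrite nc_one_sub_e; have := sin_max (pi * (M%:R * t)); lra.
rewrite e_mulrn.
have -> : 1 - e t ^+ M = (1 - e t) * dirichlet M t.
  rewrite -opprB subrX1 -mulNr opprB; congr (_ * _).
  by apply: eq_bigr => i _; rewrite e_mulrn.
by rewrite Normc.normcM nc_one_sub_e; lra.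
Qed.

Lemma inv_sqr_sin_le t : 0 < dist_int t ->
  `|sin (pi * t)| ^- 2 <= 100 / 961 * dist_int t ^- 2 + 1.
Proof.
move=> d0; rewrite normr_sin_dist_int.
have pi0 := pi_gt0 R; have pi3 := pi_ge31 R; have d2 := dist_int_le_half t.
have := @sqr_le_sqr_sin R (pi * dist_int t) ltac:(apply/andP; split; nra).
have : 0 < sin (pi * dist_int t) by apply: sin_gt0_pi; apply/andP; split; nra.
move: (sin (pi * dist_int t)) => s; move: (dist_int t) d0 d2 => d d0 d2 s0 h.
have s2 : 0 < s ^+ 2 by rewrite exprn_gt0.
have dd : 0 < d ^+ 2 by rewrite exprn_gt0.
rewrite -(ler_pM2l s2) mulfV ?gt_eqF // -(ler_pM2r dd) mul1r.
have -> : s ^+ 2 * (100 / 961 * d ^- 2 + 1) * d ^+ 2 = s ^+ 2 * (100 / 961 + d ^+ 2).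
  by field; lra.
have p2 : 961 / 100 <= pi ^+ 2 :> R by nra.
rewrite exprMn in h.
have q : 0 < pi ^+ 2 :> R by lra.
rewrite -(ler_pM2l q); move: (d ^+ 2) (s ^+ 2) (pi ^+ 2) h p2 dd s2 q => D S P h p2 dd s2 q.
nra.
Qed.

Lemma dirichlet2_le M L t : 0 < dist_int t ->
  nc (dirichlet M t) * nc (dirichlet L t) <= 100 / 961 * dist_int t ^- 2 + 1.
Proof.
move=> d0; apply: le_trans (inv_sqr_sin_le d0).
have pi0 := pi_gt0 R; have d2 := dist_int_le_half t.
have s0 : 0 < `|sin (pi * t)|.
  by rewrite normr_sin_dist_int; apply: sin_gt0_pi; apply/andP; split; nra.
rewrite -div1r ler_pdivlMr ?exprn_gt0 //.
have := dirichlet_sin M t; have := dirichlet_sin L t.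
move: (nc_ge0 (dirichlet M t)) (nc_ge0 (dirichlet L t)).
move: (nc (dirichlet M t) : R) (nc (dirichlet L t) : R) (`|sin (pi * t)| : R) s0 => a b s s0 a0 b0 h1 h2.
have -> : a * b * s ^+ 2 = (a * s) * (b * s) by ring.
by apply: mulr_ile1 => //; apply: mulr_ge0 => //; exact: ltW.
Qed.

Lemma dirichlet_dist_le M t : 0 < dist_int t -> nc (dirichlet M t) <= (dist_int t)^-1.
Proof.
move=> d0; have := dirichlet2_le M M d0; have d2 := dist_int_le_half t.
move: (dist_int t) (nc (dirichlet M t) : R) (nc_ge0 (dirichlet M t)) d0 d2 => d a a0 d0 d2 h.
have dd : 0 < d^-1 by rewrite invr_gt0.
rewrite -ler_sqr ?nnegrE // ?(ltW dd) // expr2; apply: le_trans h _.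
have : 2 <= d^-1 by rewrite -[2]invrK lef_pV2 ?posrE; lra.
by rewrite -exprVn; move: (d^-1) dd => w; nra.
Qed.

Lemma sum_sqr_expand (I : finType) (b : I -> R[i]) (th : I -> R) (M : nat) :
  (\sum_(n < M) nc (\sum_i b i * e (n%:R * th i)) ^+ 2)%:C%C =
  \sum_i \sum_j b i * conjc (b j) * dirichlet M (th i - th j).
Proof.
rewrite rmorph_sum /=.
under eq_bigr => n _ do rewrite sqr_nc rmorph_sum /= mulr_suml.
rewrite exchange_big; apply: eq_bigr => i _ /=.
under eq_bigr => n _ do rewrite mulr_sumr.
rewrite exchange_big; apply: eq_bigr => j _ /=.
rewrite mulr_sumr; apply: eq_bigr => n _.
have conjM (u v : R[i]) : conjc (u * v) = conjc u * conjc v by exact: rmorphM.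
rewrite conjM mulrBr.
rewrite eD.
rewrite eN.
rewrite -!mulrA.
congr (_ * _).
rewrite mulrCA.
by [].
Qed.
End Exponentials.

Section LargeSieve.
Variable R : realType.
Implicit Types (t s : R).
Local Notation nc := (@Normc.normc R).

Lemma sum_inv_sqr_le n : \sum_(1 <= k < n.+1) (k%:R ^+ 2)^-1 <= 1647 / 1000 :> R.
Proof.
(* From k = 4 on, 1/k^2 is compared with 1/(k - 1/2) - 1/(k + 1/2), which telescopes; 49/36 + 2/7 is
   just below 1.647. *)
have h m : \sum_(1 <= k < m.+4) (k%:R ^+ 2)^-1 <= 1647 / 1000 - (m%:R + 7 / 2)^-1 :> R.
  elim: m => [|m IH].
    have -> : \sum_(1 <= k < 4) (k%:R ^+ 2)^-1 = 49 / 36 :> R.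
      by rewrite 3?big_nat_recr //= big_geq //; field.
    have -> : (0%:R + 7 / 2)^-1 = 2 / 7 :> R by field.
    lra.
  rewrite big_nat_recr //=.
  have m0 : 0 <= m%:R :> R by rewrite ler0n.
  have : (m.+4%:R ^+ 2)^-1 <= (m%:R + 7 / 2)^-1 - (m.+1%:R + 7 / 2)^-1 :> R.
    have -> : m.+4%:R = m%:R + 4 :> R by rewrite -addn4 natrD.
    have -> : m.+1%:R = m%:R + 1 :> R by rewrite -addn1 natrD.
    have -> : (m%:R + 7 / 2)^-1 - (m%:R + 1 + 7 / 2)^-1 =
              ((m%:R + 7 / 2) * (m%:R + 9 / 2))^-1 :> R.
      by field; apply/andP; split; lra.
    rewrite lef_pV2 ?posrE; nra.
  by move: IH; move: ((_ ^+ 2)^-1) ((_ + _)^-1) ((_ + _)^-1) (\sum_(_ <= _ < _) _) => *; lra.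
have [n3|n3] := leqP n 3; last first.
  case: n n3 => [|[|[|n]]] // _.
  apply: le_trans (h n) _; rewrite gerBl invr_ge0.
  by rewrite addr_ge0 ?ler0n //; lra.
apply: le_trans (_ : \sum_(1 <= k < 4) (k%:R ^+ 2)^-1 <= _); last first.
  have -> : \sum_(1 <= k < 4) (k%:R ^+ 2)^-1 = 49 / 36 :> R.
    by rewrite 3?big_nat_recr //= big_geq //; field.
  lra.
rewrite [leRHS](big_cat_nat (n := n.+1)) //= lerDl.
by apply: sumr_ge0 => k _; rewrite invr_ge0 sqr_ge0.
Qed.

(** The representative of t modulo 1 in (-1/2, 1/2]. Unlike [dist_int] it keeps the side on which t
    lies, so that spaced points can be sent to distinct cells of the line. *)
Definition centered t : R :=
  let f := t - (Num.floor t)%:~R in if f <= 1 - f then f else f - 1.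

Lemma normr_centered t : `|centered t| = dist_int t.
Proof.
have /andP[h1 h2] := floor_itv t; rewrite intrD in h2.
rewrite /centered /dist_int; case: leP => h; first by rewrite ger0_norm; lra.
by rewrite ler0_norm; lra.
Qed.

Lemma centeredE t : exists m : int, centered t = t - m%:~R.
Proof.
rewrite /centered; case: ifP => _; first by exists (Num.floor t).
by exists (Num.floor t + 1); rewrite intrD; ring.
Qed.

Lemma dist_int_centered s t : dist_int (s - t) <= `|centered s - centered t|.
Proof.
have [m ->] := centeredE s; have [n ->] := centeredE t.
have -> : s - m%:~R - (t - n%:~R) = s - t - (m - n)%:~R by rewrite intrB; ring.
exact: dist_int_le.
Qed.

(** The cell of a point is the integer nearest to [centered (y i) / s], and spacing makes the cells
    distinct. A point in cell k or -k, k > 0, is at distance at least (k - 1/2) s >= k s / 2 from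
    the integers, where the kernel is at most 2 / (k s); the harmonic sum makes the logarithm. *)
Lemma spaced_dirichlet_sum (I : finType) (P : pred I) (y : I -> R) (s : R) (M : nat) :
  0 < s <= 1 -> {in P &, forall i j, i != j -> s <= dist_int (y i - y j)} ->
  \sum_(i | P i) nc (dirichlet M (y i)) <= M%:R + 4 / s * (1 - ln s).
Proof.
move=> /andP[s0 s1] sp; have si : 0 < s^-1 by rewrite invr_gt0.
pose f i := Num.floor (centered (y i) / s + 1 / 2).
pose J := Num.truncn (1 / 2 / s + 1 / 2).
pose g k : R := if k is 0%N then M%:R else 2 / (k%:R * s).
have fP i : (f i)%:~R <= centered (y i) / s + 1 / 2 < (f i)%:~R + 1.
  by have := floor_itv (centered (y i) / s + 1 / 2); rewrite intrD.
have cs i : `|centered (y i)| / s <= 1 / 2 / s.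
  by rewrite ler_pM2r // normr_centered dist_int_le_half.
have fabs i : (`|f i|%N)%:R = `|(f i)%:~R| :> R by rewrite -intr_norm natr_absz.
have fJ i : P i -> (`|f i| <= J)%N.
  move=> _; rewrite /J truncn_ge_nat; last by rewrite addr_ge0 //; nra.
  rewrite fabs ler_norml; have := fP i; have := cs i.
  rewrite -{1}(gtr0_norm si) -normrM ler_norml.
  by move: (centered _ / s) (1 / 2 / s) => u v /andP[? ?] /andP[? ?]; apply/andP; split; lra.
have g0 k : 0 <= g k.
  by case: k => [|k] /=; rewrite ?ler0n // divr_ge0 // mulr_ge0 // ltW.
have finj : {in P &, injective f}.
  move=> i j Pi Pj fij; apply/eqP/negPn/negP => ij.
  have := le_trans (sp i j Pi Pj ij) (dist_int_centered (y i) (y j)).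
  apply/negP; rewrite -ltNge -(ltr_pM2r si) mulfV ?gt_eqF //.
  rewrite -{1}(gtr0_norm si) -normrM mulrBl.
  have := fP i; have := fP j; rewrite fij.
  by move: (centered (y i) / s) (centered (y j) / s) => u v; rewrite ltr_norml; lra.
apply: le_trans (_ : \sum_(i | P i) g `|f i|%N <= _).
  apply: ler_sum => i _; rewrite /g; case E : `|f i|%N => [|k]; first exact: dirichlet_le.
  have fi : k.+1%:R - 1 / 2 <= `|centered (y i)| / s.
    rewrite -E fabs -{1}(gtr0_norm si) -normrM.
    have := fP i; move: (centered (y i) / s) => u.
    move: E => /(congr1 (fun n => n%:R : R)); rewrite fabs.
    have : 1 <= k.+1%:R :> R by rewrite ler1n.
    have [p|p] := ger0P ((f i)%:~R : R) => k1 hk /andP[? ?]; rewrite -?hk.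
      by apply: le_trans (ler_norm _); lra.
    by rewrite -normrN; apply: le_trans (ler_norm _); lra.
  have k1 : 1 <= k.+1%:R :> R by rewrite ler1n.
  have d1 : k.+1%:R * s / 2 <= dist_int (y i).
    rewrite -normr_centered mulrAC -ler_pdivlMr //.
    by apply: le_trans fi; lra.
  have d0 : 0 < k.+1%:R * s / 2 by rewrite divr_gt0 // mulr_gt0 //; lra.
  apply: le_trans (dirichlet_dist_le _ _) _; first exact: lt_le_trans d1.
  by rewrite -[2 / _]invf_div lef_pV2 ?posrE // (lt_le_trans d0).
apply: le_trans (sum_int_inj_le finj fJ g0) _; rewrite /= lerD2l.
have -> : \sum_(1 <= k < J.+1) g k = 2 / s * \sum_(1 <= k < J.+1) k%:R^-1.
  rewrite mulr_sumr; apply: eq_big_nat => k /andP[k0 _].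
  by case: k k0 => // k _; rewrite /g invfM; ring.
have -> : 4 / s * (1 - ln s) = 2 * (2 / s * (1 - ln s)) by ring.
rewrite ler_pM2l // ler_pM2l ?divr_gt0 //; apply: le_trans (harmonic_le _ _) _.
rewrite lerD2l -lnV ?posrE //.
have [->|J0] := posnP J; first by rewrite ln0 // ln_ge0 // -[1]invr1 lef_pV2 ?posrE.
rewrite ler_ln ?posrE ?ltr0n //.
apply: le_trans (_ : 1 / 2 / s + 1 / 2 <= _).
  by rewrite truncn_le addr_ge0 //; nra.
have : 1 <= s^-1 by rewrite -[1]invr1 lef_pV2 ?posrE.
by move: (s^-1) => v; lra.
Qed.

Lemma opp_int_absurd (u v : int) :
  u = - v -> 0 <= u -> 0 <= v -> (0 < `|u|)%N -> False.
Proof. by move=> -> *; lia. Qed.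

(** A row sum for Schur's test. Dividing by delta and rounding towards zero numbers the points j !=
    i by distinct nonzero integers, a point numbered k or -k being at distance at least k delta.
    Then 2 * 100/961 * 1.647 < 0.343, and the terms 1 are at most 1/delta in number. *)
Lemma large_sieve_row (I : finType) (x : I -> R) (delta : R) (i : I) :
  0 < delta -> (forall j k, j != k -> delta <= dist_int (x j - x k)) ->
  \sum_(j | j != i) (100 / 961 * dist_int (x i - x j) ^- 2 + 1)
  <= 343 / 1000 / delta ^+ 2 + delta^-1.
Proof.
have [a [a0 aE]] : exists a : R, 0 < a /\ a = 100 / 961.
  exists (100 / 961); split; [lra|reflexivity].
rewrite -aE => d0 sp; have di : 0 < delta^-1 by rewrite invr_gt0.
pose y j := centered (x i - x j).
pose f j : int := if 0 <= y j then Num.floor (y j / delta) else - Num.floor (- y j / delta).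
pose J := Num.truncn (1 / 2 / delta).
pose g k : R := if k is 0%N then 0 else a / (delta ^+ 2) * (k%:R ^+ 2)^-1 + 1.
have yd j : j != i -> delta <= `|y j|.
  by move=> ji; rewrite normr_centered; apply: sp; rewrite eq_sym.
have fabs j : j != i -> [/\ (0 < `|f j|)%N, `|f j|%:R <= `|y j| / delta & `|y j| / delta < `|f j|%:R + 1].
  move=> ji; have := yd j ji; rewrite /f -(ler_pM2r di) mulfV ?gt_eqF //.
  have fl (u : R) : 1 <= u -> (0 < `|Num.floor u|)%N /\ `|Num.floor u|%:R <= u < `|Num.floor u|%:R + 1.
    move=> u1; have := floor_itv u; rewrite intrD.
    have : 1 <= Num.floor u by rewrite floor_ge_int.
    by case: (Num.floor u) => n //= n1 /andP[? ?]; split => //; apply/andP.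
  have [p|p] := leP 0 (y j).
    by rewrite (ger0_norm p) => /fl[? /andP[? ?]].
  by rewrite (ltr0_norm p) abszN => /fl[? /andP[? ?]].
have fJ j : j != i -> (`|f j| <= J)%N.
  move=> ji; have [_ h _] := fabs j ji.
  rewrite truncn_ge_nat; last by rewrite divr_ge0 // ltW.
  by apply: le_trans h _; rewrite ler_pM2r // normr_centered dist_int_le_half.
have g0 k : 0 <= g k.
  by case: k => [//|k] /=; rewrite addr_ge0 // mulr_ge0 ?invr_ge0 ?sqr_ge0 // divr_ge0 ?sqr_ge0 ?(ltW a0).
have finj : {in (fun j => j != i) &, injective f}.
  move=> j k ji ki fjk; apply/eqP/negPn/negP => jk.
  have := sp k j ltac:(by rewrite eq_sym).
  have -> : x k - x j = (x i - x j) - (x i - x k) by ring.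
  move=> h; have := le_trans h (dist_int_centered _ _); rewrite -/(y j) -/(y k).
  apply/negP; rewrite -ltNge -(ltr_pM2r di) mulfV ?gt_eqF //.
  rewrite -{1}(gtr0_norm di) -normrM mulrBl.
  have [j1 j2 j3] := fabs j ji; have [k1 k2 k3] := fabs k ki.
  move: j1 k1 j2 j3 k2 k3; rewrite fjk => _ k1.
  have sg : (0 <= y j) = (0 <= y k).
    have fl0 (u : R) : 0 <= u -> 0 <= Num.floor (u / delta).
      by move=> u0; rewrite floor_ge_int // divr_ge0 // ltW.
    have [jp _ _] := fabs j ji; move: fjk k1 jp; rewrite /f.
    have [pj|pj] := leP 0 (y j); have [pk|pk] := leP 0 (y k) => // fjk k1 jp.
      case: (opp_int_absurd fjk _ _ jp); first exact: fl0.
      by apply: fl0; rewrite oppr_ge0 ltW.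
    case: (opp_int_absurd (esym fjk) _ _ k1); first exact: fl0.
    by apply: fl0; rewrite oppr_ge0 ltW.
  move: sg; have [pj|pj] := leP 0 (y j); have [pk|pk] := leP 0 (y k) => // _.
    rewrite (ger0_norm pj) (ger0_norm pk).
    move: (y j / delta) (y k / delta) (`|f k|%:R : R) => u v w.
    by rewrite ltr_norml; lra.
  rewrite (ltr0_norm pj) (ltr0_norm pk) !mulNr; move: (y j / delta) (y k / delta) (`|f k|%:R : R) => u v w.
  by rewrite ltr_norml; lra.
apply: le_trans (_ : \sum_(j | j != i) g `|f j|%N <= _).
  apply: ler_sum => j ji; have [j1 j2 j3] := fabs j ji; rewrite /g.
  case E : `|f j|%N j1 j2 => [//|k] _ j2; rewrite lerD2r -mulrA -invfM.
  rewrite ler_pM2l //.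
  have k0 : 0 < k.+1%:R * delta by rewrite mulr_gt0 // ltr0n.
  have kd : k.+1%:R * delta <= dist_int (x i - x j) by rewrite -normr_centered -ler_pdivlMr.
  rewrite -exprMn [delta * _]mulrC lef_pV2 ?posrE ?exprn_gt0 ?(lt_le_trans k0) //.
  by rewrite ler_sqr ?nnegrE ?(ltW k0) // (le_trans (ltW k0)).
apply: le_trans (sum_int_inj_le finj fJ g0) _; rewrite /= add0r.
have -> : \sum_(1 <= k < J.+1) g k =
    a / (delta ^+ 2) * (\sum_(1 <= k < J.+1) (k%:R ^+ 2)^-1) + J%:R.
  transitivity (\sum_(1 <= k < J.+1) (a / (delta ^+ 2) * (k%:R ^+ 2)^-1 + 1)).
    by apply: eq_big_nat => k /andP[k0 _]; case: k k0.
  by rewrite big_split -mulr_sumr /= sumr_const_nat subn1.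
have hJ : J%:R <= 1 / 2 / delta by rewrite truncn_le divr_ge0 // ltW.
have dd : 0 < (delta ^+ 2)^-1 by rewrite invr_gt0 exprn_gt0.
have := sum_inv_sqr_le J; move: (\sum_(_ <= _ < _) _) => S hS.
have : (delta ^+ 2)^-1 * S <= (delta ^+ 2)^-1 * (1647 / 1000) by rewrite ler_pM2l.
by rewrite aE; move: hJ dd; move: ((delta ^+ 2)^-1) (delta^-1) (J%:R : R) => v w b; lra.
Qed.

Lemma sum_sqr_le (I : finType) (c : I -> R[i]) (z : I -> I -> R[i]) (A : R) :
  A%:C%C = \sum_i \sum_j c i * conjc (c j) * z i j ->
  A <= \sum_i \sum_j nc (c i) * nc (c j) * nc (z i j).
Proof.
move=> AE; apply: le_trans (ler_norm _) _; rewrite -nc_real AE.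
apply: le_trans (nc_sum _ _ _) _; apply: ler_sum => i _.
apply: le_trans (nc_sum _ _ _) _; apply: ler_sum => j _.
by rewrite !Normc.normcM ncJ.
Qed.

(* The window n < M is covered L times by the M + L shifted frequencies, which
   replaces the Dirichlet kernel by a product of two of them, hence a quadratically
   decaying kernel. *)
Lemma large_sieve_window (I : finType) (x : I -> R) (c : I -> R[i]) (M L : nat) :
  L%:R * \sum_(n < M) nc (\sum_i c i * e (n%:R * x i)) ^+ 2 <=
  \sum_i \sum_j nc (c i) * nc (c j) *
    nc (dirichlet (M + L) (x i - x j) * dirichlet L (- (x i - x j))).
Proof.
pose b (l : nat) i := c i * e (- (l%:R * x i)).
apply: le_trans (_ : \sum_(l < L) \sum_(n < M + L) nc (\sum_i b l i * e (n%:R * x i)) ^+ 2 <= _).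
  rewrite mulr_natl -[X in _ *+ X]card_ord -sumr_const; apply: ler_sum => l _.
  have lt (n : 'I_M) : (n + l < M + L)%N by have := ltn_ord n; have := ltn_ord l; lia.
  pose f n := Ordinal (lt n).
  pose G (n : 'I_(M + L)) := nc (\sum_i b l i * e (n%:R * x i)) ^+ 2.
  have injf : {in xpredT &, injective f}.
    by move=> m n _ _ /(congr1 val) /= /addIn /val_inj.
  apply: le_trans (ler_sum_inj injf (G := G) _) => [|n]; last exact: sqr_ge0.
  rewrite le_eqVlt; apply/orP; left; apply/eqP; apply: eq_bigr => n _; rewrite /G /=.
  congr (nc _ ^+ 2); apply: eq_bigr => i _; rewrite /b -mulrA -eD; congr (_ * e _).
  by rewrite natrD; ring.
apply: (@sum_sqr_le I c (fun i j => dirichlet (M + L) (x i - x j) * dirichlet L (- (x i - x j)))).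
rewrite rmorph_sum /=; under eq_bigr => l _ do rewrite sum_sqr_expand.
rewrite exchange_big; apply: eq_bigr => i _ /=.
rewrite exchange_big; apply: eq_bigr => j _ /=.
rewrite [dirichlet L _]/dirichlet !mulr_sumr; apply: eq_bigr => l _.
have conjM (u v : R[i]) : conjc (u * v) = conjc u * conjc v by exact: rmorphM.
rewrite /b conjM -eN opprK mulrN mulrBr opprB addrC eD.
move: (e _) (e _) (c i) (conjc (c j)) (dirichlet _ _) => p q u v w.
by rewrite -!mulrA; congr (_ * _); rewrite mulrCA; congr (_ * _); rewrite mulrC -mulrA mulrCA.
Qed.

(** After division by L the row bound is M + L + 0.343 / (L delta^2) up to a bounded term. L near
    0.6 / delta is close to optimal, and the optimum 2 sqrt(0.343) = 1.1713 is below 47/40. *)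
Lemma large_sieve_dual (I : finType) (x : I -> R) (c : I -> R[i]) (delta : R) (M : nat) :
  0 < delta -> (forall j k, j != k -> delta <= dist_int (x j - x k)) ->
  \sum_(n < M) nc (\sum_i c i * e (n%:R * x i)) ^+ 2 <=
  (M%:R + 47 / 40 / delta + 3) * \sum_i nc (c i) ^+ 2.
Proof.
move=> d0 sp; have di : 0 < delta^-1 by rewrite invr_gt0.
pose L := (Num.truncn (3 / 5 / delta)).+1.
have L0 : 0 < L%:R :> R by rewrite ltr0n.
have L35 : 0 <= 3 / 5 / delta by rewrite divr_ge0 // ltW.
have L1 : 3 / 5 / delta <= L%:R by have /andP[_ /ltW] := truncn_itv L35.
have L2 : L%:R <= 3 / 5 / delta + 1 by rewrite /L -natr1 lerD2r truncn_le.
rewrite -(ler_pM2l L0); apply: le_trans (large_sieve_window x c M L) _.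
rewrite mulrA; apply: schur_bound => [i j|i j|i].
- exact: nc_ge0.
- rewrite -(opprB (x j)) opprK !Normc.normcM dirichletN ncJ; congr (_ * _).
  by rewrite dirichletN ncJ.
rewrite (bigD1 i) //=.
apply: le_trans (_ : (M + L)%:R * L%:R + (343 / 1000 / delta ^+ 2 + delta^-1) <= _).
  apply: lerD.
    rewrite Normc.normcM; apply: ler_pM; rewrite ?nc_ge0 ?dirichlet_le //.
  apply: le_trans (large_sieve_row i d0 sp); apply: ler_sum => j ji.
  rewrite Normc.normcM dirichletN ncJ; apply: dirichlet2_le.
  by apply: lt_le_trans d0 _; apply: sp; rewrite eq_sym.
rewrite natrD; have -> : (delta ^+ 2)^-1 = delta^-1 ^+ 2 by rewrite exprVn.
move: L1 L2 L0 di; move: (L%:R : R) (M%:R : R) (delta^-1) => l m v L1 L2 L0 di.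
suff : l ^+ 2 + 343 / 1000 * v ^+ 2 + v <= l * (47 / 40 * v + 3) by rewrite expr2; lra.
nra.
Qed.

End LargeSieve.

(** * The sieve *)

Lemma coprime_prod_seq (p : nat) (s : seq nat) :
  prime p -> all prime s -> p \notin s -> coprime p (\prod_(q <- s) q).
Proof.
move=> pp; elim: s => [|q s IH] /=; first by rewrite big_nil coprimen1.
move=> /andP[pq ps]; rewrite inE negb_or big_cons coprimeMr => /andP[pnq pns].
by rewrite IH // andbT prime_coprime // dvdn_prime2.
Qed.

Lemma prod_seq_dvdn (s : seq nat) (n : nat) :
  uniq s -> all prime s -> (forall p, p \in s -> (p %| n)%N) -> (\prod_(q <- s) q %| n)%N.
Proof.
elim: s => [|p s IH] /=; first by rewrite big_nil dvd1n.
move=> /andP[ps us] /andP[pp als] H; rewrite big_cons.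
rewrite Gauss_dvd; last by rewrite coprime_prod_seq.
rewrite H ?mem_head //=; apply: IH => // q qs.
by rewrite H // inE qs orbT.
Qed.

(** Toggling a fixed element of U is a sign-reversing involution on the subsets V. *)
Lemma sum_sign_subset (S : numDomainType) (T : finType) (U : {set T}) :
  \sum_(V : {set T} | V \subset U) (-1) ^+ #|V| = (#|U| == 0)%N%:R :> S.
Proof.
case: (finset.set_0Vmem U) => [->|[p pU]].
  rewrite cards0 (big_pred1 finset.set0) ?cards0 ?expr0 // => V.
  by rewrite finset.subset0.
have -> : (#|U| == 0)%N = false by rewrite (cardsD1 p) pU.
pose h (V : {set T}) := if p \in V then V :\ p else p |: V.
have hK V : h (h V) = V.
  rewrite {2}/h; case: ifP => pV; rewrite /h; first by rewrite setD11 finset.setD1K.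
  by rewrite setU11 setU1K // pV.
have hU V : (h V \subset U) = (V \subset U).
  rewrite /h; case: ifP => pV; last by rewrite finset.subUset finset.sub1set pU.
  by rewrite -{2}(finset.setD1K pV) finset.subUset finset.sub1set pU.
set s := LHS; have : s = - s.
  rewrite {1}/s (reindex_inj (can_inj hK)) -sumrN.
  apply: eq_big => [V|V _]; first exact: hU.
  rewrite /h; case: ifP => pV; last by rewrite cardsU1 pV exprS mulN1r.
  by rewrite [in RHS](cardsD1 p) pV exprS mulN1r opprK.
move/eqP; rewrite -subr_eq0 opprK -mulr2n mulrn_eq0 /= => /eqP -> //.
Qed.

(** * Additive characters modulo P and Ramanujan sums *)

Section SieveGroup.
Variable R : realType.
Variables (b : nat) (A : {set 'I_b}).
Hypothesis A_prime : forall p : 'I_b, p \in A -> prime p.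
Implicit Types (U V : {set 'I_b}).
Local Notation nc := (@Normc.normc R).

Definition prodset U : nat := (\prod_(p in U) p)%N.
Local Notation P := (prodset A).

Lemma prodset0 : prodset finset.set0 = 1%N.
Proof. by rewrite /prodset finset.big_set0. Qed.

Lemma prodset_gt0 U : U \subset A -> (0 < prodset U)%N.
Proof.
by move=> /fintype.subsetP UA; apply: prodn_cond_gt0 => p /UA /A_prime /prime_gt0.
Qed.

Lemma prodset_setID U V : prodset V = (prodset (V :&: U) * prodset (V :\: U))%N.
Proof. by rewrite /prodset (big_setID U). Qed.

Lemma prodsetD U V : U \subset V -> prodset V = (prodset U * prodset (V :\: U))%N.
Proof. by move=> /finset.setIidPr UV; rewrite (prodset_setID U) UV. Qed.

Lemma mem_dvd_prodset p U : p \in U -> (p %| prodset U)%N.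
Proof. by move=> pU; rewrite /prodset (bigD1 p) //= dvdn_mulr. Qed.

Lemma prodset_dvd U n : U \subset A ->
  (forall p, p \in U -> (p %| n)%N) -> (prodset U %| n)%N.
Proof.
move=> /fintype.subsetP UA H.
have -> : prodset U = (\prod_(q <- map val (enum U)) q)%N.
  by rewrite big_map big_enum.
apply: prod_seq_dvdn.
- by rewrite map_inj_uniq ?enum_uniq //; exact: val_inj.
- by apply/allP => _ /mapP[p + ->]; rewrite mem_enum => /UA /A_prime.
- by move=> _ /mapP[p + ->]; rewrite mem_enum => /H.
Qed.

Lemma prodset_gt1 U p : U \subset A -> p \in U -> (1 < prodset U)%N.
Proof.
move=> UA pU; have pp : prime p by apply: A_prime; exact: (fintype.subsetP UA).
by apply: leq_trans (prime_gt1 pp) _; apply: dvdn_leq; [exact: prodset_gt0|exact: mem_dvd_prodset].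
Qed.

Let P_gt0 : (0 < P)%N. Proof. exact: prodset_gt0. Qed.
Let PE : P.-1.+1 = P. Proof. exact: prednK. Qed.

(* Residues c modulo P stand for the characters n |-> e(n c / P); the primes in the
   support of c are those of the reduced denominator of c / P. *)
Definition supp (c : 'I_P.-1.+1) : {set 'I_b} := [set p in A | ~~ (p %| c)%N]%SET.

Lemma supp_sub c : supp c \subset A.
Proof. by apply/fintype.subsetP => p; rewrite inE => /andP[]. Qed.

Lemma dvdn_modP (p : 'I_b) n : p \in A -> (p %| n %% P.-1.+1)%N = (p %| n)%N.
Proof. by move=> pA; rewrite /dvdn modn_dvdm // PE mem_dvd_prodset. Qed.

Lemma supp0 : supp 0 = finset.set0.
Proof. by apply/setP => p; rewrite !inE dvdn0 andbF. Qed.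

Lemma suppD c d : supp (c + d) \subset supp c :|: supp d.
Proof.
apply/fintype.subsetP => p; rewrite !inE => /andP[pA]; rewrite pA /= dvdn_modP //.
by apply: contraR; rewrite negb_or !negbK => /andP[pc pd]; rewrite dvdn_add.
Qed.

Lemma suppN_sub c : supp (- c) \subset supp c.
Proof.
apply/fintype.subsetP => p; rewrite !inE => /andP[pA]; rewrite pA /= dvdn_modP //.
by apply: contra => pc; rewrite dvdn_sub // PE mem_dvd_prodset.
Qed.

Lemma suppN c : supp (- c) = supp c.
Proof.
by apply/eqP; rewrite finset.eqEsubset suppN_sub -{1}(opprK c) suppN_sub.
Qed.

Lemma supp_subE c U : U \subset A -> (supp c \subset U) = (prodset (A :\: U) %| c)%N.
Proof.
move=> UA; apply/idP/idP => [/fintype.subsetP cU|Uc].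
  apply: prodset_dvd => [|p]; first exact: finset.subsetDl.
  rewrite inE => /andP[pU pA]; apply: contraR pU => pc; apply: cU.
  by rewrite inE pA.
apply/fintype.subsetP => p; rewrite inE => /andP[pA]; apply: contraR => pU.
by apply: dvdn_trans Uc; apply: mem_dvd_prodset; rewrite inE pU.
Qed.

Lemma supp_eq0 c : supp c = finset.set0 -> c = 0.
Proof.
move=> c0; have : supp c \subset finset.set0 by rewrite c0.
rewrite supp_subE ?finset.sub0set // finset.setD0 => /dvdnP[k ck].
apply: val_inj => /=; rewrite ck; case: k ck => // k ck.
by have := ltn_ord c; rewrite {2}PE ck ltnNge mulSn leq_addr.
Qed.

Lemma card_supp_sub U : U \subset A -> (#|[set c | supp c \subset U]%SET| <= prodset U)%N.
Proof.
move=> UA; have U0 := prodset_gt0 UA.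
have D0 : (0 < prodset (A :\: U))%N by apply: prodset_gt0; exact: finset.subsetDl.
pose f (c : 'I_P.-1.+1) : 'I_(prodset U).-1.+1 := inord (c %/ prodset (A :\: U)).
have fE c : f c = (c %/ prodset (A :\: U))%N :> nat.
  rewrite inordK //; rewrite (prednK U0) ltn_divLR // -(prodsetD UA).
  by have := ltn_ord c; rewrite {2}PE.
rewrite -[X in (_ <= X)%N](prednK U0) -[X in (_ <= X)%N]card_ord.
rewrite -(@card_in_imset _ _ f) ?max_card // => c d.
rewrite !inE !supp_subE // => hc hd /(congr1 val) /=; rewrite !fE => h.
by apply: val_inj; rewrite -[val c](divnK hc) -[val d](divnK hd) h.
Qed.

Definition chi (n : nat) (c : 'I_P.-1.+1) : R[i] := e (n%:R * (c%:R / P%:R)).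

Let PR_gt0 : 0 < P%:R :> R. Proof. by rewrite ltr0n. Qed.

Lemma chiD n c d : chi n (c + d) = chi n c * chi n d.
Proof.
have h : (c + d)%N = ((c + d) %/ P.-1.+1 * P + (c + d)%R)%N.
  apply: etrans (divn_eq (c + d)%N P.-1.+1) _.
  by congr (_ * _ + _)%N; exact: PE.
rewrite /chi -eD -mulrDr -mulrDl -natrD h natrD natrM mulrDl mulfK ?gt_eqF //.
by rewrite mulrDr eD -natrM e_nat mul1r.
Qed.

Lemma chi0 n : chi n 0 = 1.
Proof. by rewrite /chi mul0r mulr0 e0. Qed.

Lemma nc_chi n c : nc (chi n c) = 1.
Proof. exact: nc_e. Qed.

Lemma dist_int_gt0 (t : R) : (forall m : int, t <> m%:~R) -> 0 < dist_int t.
Proof.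
move=> tm; have [m ->] := dist_int_attained t.
by rewrite normr_gt0 subr_eq0; apply/eqP.
Qed.

Lemma e_neq1 (t : R) : (forall m : int, t <> m%:~R) -> 1 - e t != 0.
Proof.
move=> /dist_int_gt0 d0; apply/eqP => h.
have := nc_one_sub_e t; rewrite h Normc.normc0 normr_sin_dist_int.
have pi0 := pi_gt0 R; have d2 := dist_int_le_half t.
have : 0 < sin (pi * dist_int t) by apply: sin_gt0_pi; apply/andP; split; nra.
by lra.
Qed.

(** The residues with support in U form a subgroup. For n coprime to P and U nonempty, translation
    by its generator, the product over A :\: U, multiplies the sum by a factor other than 1. *)
Lemma chi_sum_supp_sub n U : coprime n P -> U \subset A ->
  \sum_(c | supp c \subset U) chi n c = (#|U| == 0)%N%:R.
Proof.
move=> nP UA; case: (finset.set_0Vmem U) => [->|[p pU]].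
  rewrite cards0 (big_pred1 0) ?chi0 // => c; rewrite finset.subset0.
  by apply/eqP/eqP => [/supp_eq0|->] //; rewrite supp0.
have -> : (#|U| == 0)%N = false by rewrite (cardsD1 p) pU.
have U1 := prodset_gt1 UA pU.
have U0 : (0 < prodset U)%N by apply: leq_trans U1.
have D0 : (0 < prodset (A :\: U))%N by apply: prodset_gt0; exact: finset.subsetDl.
have DP : (prodset (A :\: U) < P.-1.+1)%N by rewrite PE [X in (_ < X)%N](prodsetD UA) ltn_Pmull.
pose c0 : 'I_P.-1.+1 := Ordinal DP.
have c0U : supp c0 \subset U by rewrite supp_subE.
have chi1 : 1 - chi n c0 != 0.
  apply: e_neq1 => m /= hm.
  have : n%:R = m%:~R * (prodset U)%:R :> R.
    rewrite -hm (prodsetD UA) natrM; field.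
    by rewrite !pnatr_eq0 -!lt0n U0 D0.
  rewrite [(prodset U)%:R]pmulrn -intrM [LHS]pmulrn => /eqP; rewrite eqr_int => /eqP nE.
  have pn : (p %| n)%N.
    have : (p%:Z %| n%:Z)%Z by rewrite nE dvdz_mull //; exact: mem_dvd_prodset.
    by [].
  have pP : (p %| P)%N by apply: mem_dvd_prodset; exact: (fintype.subsetP UA).
  have := dvdn_gcd p n P; rewrite pn pP (eqP nP) dvdn1 => /eqP p1.
  have := A_prime (fintype.subsetP UA _ pU).
  by rewrite p1.
set s := LHS; have : s = chi n c0 * s.
  rewrite {1}/s (reindex_inj (addrI c0)) mulr_sumr.
  apply: eq_big => [c|c _]; last exact: chiD.
  apply/idP/idP => h; last first.
    by apply: fintype.subset_trans (suppD _ _) _; rewrite finset.subUset c0U.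
  have -> : c = - c0 + (c0 + c) by rewrite addrA addNr add0r.
  by apply: fintype.subset_trans (suppD _ _) _; rewrite finset.subUset suppN c0U.
move/eqP; rewrite -subr_eq0 -{1}(mul1r s) -mulrBl mulf_eq0 (negPf chi1) => /eqP //.
Qed.

(** A Ramanujan sum of squarefree modulus q takes the value mu(q) at n coprime to q: Möbius
    inversion of [chi_sum_supp_sub], by induction on the size of U. *)
Lemma chi_sum_supp n U : coprime n P -> U \subset A ->
  \sum_(c | supp c == U) chi n c = (-1) ^+ #|U|.
Proof.
move=> nP; have [m] := ubnP #|U|; elim: m U => // m IH U; rewrite ltnS => Um UA.
have := chi_sum_supp_sub nP UA; rewrite -(sum_sign_subset _ U).
rewrite (partition_big supp [pred V : {set 'I_b} | V \subset U]) //=.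
rewrite (bigD1 U) //= [RHS](bigD1 U) //=.
have -> : \sum_(i : {set 'I_b} | (i \subset U) && (i != U))
   \sum_(c | (supp c \subset U) && (supp c == i)) chi n c =
   \sum_(i : {set 'I_b} | (i \subset U) && (i != U)) (-1) ^+ #|i|.
  apply: eq_bigr => V /andP[VU VnU]; rewrite -(IH V).
  - apply: eq_bigl => c; apply/andP/idP => [[]//|/eqP cV].
    by rewrite cV eqxx.
  - apply: leq_trans Um; apply: proper_card.
    by rewrite finset.properEneq VnU.
  - exact: fintype.subset_trans UA.
move/addIr <-; apply: eq_bigl => c; apply/idP/andP => [/eqP ->|[]//].
by rewrite eqxx.
Qed.

(** The function h of the overview, with general weights f. The sign mu(q) cancels the value mu(q)
    of each Ramanujan sum at n coprime to P. *)
Definition ramanujan_sum (f : {set 'I_b} -> R) (n : nat) : R[i] :=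
  \sum_c ((-1) ^+ #|supp c| * f (supp c))%:C%C * chi n c.

Lemma ramanujan_sum_coprime f n : coprime n P ->
  ramanujan_sum f n = (\sum_(U : {set 'I_b} | U \subset A) f U)%:C%C.
Proof.
move=> nP; rewrite /ramanujan_sum.
rewrite (partition_big supp [pred V : {set 'I_b} | V \subset A]) /=; last first.
  by move=> c _; exact: supp_sub.
rewrite rmorph_sum /=; apply: eq_bigr => U UA.
transitivity (((-1) ^+ #|U| * f U)%:C%C * \sum_(c | supp c == U) chi n c).
  by rewrite mulr_sumr; apply: eq_bigr => c /eqP ->.
rewrite chi_sum_supp //.
have realM (u v : R) : (u * v)%:C%C = u%:C%C * v%:C%C by exact: rmorphM.
rewrite realM mulrC mulrA.
have -> : ((-1) ^+ #|U|)%:C%C = (-1) ^+ #|U| :> R[i] by rewrite rmorphXn /= rmorphN1.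
by rewrite -expr2 -exprM mulnC exprM sqrrN expr1n expr1n mul1r.
Qed.

(** Distinct fractions with reduced denominators q and r differ modulo 1 by a nonzero multiple of 1
    / (q r). *)
Lemma supp_dist (t u : 'I_P.-1.+1) : t != u ->
  ((prodset (supp t) * prodset (supp u))%:R)^-1 <= dist_int ((t%:R - u%:R) / P%:R : R).
Proof.
move=> tu; set q := prodset (supp t); set r := prodset (supp u).
have q0 : (0 < q)%N by apply: prodset_gt0; exact: supp_sub.
have r0 : (0 < r)%N by apply: prodset_gt0; exact: supp_sub.
have mult (v : 'I_P.-1.+1) : exists k : nat, v%:R / P%:R * (prodset (supp v))%:R = k%:R :> R.
  have := subxx (supp v); rewrite supp_subE ?supp_sub // => /dvdnP[k vE].
  exists k; rewrite vE (prodsetD (supp_sub v)) !natrM; field.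
  by rewrite !pnatr_eq0 -!lt0n !prodset_gt0 ?finset.subsetDl ?supp_sub.
have [k kE] := mult t; have [l lE] := mult u; rewrite -/q -/r in kE lE.
have tP : (t < P)%N by have := ltn_ord t; rewrite {2}PE.
have uP : (u < P)%N by have := ltn_ord u; rewrite {2}PE.
have [m mE] := dist_int_attained ((t%:R - u%:R) / P%:R : R).
have qr0 : 0 < (q * r)%:R :> R by rewrite ltr0n muln_gt0 q0.
have d0 : 0 < dist_int ((t%:R - u%:R) / P%:R : R).
  apply: dist_int_gt0 => z.
  move/(congr1 (fun s => s * P%:R)); rewrite divfK ?gt_eqF //.
  rewrite [t%:R]pmulrn [u%:R]pmulrn [P%:R]pmulrn -intrB -intrM => /eqP.
  rewrite eqr_int => /eqP; case: z => [[|z]|z] h.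
  - by move/eqP: tu; apply; apply: val_inj => /=; lia.
  - have : (P <= z.+1 * P)%N by rewrite leq_pmull.
    by lia.
  - have : (P <= z.+1 * P)%N by rewrite leq_pmull.
    by rewrite NegzE in h; lia.
rewrite -div1r ler_pdivrMr //; move: d0; rewrite mE => d0.
rewrite -{1}(gtr0_norm qr0) -normrM.
have hE : ((t%:R - u%:R) / P%:R - m%:~R) * (q * r)%:R =
   (k%:Z * r%:Z - l%:Z * q%:Z - m * (q * r)%:Z)%:~R :> R.
  rewrite !intrB !intrM -!pmulrn -kE -lE natrM; ring.
have : ((t%:R - u%:R) / P%:R - m%:~R) * (q * r)%:R != 0 :> R.
  apply: mulf_neq0; last by rewrite gt_eqF.
  by move: d0; rewrite normr_gt0.
rewrite hE intr_eq0 -intr_norm ler1z => hz.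
by rewrite -gtz0_ge1 normr_gt0.
Qed.

End SieveGroup.

(** An element of S lies in the first set only, in the second only, or in both. *)
Lemma card_setU_pairs (T : finType) (S : {set T}) :
  (#|[set XY : {set T} * {set T} | XY.1 :|: XY.2 == S]%SET| <= 3 ^ #|S|)%N.
Proof.
pose f (XY : {set T} * {set T}) : {ffun T -> 'I_3} :=
  [ffun p => if p \in XY.1 then (if p \in XY.2 then inord 2 else inord 1) else ord0].
have <- : #|pffun_on (ord0 : 'I_3) (mem S) predT| = (3 ^ #|S|)%N.
  by rewrite card_pffun_on cardT size_enum_ord.
have inX (XY : {set T} * {set T}) p : (p \in XY.1) = (f XY p != ord0).
  by rewrite ffunE; case: ifP => _; rewrite ?eqxx //; case: ifP => _; rewrite -val_eqE /= inordK.
have inY (XY : {set T} * {set T}) p : XY.1 :|: XY.2 = S ->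
    (p \in XY.2) = (p \in S) && ((f XY p == ord0) || (f XY p == inord 2)).
  move=> <-; rewrite finset.in_setU ffunE; case: (p \in XY.1) => /=; last by rewrite ?eqxx ?andbT.
  by case: (p \in XY.2); rewrite -!val_eqE /= !inordK.
rewrite -(@card_in_imset _ _ f) => [|[X Y] [X' Y']]; last first.
  rewrite !finset.inE => /eqP h /eqP h' ff; congr (_, _); apply/setP => p.
    by rewrite (inX (X, Y)) (inX (X', Y')) ff.
  by rewrite (inY (X, Y)) // (inY (X', Y')) // ff.
apply: subset_leq_card; apply/fintype.subsetP => _ /imsetP[XY + ->].
rewrite finset.inE => /eqP h; apply/pffun_onP; split => [|p _] //.
apply/fintype.subsetP => p; rewrite finfun.supportE.
by rewrite -inX -h finset.in_setU => ->.
Qed.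

(** * Autocorrelation of the sieve weights *)

Section SieveWeights.
Variable R : realType.
Variables (b : nat) (A : {set 'I_b}) (Q : nat).
Hypothesis A_prime : forall p : 'I_b, p \in A -> prime p.
Implicit Types (U V : {set 'I_b}) (c t : 'I_(prodset A).-1.+1).
Local Notation nc := (@Normc.normc R).
Local Notation P := (prodset A).

(** With weights 1/q, rather than the 1 / phi(q) of the lower bound, a count gcd(q, r) times two
    weights is exactly 1 / lcm(q, r), on which [sieve_weight_pair] rests. *)
Definition sieve_weight U : R :=
  if (U \subset A) && (prodset U <= Q)%N then (prodset U)%:R^-1 else 0.

Definition sieve_mass : R := \sum_(U : {set 'I_b} | U \subset A) sieve_weight U.

Lemma sieve_weight_ge0 U : 0 <= sieve_weight U.
Proof. by rewrite /sieve_weight; case: ifP => _ //; rewrite invr_ge0. Qed.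

Lemma prodset_setU U V : prodset (U :|: V) = (prodset U * prodset (V :\: U))%N.
Proof.
rewrite (prodset_setID U (U :|: V)); congr (_ * _)%N; congr prodset.
  by rewrite finset.setIC; apply/finset.setIidPl; exact: finset.subsetUl.
by rewrite finset.setDUl finset.setDv finset.set0U.
Qed.

(** The difference of two such c has its support in both U and V. *)
Lemma card_supp_pair t U V :
  (#|[set c : 'I_P.-1.+1 | (supp (c + t)%R == U) && (supp c == V)]%SET| <= prodset (U :&: V))%N.
Proof.
case: (finset.set_0Vmem [set c : 'I_P.-1.+1 | (supp (c + t)%R == U) && (supp c == V)]%SET) => [->|[c0]].
  by rewrite cards0.
rewrite finset.inE => /andP[/eqP hU /eqP hV].
have UA : U :&: V \subset A.
  by rewrite -hV; apply: fintype.subset_trans (supp_sub c0); exact: finset.subsetIr.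
apply: leq_trans _ (card_supp_sub A_prime UA).
rewrite -(@card_imset _ _ (fun c => c - c0) _ (addIr _)).
apply: subset_leq_card; apply/fintype.subsetP => _ /imsetP[c + ->].
rewrite !finset.inE => /andP[/eqP cU /eqP cV]; rewrite finset.subsetI; apply/andP; split.
  have -> : c - c0 = (c + t) + - (c0 + t) by rewrite opprD addrACA subrr addr0.
  apply: fintype.subset_trans (suppD A_prime _ _) _.
  by rewrite (suppN A_prime) cU hU finset.setUid.
apply: fintype.subset_trans (suppD A_prime _ _) _.
by rewrite (suppN A_prime) cV hV finset.setUid.
Qed.

Lemma supp_pair_sub t U V c : supp (c + t) = U -> supp c = V ->
  [&& U \subset A, V \subset A, supp t \subset U :|: V, U \subset supp t :|: V & V \subset supp t :|: U].
Proof.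
move=> <- <-; rewrite !supp_sub /=; apply/and3P; split.
- have {1}-> : t = (c + t) + - c by rewrite addrAC subrr add0r.
  by apply: fintype.subset_trans (suppD A_prime _ _) _; rewrite (suppN A_prime).
- by rewrite finset.setUC; exact: (suppD A_prime).
- have {1}-> : c = (c + t) + - t by rewrite addrK.
  by apply: fintype.subset_trans (suppD A_prime _ _) _; rewrite (suppN A_prime) finset.setUC.
Qed.

(** Let q, r be the products over U, V. When both weights are nonzero, the left-hand side is gcd(q,
    r) / (q r) = 1 / lcm(q, r). As any two of the three sets cover the third, U :|: V is the
    disjoint union of S and U :\: S, which factors the lcm. *)
Lemma sieve_weight_pair U V (S : {set 'I_b}) : U \subset A -> V \subset A ->
  S \subset U :|: V -> U \subset S :|: V -> V \subset S :|: U ->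
  (prodset (U :&: V))%:R * (sieve_weight U * sieve_weight V) <=
  sieve_weight (U :\: S) / (prodset S)%:R.
Proof.
move=> UA VA SUV USV VSU.
have SA : S \subset A by apply: fintype.subset_trans SUV _; rewrite finset.subUset UA.
have S0 := prodset_gt0 A_prime SA; have U0 := prodset_gt0 A_prime UA.
have V0 := prodset_gt0 A_prime VA.
have rhs0 : 0 <= sieve_weight (U :\: S) / (prodset S)%:R.
  by rewrite mulr_ge0 ?sieve_weight_ge0 // invr_ge0.
rewrite {1}/sieve_weight UA /=; case: ifP => UQ; last by rewrite mul0r mulr0.
rewrite {1}/sieve_weight VA /=; case: ifP => VQ; last by rewrite !mulr0.
have USA : U :\: S \subset A by apply: fintype.subset_trans UA; exact: finset.subsetDl.
have USQ : (prodset (U :\: S) <= Q)%N.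
  by apply: leq_trans UQ; rewrite (prodset_setID S U) leq_pmull // (prodset_gt0 A_prime) //
    (fintype.subset_trans _ SA) // finset.subsetIr.
rewrite /sieve_weight USA USQ /=.
have e1 : (prodset U * prodset (V :\: U))%N = (prodset S * prodset (U :\: S))%N.
  rewrite -prodset_setU (prodset_setID S (U :|: V)); congr (_ * _)%N; congr prodset.
    by rewrite finset.setIC; apply/finset.setIidPl.
  rewrite finset.setDUl; apply/finset.setUidPl; apply/fintype.subsetP => p.
  rewrite !finset.in_setD => /andP[pS pV]; rewrite pS /=.
  by have := fintype.subsetP VSU p pV; rewrite finset.in_setU (negPf pS).
have e2 : prodset V = (prodset (U :&: V) * prodset (V :\: U))%N.
  by rewrite (prodset_setID U V) finset.setIC.
have UV0 : (0 < prodset (U :&: V))%N.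
  by rewrite (prodset_gt0 A_prime) // (fintype.subset_trans _ UA) // finset.subsetIl.
have VU0 : (0 < prodset (V :\: U))%N.
  by rewrite (prodset_gt0 A_prime) // (fintype.subset_trans _ VA) // finset.subsetDl.
have e1' : (prodset U)%:R * (prodset (V :\: U))%:R = (prodset S)%:R * (prodset (U :\: S))%:R :> R.
  by rewrite -!natrM e1.
rewrite -invfM mulrC -invfM -(mulrC (prodset S)%:R) -e1' mulrC e2 natrM le_eqVlt.
apply/orP; left; apply/eqP; field.
by rewrite !pnatr_eq0 -!lt0n UV0 VU0 U0.
Qed.

(** The c are grouped by the supports U of c + t and V of c. Outside supp t these coincide, and the
    common part contributes the mass; inside they cover supp t, in at most 3 ^ #|supp t| ways. *)
Lemma sieve_weight_conv t :
  \sum_c sieve_weight (supp (c + t)) * sieve_weight (supp c) <=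
  sieve_mass * ((3 ^ #|supp t|)%:R / (prodset (supp t))%:R).
Proof.
set S := supp t.
pose cond (UV : {set 'I_b} * {set 'I_b}) :=
  [&& UV.1 \subset A, UV.2 \subset A, S \subset UV.1 :|: UV.2, UV.1 \subset S :|: UV.2
    & UV.2 \subset S :|: UV.1].
have S0 : 0 <= (prodset S)%:R^-1 :> R by rewrite invr_ge0.
apply: le_trans (_ : \sum_(UV | cond UV) sieve_weight (UV.1 :\: S) / (prodset S)%:R <= _).
  rewrite (partition_big (fun c => (supp (c + t), supp c)) cond) /=; last first.
    by move=> c _; exact: supp_pair_sub.
  apply: ler_sum => -[U V] /and5P[/= UA VA SUV USV VSU].
  apply: le_trans (sieve_weight_pair UA VA SUV USV VSU).
  rewrite (eq_bigr (fun=> sieve_weight U * sieve_weight V)); last first.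
    by move=> c /eqP[-> ->].
  rewrite sumr_const -[_ *+ _]mulr_natl ler_wpM2r //.
    by rewrite mulr_ge0 ?sieve_weight_ge0.
  rewrite ler_nat; apply: leq_trans (card_supp_pair t U V).
  by apply: subset_leq_card; apply/fintype.subsetP => c; rewrite unfold_in /= => h; rewrite finset.inE.
pose f (UV : {set 'I_b} * {set 'I_b}) := (UV.1 :\: S, (UV.1 :&: S, UV.2 :&: S)).
pose G (W : {set 'I_b} * ({set 'I_b} * {set 'I_b})) :=
  sieve_weight W.1 / (prodset S)%:R * (W.2.1 :|: W.2.2 == S)%:R.
have -> : \sum_(UV | cond UV) sieve_weight (UV.1 :\: S) / (prodset S)%:R =
          \sum_(UV | cond UV) G (f UV).
  apply: eq_bigr => -[U V] /and5P[/= UA VA SUV USV VSU]; rewrite /G /=.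
  by rewrite -finset.setIUl finset.setIC; move/finset.setIidPl: SUV => ->; rewrite eqxx mulr1.
have G0 W : 0 <= G W by rewrite /G mulr_ge0 // mulr_ge0 ?sieve_weight_ge0.
have injf : {in cond &, injective f}.
  have key U V : V \subset S :|: U -> U \subset S :|: V -> V :\: S = U :\: S.
    move=> VSU USV; apply/setP => p; rewrite !finset.in_setD; case pS : (p \in S) => //=.
    apply/idP/idP => [/(fintype.subsetP VSU)|/(fintype.subsetP USV)];
    by rewrite finset.in_setU pS.
  move=> [U V] [U' V'] /and5P[/= _ _ _ USV VSU] /and5P[/= _ _ _ USV' VSU'] [h1 h2 h3].
  congr (_, _); first by rewrite -(finset.setID U S) h1 h2 finset.setID.
  by rewrite -(finset.setID V S) h3 (key U V) // h1 -(key U' V') // finset.setID.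
apply: le_trans (ler_sum_inj injf G0) _.
rewrite -(pair_bigA _ (fun W1 W2 => G (W1, W2))) /=.
have -> : \sum_i \sum_j G (i, j) =
   \sum_(W : {set 'I_b}) sieve_weight W / (prodset S)%:R *
     (#|[set XY : {set 'I_b} * {set 'I_b} | XY.1 :|: XY.2 == S]%SET|)%:R.
  apply: eq_bigr => W _; rewrite /G /= -mulr_sumr -sum1_card natr_sum.
  congr (_ * _); rewrite [RHS]big_mkcond /=; apply: eq_bigr => XY _.
  by rewrite finset.inE; case: (_ == _).
rewrite -mulr_suml -mulr_suml.
have -> : \sum_i sieve_weight i = sieve_mass.
  rewrite /sieve_mass [RHS]big_mkcond /=; apply: eq_bigr => U _.
  by rewrite /sieve_weight; case: (U \subset A).
have m0 : 0 <= sieve_mass by apply: sumr_ge0 => U _; exact: sieve_weight_ge0.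
rewrite -mulrA ler_wpM2l // mulrC ler_wpM2r // ler_nat.
exact: card_setU_pairs.
Qed.

Definition sieve_coef c : R := (-1) ^+ #|supp c| * sieve_weight (supp c).

Definition sieve_corr t : R := \sum_c sieve_coef (c + t) * sieve_coef c.

Lemma normr_sieve_coef c : `|sieve_coef c| = sieve_weight (supp c).
Proof. by rewrite normrM normrX normrN1 expr1n mul1r ger0_norm ?sieve_weight_ge0. Qed.

(** Supports that carry weight have products at most Q, and those of c + t and c cover supp t; hence
    the correlation vanishes when the denominator of t exceeds Q ^ 2. *)
Lemma sieve_corr_le t : `|sieve_corr t| <=
  sieve_mass * (if (prodset (supp t) <= Q ^ 2)%N then (3 ^ #|supp t|)%:R / (prodset (supp t))%:R else 0).
Proof.
apply: le_trans (ler_norm_sum _ _ _) _.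
under eq_bigr => c _ do rewrite normrM !normr_sieve_coef.
case: ifP => hQ; first exact: sieve_weight_conv.
rewrite mulr0 big1 // => c _; rewrite /sieve_weight !supp_sub /=.
case: ifP => h1; last by rewrite mul0r.
case: ifP => h2; last by rewrite mulr0.
move: hQ => /negbT; rewrite -ltnNge => hQ; exfalso.
have /and5P[_ _ h _ _] := supp_pair_sub (erefl (supp (c + t))) (erefl (supp c)).
have : (prodset (supp t) <= Q ^ 2)%N; last by rewrite leqNgt hQ.
apply: leq_trans (_ : (prodset (supp (c + t)%R :|: supp c) <= _)%N).
  rewrite (prodsetD h) leq_pmulr // (prodset_gt0 A_prime) //.
  apply: fintype.subset_trans (finset.subsetDl _ _) _.
  by rewrite finset.subUset !supp_sub.
rewrite prodset_setU -mulnn; apply: leq_mul => //; apply: leq_trans h2.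
rewrite [leqRHS](prodset_setID (supp (c + t))) leq_pmull // (prodset_gt0 A_prime) //.
by apply: fintype.subset_trans (finset.subsetIl _ _) _; rewrite supp_sub.
Qed.

Lemma sieve_corr0_le : sieve_corr 0 <= sieve_mass.
Proof.
have S0 : supp (0 : 'I_P.-1.+1) = finset.set0 by rewrite supp0.
apply: le_trans (ler_norm _) _; apply: le_trans (ler_norm_sum _ _ _) _.
under eq_bigr => c _ do rewrite normrM !normr_sieve_coef.
by apply: le_trans (sieve_weight_conv 0) _; rewrite S0 cards0 expn0 prodset0 divr1 mulr1.
Qed.

Lemma sqr_ramanujan_sum n :
  (nc (ramanujan_sum A sieve_weight n) ^+ 2)%:C%C =
  \sum_(t : 'I_P.-1.+1) (sieve_corr t)%:C%C * chi R n t.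
Proof.
have conj_h : conjc (\sum_c (sieve_coef c)%:C%C * chi R n c) =
    \sum_c (sieve_coef c)%:C%C * e (- (n%:R * (c%:R / P%:R))).
  have conj_sum (F : 'I_P.-1.+1 -> R[i]) : conjc (\sum_i F i) = \sum_i conjc (F i).
    exact: rmorph_sum.
  have conjM (u v : R[i]) : conjc (u * v) = conjc u * conjc v by exact: rmorphM.
  by rewrite conj_sum; apply: eq_bigr => c _; rewrite conjM conjc_real eN.
have hE : ramanujan_sum A sieve_weight n = \sum_c (sieve_coef c)%:C%C * chi R n c by apply: eq_bigr.
rewrite sqr_nc hE conj_h mulr_suml.
transitivity (\sum_(c : 'I_P.-1.+1) \sum_(t : 'I_P.-1.+1)
    ((sieve_coef (c + t))%:C%C * (sieve_coef c)%:C%C) * chi R n t).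
  under eq_bigr => c _ do rewrite mulr_sumr.
  rewrite exchange_big /=; apply: eq_bigr => c _.
  rewrite (reindex_inj (addrI c)) /=; apply: eq_bigr => t _.
  have : chi R n c * e (- (n%:R * (c%:R / P%:R))) = 1 by rewrite /chi -eD subrr e0.
  rewrite (chiD R A_prime); move: (chi R n c) (e _) (chi R n t) => x y z xy.
  move: ((sieve_coef (c + t))%:C%C) ((sieve_coef c)%:C%C) => u v.
  by rewrite mulrACA; congr (_ * _); rewrite mulrAC xy mul1r.
rewrite exchange_big /=; apply: eq_bigr => t _.
rewrite /sieve_corr rmorph_sum /= mulr_suml; apply: eq_bigr => c _.
by congr (_ * _); rewrite [RHS]rmorphM.
Qed.

(* E bounds the contribution of the nontrivial characters, for each pair of points. *)
Lemma sieve_dual (I : finType) (x : I -> R) (c : I -> R[i]) (M : nat) (B E : R) :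
  0 < sieve_mass ->
  \sum_(n < M) nc (\sum_i c i * e (n%:R * x i)) ^+ 2 <= B * \sum_i nc (c i) ^+ 2 ->
  (forall th : R, \sum_(t : 'I_P.-1.+1 | (t != 0) && (prodset (supp t) <= Q ^ 2)%N)
     (3 ^ #|supp t|)%:R / (prodset (supp t))%:R * nc (dirichlet M (th + t%:R / P%:R)) <= E) ->
  \sum_(n < M | coprime n P) nc (\sum_i c i * e (n%:R * x i)) ^+ 2 <=
  (B + #|I|%:R * E) / sieve_mass * \sum_i nc (c i) ^+ 2.
Proof.
move=> m0 hB hE; set T := fun n : nat => \sum_i c i * e (n%:R * x i).
set C := \sum_i nc (c i) ^+ 2.
pose h n := ramanujan_sum A sieve_weight n.
pose X := \sum_(n < M) nc (h n) ^+ 2 * nc (T n) ^+ 2.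
have lower : sieve_mass ^+ 2 * \sum_(n < M | coprime n P) nc (T n) ^+ 2 <= X.
  rewrite /X mulr_sumr [leRHS](bigID (fun n : 'I_M => coprime n P)) /=.
  rewrite -[leLHS]addr0; apply: lerD; last first.
    by apply: sumr_ge0 => n _; rewrite mulr_ge0 // sqr_ge0.
  apply: ler_sum => n nP; rewrite /h (ramanujan_sum_coprime A_prime) // nc_real.
  by rewrite real_normK ?num_real.
pose Y := \sum_(n < M) nc (T n) ^+ 2.
have XE : (X - sieve_corr 0 * Y)%:C%C = \sum_i \sum_j c i * conjc (c j) *
    \sum_(t : 'I_P.-1.+1 | t != 0) (sieve_corr t)%:C%C * dirichlet M (x i - x j + t%:R / P%:R).
  have XE' : X%:C%C = \sum_(t : 'I_P.-1.+1) (sieve_corr t)%:C%C *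
      \sum_i \sum_j c i * conjc (c j) * dirichlet M (x i - x j + t%:R / P%:R).
    rewrite /X rmorph_sum /=.
    transitivity (\sum_(n < M) \sum_(t : 'I_P.-1.+1)
      (sieve_corr t)%:C%C * (chi R n t * (nc (T n) ^+ 2)%:C%C)).
      apply: eq_bigr => n _; rewrite rmorphM /= sqr_ramanujan_sum mulr_suml.
      by apply: eq_bigr => t _; rewrite mulrA.
    rewrite exchange_big /=; apply: eq_bigr => t _; rewrite -mulr_sumr; congr (_ * _).
    transitivity (\sum_(n < M) \sum_i \sum_j c i * conjc (c j) * e (n%:R * (x i - x j + t%:R / P%:R))).
      apply: eq_bigr => n _; rewrite sqr_nc /T rmorph_sum /= mulr_suml mulr_sumr.
      apply: eq_bigr => i _; rewrite !mulr_sumr; apply: eq_bigr => j _.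
      have conjM (u v : R[i]) : conjc (u * v) = conjc u * conjc v by exact: rmorphM.
      rewrite conjM /chi mulrDr eD mulrBr eD eN.
      move: (e (n%:R * x i)) (conjc (e _)) (e _) (c i) (conjc (c j)) => p q r u v.
      by rewrite mulrC mulrACA !mulrA.
    rewrite exchange_big; apply: eq_bigr => i _ /=; rewrite exchange_big.
    by apply: eq_bigr => j _ /=; rewrite /dirichlet mulr_sumr.
  have YE := sum_sqr_expand c x M; rewrite -/Y in YE.
  rewrite rmorphB rmorphM /= XE' YE (bigD1 0) //=.
  have -> : \sum_i \sum_j c i * conjc (c j) * dirichlet M (x i - x j + (0%N)%:R / P%:R) =
            \sum_i \sum_j c i * conjc (c j) * dirichlet M (x i - x j).
    by apply: eq_bigr => i _; apply: eq_bigr => j _; rewrite mul0r addr0.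
  rewrite addrAC subrr add0r; under eq_bigr => t _ do rewrite mulr_sumr.
  rewrite exchange_big; apply: eq_bigr => i _ /=.
  under eq_bigr => t _ do rewrite mulr_sumr.
  rewrite exchange_big; apply: eq_bigr => j _ /=.
  by rewrite mulr_sumr; apply: eq_bigr => t _; rewrite mulrCA.
have up : X - sieve_corr 0 * Y <= sieve_mass * (#|I|%:R * E * C).
  apply: le_trans (sum_sqr_le XE) _.
  apply: le_trans (_ : \sum_i \sum_j nc (c i) * nc (c j) * (sieve_mass * E) <= _).
    apply: ler_sum => i _; apply: ler_sum => j _; rewrite ler_wpM2l ?mulr_ge0 ?nc_ge0 //.
    apply: le_trans (nc_sum _ _ _) _.
    apply: le_trans (_ : sieve_mass * \sum_(t : 'I_P.-1.+1 | (t != 0) && (prodset (supp t) <= Q ^ 2)%N)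
     (3 ^ #|supp t|)%:R / (prodset (supp t))%:R * nc (dirichlet M (x i - x j + t%:R / P%:R)) <= _).
      rewrite mulr_sumr big_mkcondr /=; apply: ler_sum => t _.
      rewrite Normc.normcM nc_real.
      have := ler_wpM2r (nc_ge0 (dirichlet M (x i - x j + t%:R / P%:R))) (sieve_corr_le t).
      case: ifP => _ le_t; apply: le_trans le_t _; last by rewrite mulr0 mul0r.
      by rewrite -[leLHS]mulrA.
    by rewrite ler_pM2l.
  under eq_bigr => i _ do rewrite -mulr_suml -mulr_sumr.
  rewrite -mulr_suml -mulr_suml -expr2 mulrCA ler_wpM2l ?(ltW m0) // mulrAC mulrC.
  have E0 : 0 <= E by apply: le_trans (hE 0); apply: sumr_ge0 => t _; rewrite mulr_ge0 ?nc_ge0 // divr_ge0.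
  rewrite mulrA -expr2 [leRHS]mulrAC; apply: ler_wpM2r => //.
  exact: sqr_sum_le.
have YB : sieve_corr 0 * Y <= sieve_mass * (B * C).
  have Y0 : 0 <= Y by apply: sumr_ge0 => n _; exact: sqr_ge0.
  apply: le_trans (ler_wpM2r Y0 sieve_corr0_le) _.
  by rewrite ler_pM2l.
rewrite mulrAC ler_pdivlMr // mulrC -(ler_pM2l m0) mulrA -expr2.
apply: le_trans lower _.
have -> : sieve_mass * ((B + #|I|%:R * E) * C) = sieve_mass * (#|I|%:R * E * C) + sieve_mass * (B * C).
  by ring.
by rewrite -lerBlDr; apply: le_trans up; rewrite lerD2l lerN2.
Qed.

End SieveWeights.

(** * The contribution of the nontrivial characters *)

Section SieveError.
Variable R : realType.
Variables (b : nat) (A : {set 'I_b}) (Q : nat) (Z eps : R).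
Hypothesis A_prime : forall p : 'I_b, p \in A -> prime p.
Hypothesis A_large : forall p : 'I_b, p \in A -> Z <= p%:R.
Hypothesis Z_ge1 : 1 <= Z.
Hypothesis eps_ge0 : 0 <= eps <= 1 / 4.
Hypothesis Z_eps : 3 <= Z `^ eps.
Implicit Types (U V : {set 'I_b}) (t : 'I_(prodset A).-1.+1).
Local Notation nc := (@Normc.normc R).
Local Notation P := (prodset A).

(** Every prime in U is at least Z, so p ^ eps >= 3 for each of them. *)
Lemma pow3_le_powR U : U \subset A -> (3 ^ #|U|)%:R <= (prodset U)%:R `^ eps :> R.
Proof.
move=> /fintype.subsetP UA; rewrite natrX.
have -> : (prodset U)%:R `^ eps = \prod_(p in U) ((p : nat)%:R `^ eps) :> R.
  rewrite /prodset natr_prod.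
  suff [] : 0 <= \prod_(p in U) (p : nat)%:R :> R /\
     (\prod_(p in U) (p : nat)%:R) `^ eps = \prod_(p in U) ((p : nat)%:R `^ eps) :> R by [].
  elim/big_rec2: _ => [|p y x _ [x0 IH]]; first by rewrite powR1.
  by split; [rewrite mulr_ge0|rewrite powRM // IH].
rewrite -prodr_const; apply: ler_prod => p pU; rewrite ler0n /=.
apply: le_trans Z_eps _; case/andP: eps_ge0 => e0 _.
by apply: ge0_ler_powR; rewrite ?nnegrE ?A_large ?UA // (le_trans ler01).
Qed.

Lemma powR2_le : 2 `^ (eps - 1) <= 3 / 5 :> R.
Proof.
have /andP[_ e4] := eps_ge0.
apply: le_trans (_ : 2 `^ (- (3 / 4)) <= _).
  by apply: ler_powR; lra.
have h0 : 0 <= 2 `^ (- (3 / 4)) :> R by exact: powR_ge0.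
have h1 : 0 <= 3 / 5 :> R by lra.
rewrite -(@ler_pXn2r _ 4) ?nnegrE //.
rewrite -powR_mulrn // -powRrM.
have -> : - (3 / 4) * 4%:R = - 3%:R :> R by lra.
by rewrite powR_invn //; lra.
Qed.

Lemma powR_subr1 (y : R) : 0 < y -> y `^ (eps - 1) = y `^ eps / y.
Proof.
by move=> y0; rewrite powRB ?(gt_eqF y0) ?implybT // powRr1 // ltW.
Qed.

(** Fractions with denominators in [X, 2 X) are (2 X)^-2-spaced, so [spaced_dirichlet_sum] applies,
    and each weight is at most X ^ (eps - 1). The term with M decays in j with ratio 2 ^ (eps - 1)
    <= 3/5; the other grows like X ^ (1 + eps). *)
Lemma sieve_block (j M : nat) (th : R) :
  let X := Z * 2 ^+ j in
  \sum_(t : 'I_P.-1.+1 | [&& t != 0, (prodset (supp t) <= Q ^ 2)%N & X <= (prodset (supp t))%:R < 2 * X])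
     (3 ^ #|supp t|)%:R / (prodset (supp t))%:R * nc (dirichlet M (th + t%:R / P%:R))
  <= M%:R * Z `^ (eps - 1) * (3 / 5) ^+ j
     + (if X <= (Q ^ 2)%:R then 16 * X * (Q ^ 2)%:R `^ eps * (1 + 2 * ln (2 * (Q ^ 2)%:R)) else 0).
Proof.
have Z1 := Z_ge1; have Z0 : 0 < Z by lra.
set X := Z * 2 ^+ j => /=.
have X1 : 1 <= X by rewrite -[1]mulr1 ler_pM // exprn_ege1 // ler1n.
have X0 : 0 < X by lra.
have /andP[e0 e4] := eps_ge0.
have rhs1 : 0 <= M%:R * Z `^ (eps - 1) * (3 / 5) ^+ j.
  by rewrite mulr_ge0 ?exprn_ge0 ?mulr_ge0 ?powR_ge0 //; lra.
case: ifP => hX; last first.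
  rewrite addr0 big1 // => t /and3P[_ h1 /andP[h2 _]].
  by move: hX; rewrite (le_trans h2) // ler_nat.
pose s := (2 * X) ^- 2.
have s0 : 0 < s by rewrite invr_gt0 exprn_gt0 // mulr_gt0.
have s1 : s <= 1 by rewrite invf_le1 ?exprn_gt0 ?mulr_gt0 // exprn_ege1 //; lra.
have lns : - ln s <= 2 * ln (2 * (Q ^ 2)%:R).
  rewrite lnV ?posrE ?exprn_gt0 ?mulr_gt0 // opprK lnXn ?mulr_gt0 // -[_ *+ 2]mulr_natl.
  by rewrite ler_pM2l // ler_ln ?posrE ?mulr_gt0 ?ler_pM2l // (lt_le_trans X0).
have bound t : X <= (prodset (supp t))%:R ->
    (3 ^ #|supp t|)%:R / (prodset (supp t))%:R <= X `^ (eps - 1).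
  move=> Xr; have r0 : 0 < (prodset (supp t))%:R :> R by rewrite (lt_le_trans X0).
  apply: le_trans (_ : (prodset (supp t))%:R `^ eps / (prodset (supp t))%:R <= _).
    by rewrite ler_pM2r ?invr_gt0 // pow3_le_powR // supp_sub.
  have powB (y : R) : 0 < y -> y `^ (eps - 1) = (y `^ (1 - eps))^-1.
    by move=> y0; rewrite -powRN opprB.
  have -> : (prodset (supp t))%:R `^ eps / (prodset (supp t))%:R =
     (prodset (supp t))%:R `^ (eps - 1) :> R.
    by rewrite powR_subr1.
  rewrite !powB // lef_pV2 ?posrE ?powR_gt0 //.
  by apply: ge0_ler_powR => //; rewrite ?nnegrE ?(ltW X0) ?(ltW r0) //; lra.
pose B t := [&& t != 0, (prodset (supp t) <= Q ^ 2)%N & X <= (prodset (supp t))%:R < 2 * X].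
have spaced : {in B &, forall t u, t != u ->
    s <= dist_int ((th + t%:R / P%:R) - (th + u%:R / P%:R))}.
  move=> t u /and3P[_ _ /andP[t1 t2]] /and3P[_ _ /andP[u1 u2]] tu.
  have -> : (th + t%:R / P%:R) - (th + u%:R / P%:R) = (t%:R - u%:R) / P%:R by ring.
  apply: le_trans (supp_dist R A_prime tu).
  rewrite lef_pV2 ?posrE ?exprn_gt0 ?mulr_gt0 //.
    by rewrite natrM expr2; apply: ler_pM; rewrite ?ler0n ?ltW.
  by rewrite natrM mulr_gt0 // (lt_le_trans X0).
have s01 : 0 < s <= 1 by rewrite s0.
have := spaced_dirichlet_sum M s01 spaced; set D := \sum_(i | B i) _ => hD.
apply: le_trans (_ : X `^ (eps - 1) * D <= _).
  rewrite /D mulr_sumr; apply: ler_sum => t /and3P[_ _ /andP[t1 _]].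
  by rewrite ler_wpM2r ?nc_ge0 // bound.
apply: le_trans (_ : X `^ (eps - 1) * (M%:R + 4 / s * (1 - ln s)) <= _).
  by rewrite ler_wpM2l // powR_ge0.
rewrite mulrDr; apply: lerD.
  rewrite mulrC -mulrA ler_wpM2l // /X powRM ?exprn_ge0 //; last by lra.
  rewrite ler_wpM2l ?powR_ge0 // -powR_mulrn // powRAC powR_mulrn ?powR_ge0 //.
  by apply: lerXn2r; rewrite ?nnegrE ?powR_ge0 ?powR2_le //; lra.
have -> : 4 / s = 16 * X * X by rewrite /s invrK exprMn expr2; ring.
have Xe : X `^ (eps - 1) * X = X `^ eps.
  by rewrite powR_subr1 // divfK // gt_eqF.
have -> : X `^ (eps - 1) * (16 * X * X * (1 - ln s)) = 16 * X * (X `^ (eps - 1) * X) * (1 - ln s).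
  by ring.
rewrite Xe; apply: ler_pM.
- by rewrite !mulr_ge0 ?powR_ge0 // ltW.
- by have := ln_le0 s1; lra.
- apply: ler_wpM2l; first by rewrite mulr_ge0 // ltW.
  by apply: ge0_ler_powR => //; rewrite ?nnegrE ?ler0n ?(ltW X0).
- by lra.
Qed.

Lemma sum_pow35 n : \sum_(j < n) (3 / 5) ^+ j <= 5 / 2 :> R.
Proof.
have -> : \sum_(j < n) (3 / 5) ^+ j = 5 / 2 * (1 - (3 / 5) ^+ n) :> R.
  elim: n => [|n IH]; first by rewrite big_ord0 expr0; lra.
  by rewrite big_ord_recr /= IH exprS; lra.
have : 0 <= (3 / 5) ^+ n :> R by rewrite exprn_ge0 //; lra.
by lra.
Qed.

Lemma sum_pow2_le n (W : R) : 0 <= W ->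
  \sum_(j < n) (if Z * 2 ^+ j <= W then Z * 2 ^+ j else 0) <= 2 * W.
Proof.
move=> W0.
have h m : \sum_(j < m) (if Z * 2 ^+ j <= W then Z * 2 ^+ j else 0) <= Z * 2 ^+ m.
  have Z1 := Z_ge1; elim: m => [|m IH]; first by rewrite big_ord0 mulr1; lra.
  rewrite big_ord_recr /=; have : 0 <= Z * 2 ^+ m by rewrite mulr_ge0 ?exprn_ge0 //; lra.
  by move: IH; rewrite exprS; move: (\sum_(_ < _) _) (2 ^+ m) => S w; case: ifP => _; lra.
elim: n => [|n IH]; first by rewrite big_ord0 mulr_ge0.
rewrite big_ord_recr /=; case: ifP => hW; last by rewrite addr0.
by have := h n; move: hW; move: (\sum_(_ < _) _) (_ * _) => S w; lra.
Qed.

(** Dyadic decomposition by denominators, which start at Z because a nonzero t has a prime of A in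
    its denominator. The blocks sum geometrically, whence 5/2 and 32 = 2 * 16. *)
Lemma sieve_error (M : nat) (th : R) :
  \sum_(t : 'I_P.-1.+1 | (t != 0) && (prodset (supp t) <= Q ^ 2)%N)
     (3 ^ #|supp t|)%:R / (prodset (supp t))%:R * nc (dirichlet M (th + t%:R / P%:R))
  <= 5 / 2 * M%:R * Z `^ (eps - 1)
     + 32 * (Q ^ 2)%:R * (Q ^ 2)%:R `^ eps * (1 + 2 * ln (2 * (Q ^ 2)%:R)).
Proof.
have Z1 := Z_ge1; have Z0 : 0 < Z by lra.
have [Q0|Q0] := posnP Q.
  rewrite big1 => [|t /andP[_]]; last first.
    by rewrite Q0 leqNgt (prodset_gt0 A_prime) // supp_sub.
  by rewrite Q0 /= mulr0 !mul0r addr0 mulr_ge0 ?powR_ge0 // mulr_ge0 //; lra.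
have Q1 : 1 <= (Q ^ 2)%:R :> R by rewrite ler1n expn_gt0 Q0.
pose J := (Q ^ 2)%N.
pose jt t := trunc_log 2 (Num.truncn ((prodset (supp t))%:R / Z)).
have jtP t : (t != 0) && (prodset (supp t) <= Q ^ 2)%N ->
    Z * 2 ^+ jt t <= (prodset (supp t))%:R < 2 * (Z * 2 ^+ jt t).
  move=> /andP[t0 tQ].
  have [p pt] : exists p, p \in supp t.
    apply/set0Pn; apply: contra t0 => /eqP /(supp_eq0 A_prime) -> //.
  have pA := fintype.subsetP (supp_sub t) p pt.
  have rZ : 1 <= (prodset (supp t))%:R / Z.
    rewrite ler_pdivlMr // mul1r (le_trans (A_large pA)) // ler_nat.
    by apply: dvdn_leq; [rewrite (prodset_gt0 A_prime) // supp_sub|exact: mem_dvd_prodset].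
  have rZ0 : 0 <= (prodset (supp t))%:R / Z by lra.
  have /andP[h1 h2] := truncn_itv rZ0.
  have T0 : (0 < Num.truncn ((prodset (supp t))%:R / Z))%N by rewrite truncn_gt0.
  have /andP[g1 g2] := trunc_log_bounds (isT : (1 < 2)%N) T0.
  apply/andP; split.
    by rewrite mulrC -ler_pdivlMr // -natrX; apply: le_trans h1; rewrite ler_nat.
  have : (prodset (supp t))%:R / Z < 2 ^+ (jt t).+1.
    by rewrite -natrX; apply: lt_le_trans h2 _; rewrite ler_nat.
  by rewrite ltr_pdivrMr // exprS -mulrA [_ * Z]mulrC.
have jtJ t : (t != 0) && (prodset (supp t) <= Q ^ 2)%N -> (jt t < J.+1)%N.
  move=> ht; have /andP[h1 _] := jtP t ht; case/andP: ht => _ ht.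
  have : 2 ^+ jt t <= (prodset (supp t))%:R :> R.
    by apply: le_trans h1; rewrite ler_peMl ?exprn_ge0.
  rewrite -natrX ler_nat => h; rewrite ltnS; apply: leq_trans ht; apply: leq_trans h.
  by rewrite ltnW // ltn_expl.
pose V t := (3 ^ #|supp t|)%:R / (prodset (supp t))%:R * nc (dirichlet M (th + t%:R / P%:R)).
have V0 t : 0 <= V t by rewrite mulr_ge0 ?nc_ge0 // divr_ge0.
apply: le_trans (_ : \sum_(j < J.+1) \sum_(t : 'I_P.-1.+1 | [&& t != 0, (prodset (supp t) <= Q ^ 2)%N
    & Z * 2 ^+ j <= (prodset (supp t))%:R < 2 * (Z * 2 ^+ j)]) V t <= _).
  rewrite (partition_big (fun t => inord (jt t) : 'I_J.+1) xpredT) //=.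
  apply: ler_sum => j _; rewrite [leLHS]big_mkcond [leRHS]big_mkcond /=.
  apply: ler_sum => t _; case: ifP => [/andP[ht /eqP jE]|_]; last by case: ifP.
  have jE' : jt t = j by rewrite -jE inordK // jtJ.
  by have := jtP t ht; rewrite jE'; case/andP: ht => -> -> /= ->.
apply: le_trans (ler_sum _ (fun (j : 'I_J.+1) _ => sieve_block j M th)) _.
rewrite big_split /= -mulr_sumr; apply: lerD.
  have -> : 5 / 2 * M%:R * Z `^ (eps - 1) = M%:R * Z `^ (eps - 1) * (5 / 2) by ring.
  by rewrite ler_wpM2l ?mulr_ge0 ?powR_ge0 // sum_pow35.
set H := 1 + _; have H0 : 0 <= H.
  by rewrite /H addr_ge0 // mulr_ge0 // ln_ge0 //; lra.
apply: le_trans (_ : \sum_(j < J.+1) (if Z * 2 ^+ j <= (Q ^ 2)%:R then Z * 2 ^+ j else 0) *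
    (16 * (Q ^ 2)%:R `^ eps * H) <= _).
  by apply: ler_sum => j _; case: ifP => _; rewrite ?mul0r // le_eqVlt; apply/orP; left; apply/eqP; ring.
rewrite -mulr_suml.
have -> : 32 * (Q ^ 2)%:R * (Q ^ 2)%:R `^ eps * H = 2 * (Q ^ 2)%:R * (16 * (Q ^ 2)%:R `^ eps * H).
  by ring.
by rewrite ler_wpM2r ?mulr_ge0 ?powR_ge0 // sum_pow2_le.
Qed.

End SieveError.

(** * The mass of the sieve weights *)

Section SmoothSums.
Variable R : realType.
Implicit Types (n p m z Q : nat).

Definition smooth z m := (0 < m)%N && all (fun p => p <= z)%N (primes m).

Lemma smooth_divl z d m : (d %| m)%N -> smooth z m -> smooth z (m %/ d).
Proof.
move=> dm /andP[m0 /allP sm]; have d0 : (0 < d)%N by apply: dvdn_gt0 m0 dm.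
apply/andP; split; first by rewrite divn_gt0 // dvdn_leq.
apply/allP => p; rewrite mem_primes => /and3P[pp _ pm]; apply: sm.
by rewrite mem_primes pp m0 /= (dvdn_trans pm) // dvdn_divLR // dvdn_mulr.
Qed.

Definition smooth_sum z Q : R := \sum_(m < Q.+1 | smooth z m) m%:R^-1.

Lemma smooth_sum_dvd z Q d : (0 < d)%N ->
  \sum_(m < Q.+1 | smooth z m && (d %| m)%N) m%:R^-1 <= d%:R^-1 * smooth_sum z Q.
Proof.
move=> d0; pose f (m : 'I_Q.+1) : 'I_Q.+1 := inord (m %/ d).
have fE (m : 'I_Q.+1) : f m = (m %/ d)%N :> nat.
  by rewrite inordK // ltnS (leq_trans (leq_div _ _)) // -ltnS.
pose G (m : 'I_Q.+1) : R := if smooth z m then d%:R^-1 * m%:R^-1 else 0.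
have G0 (m : 'I_Q.+1) : 0 <= G m by rewrite /G; case: ifP => // _; rewrite mulr_ge0 ?invr_ge0.
pose P := [pred m : 'I_Q.+1 | smooth z m && (d %| m)%N].
have injf : {in P &, injective f}.
  move=> m n /andP[_ dm] /andP[_ dn] /(congr1 val) /=; rewrite !fE => h.
  by apply: val_inj; rewrite -[val m](divnK dm) -[val n](divnK dn) h.
apply: le_trans (_ : \sum_(m | P m) G (f m) <= _).
  apply: ler_sum => m /andP[sm dm]; rewrite /G fE smooth_divl //.
  by rewrite -invfM -natrM mulnC divnK.
apply: le_trans (ler_sum_inj injf G0) _.
by rewrite /G -big_mkcond /= -mulr_sumr.
Qed.

(** ln m is the sum of ln p over the prime powers p ^ k dividing m. The multiples of p ^ k carry at
    most the fraction p ^ -k of the total weight, and summing over k gives 1 / (p - 1). *)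
Lemma smooth_log_sum z Q :
  \sum_(m < Q.+1 | smooth z m) ln m%:R / m%:R <=
  smooth_sum z Q * \sum_(0 <= p < z.+1 | prime p) ln p%:R / (p%:R - 1).
Proof.
have S0 : 0 <= smooth_sum z Q by apply: sumr_ge0 => m _; rewrite invr_ge0.
apply: le_trans (_ : \sum_(m < Q.+1 | smooth z m) \sum_(0 <= p < z.+1 | prime p)
   \sum_(1 <= k < Q.+1) (if (p ^ k %| m)%N then ln p%:R / m%:R else 0) <= _).
  apply: ler_sum => m sm; have /andP[m0 /allP pm] := sm.
  have mQ : (m <= Q)%N by rewrite -ltnS.
  rewrite (ln_primes R m0 (leqnn m)) mulr_suml.
  have -> : \sum_(0 <= p < m.+1 | prime p) (logn p m)%:R * ln p%:R / m%:R =
     \sum_(0 <= p < m.+1 | prime p && (p <= z)%N) (logn p m)%:R * ln p%:R / m%:R :> R.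
    rewrite [LHS]big_mkcond [RHS]big_mkcond; apply: eq_bigr => p _; case pp: (prime p) => //=.
    case: ifP => // pz; rewrite (_ : logn p m = 0%N) ?mul0r //.
    by apply/eqP; rewrite -leqn0 leqNgt logn_gt0; apply/negP => /pm; rewrite pz.
  pose L := maxn m z.
  have e1 : \sum_(0 <= p < m.+1 | prime p && (p <= z)%N) (logn p m)%:R * ln p%:R / m%:R <=
     \sum_(0 <= p < L.+1 | prime p && (p <= z)%N) (logn p m)%:R * ln p%:R / m%:R :> R.
    rewrite [leRHS](big_cat_nat (n := m.+1)) //=; last by rewrite ltnS leq_maxl.
    rewrite lerDl; apply: sumr_ge0 => p _; rewrite divr_ge0 // mulr_ge0 // ln_ge0n //.
  apply: le_trans e1 _.
  rewrite (big_cat_nat (n := z.+1)) //=; last by rewrite ltnS leq_maxr.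
  rewrite [X in _ + X]big1_seq ?addr0; last first.
    move=> p /andP[/andP[_ pz]]; rewrite mem_index_iota => /andP[zp _].
    by move: pz; rewrite leqNgt zp.
  rewrite [leLHS]big_mkcond [leRHS]big_mkcond; apply: ler_sum => p _.
  case pp : (prime p) => //=; case: ifP => _; last first.
    by apply: sumr_ge0 => k _; case: ifP => // _; rewrite divr_ge0 // ln_ge0n.
  rewrite logn_count_dvd // natr_sum -mulrA mulr_suml.
  have -> : \sum_(1 <= k < m) (p ^ k %| m)%:R * (ln p%:R / m%:R) =
     \sum_(1 <= k < m) (if (p ^ k %| m)%N then ln p%:R / m%:R else 0) :> R.
    by apply: eq_bigr => k _; case: ifP => _; rewrite ?mul1r ?mul0r.
  rewrite [leRHS](big_cat_nat (n := m)) //=; last by lia.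
  rewrite lerDl; apply: sumr_ge0 => k _; case: ifP => // _; rewrite divr_ge0 // ln_ge0n //.
rewrite exchange_big /= mulr_sumr [leLHS]big_mkcond [leRHS]big_mkcond.
apply: ler_sum => p _; case pp : (prime p) => //.
have p1 : 1 < p%:R :> R by rewrite ltr1n prime_gt1.
rewrite exchange_big /=.
apply: le_trans (_ : \sum_(1 <= k < Q.+1) ln p%:R * ((p%:R ^+ k)^-1 * smooth_sum z Q) <= _).
  apply: ler_sum => k _.
  have pk0 : (0 < p ^ k)%N by rewrite expn_gt0 prime_gt0.
  have := smooth_sum_dvd z Q pk0; rewrite natrX => /(ler_wpM2l (ln_ge0n R p)).
  apply: le_trans; rewrite mulr_sumr -big_mkcondr /=.
  by apply: ler_sum.
rewrite -mulr_sumr -mulr_suml geom_pow_inv ?prime_gt1 //.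
have -> : smooth_sum z Q * (ln p%:R / (p%:R - 1)) = ln p%:R * ((p%:R - 1)^-1 * smooth_sum z Q).
  by ring.
rewrite ler_wpM2l ?ln_ge0n // ler_wpM2r // ler_piMl ?invr_ge0; [by []|by lra|].
by rewrite gerBl invr_ge0 exprn_ge0 //; lra.
Qed.

(* The summand is at most the increment of psi(log m), where psi has derivative
   max 0 (1 - s / T); the total variation of psi is T / 2. *)
Lemma truncated_log_sum Q (T : R) : 0 < T ->
  \sum_(1 <= m < Q.+1) Num.max 0 (1 - ln m%:R / T) / m%:R <= 1 + T / 2.
Proof.
move=> T0; pose psi (s : R) := Num.min s T - Num.min s T ^+ 2 / (2 * T).
have psi_le s : psi s <= T / 2.
  rewrite /psi; move: (Num.min s T) => w.
  have -> : w - w ^+ 2 / (2 * T) = T / 2 - (T - w) ^+ 2 / (2 * T) by field; lra.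
  by rewrite gerBl divr_ge0 ?sqr_ge0 //; lra.
have step a c : a <= c -> (c - a) * Num.max 0 (1 - c / T) <= psi c - psi a.
  move=> ac; rewrite /psi; have [cT|cT] := leP c T.
    rewrite (min_idPl (le_trans ac cT)).
    have -> : Num.max 0 (1 - c / T) = 1 - c / T.
      by apply/max_idPr; rewrite subr_ge0 ler_pdivrMr // mul1r.
    have -> : c - c ^+ 2 / (2 * T) - (a - a ^+ 2 / (2 * T)) =
       (c - a) * (1 - c / T) + (c - a) ^+ 2 / (2 * T) by field; lra.
    by rewrite lerDl divr_ge0 ?sqr_ge0 //; lra.
  have -> : Num.max 0 (1 - c / T) = 0.
    by apply/max_idPl; rewrite subr_le0 ler_pdivlMr // mul1r ltW.
  rewrite mulr0; have := psi_le a; rewrite /psi => h.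
  have -> : T - T ^+ 2 / (2 * T) = T / 2 by field; lra.
  by rewrite subr_ge0.
have main n : \sum_(1 <= m < n.+2) Num.max 0 (1 - ln m%:R / T) / m%:R <= 1 + psi (ln n.+1%:R).
  elim: n => [|n IH].
    rewrite big_nat1 ln1 mul0r subr0 divr1 /psi (min_idPl (ltW T0)) expr0n /= mul0r subr0 addr0.
    by rewrite (max_idPr _) ?ler01.
  rewrite big_nat_recr //=.
  have h := ln_succ_sub R (ltn0Sn n).
  have hl : ln n.+1%:R <= ln n.+2%:R :> R by rewrite ler_lnn.
  have {}hl := step _ _ hl.
  apply: le_trans (lerD IH _) (_ : 1 + psi (ln n.+1%:R) + (psi (ln n.+2%:R) - psi (ln n.+1%:R)) <= _).
    apply: le_trans hl; rewrite mulrC ler_wpM2r // le_max lexx //.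
  by rewrite addrACA; move: (psi _) (psi _) => u v; lra.
case: Q => [|Q]; first by rewrite big_geq // addr_ge0 // divr_ge0 // ltW.
by apply: le_trans (main Q) _; rewrite lerD2l.
Qed.

(* By smooth_log_sum the logarithm is at most L on average for the weights 1/m on the
   smooth numbers, so half of their mass survives the truncation at T = 2 L. *)
Lemma smooth_sum_le z Q (L : R) : 0 < L ->
  \sum_(0 <= p < z.+1 | prime p) ln p%:R / (p%:R - 1) <= L ->
  smooth_sum z Q <= 2 * L + 2.
Proof.
move=> L0 hL; set S := smooth_sum z Q.
have S0 : 0 <= S by apply: sumr_ge0 => m _; rewrite invr_ge0.
pose T := 2 * L; have T0 : 0 < T by rewrite /T; lra.
have h1 : \sum_(m < Q.+1 | smooth z m) ln m%:R / m%:R <= S * L.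
  by apply: le_trans (smooth_log_sum z Q) _; rewrite ler_wpM2l.
have h2 : S - (\sum_(m < Q.+1 | smooth z m) ln m%:R / m%:R) / T <= 1 + T / 2.
  apply: le_trans (truncated_log_sum Q T0).
  rewrite /S /smooth_sum mulr_suml -sumrB big_add1 /= big_mkord.
  rewrite big_mkcond big_ord_recl /= add0r.
  apply: ler_sum => m _; rewrite /bump /= add1n.
  have m0 : 0 <= m.+1%:R^-1 :> R by rewrite invr_ge0.
  case: ifP => _; last by rewrite mulr_ge0 // le_max lexx.
  have -> : m.+1%:R^-1 - ln m.+1%:R / m.+1%:R / T = (1 - ln m.+1%:R / T) / m.+1%:R :> R.
    by rewrite mulrBl mul1r [_ / T / _]mulrAC.
  by rewrite ler_wpM2r // le_max lexx orbT.
have h3 : (\sum_(m < Q.+1 | smooth z m) ln m%:R / m%:R) / T <= S / 2.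
  rewrite ler_pdivrMr //; apply: le_trans h1 _; rewrite /T; lra.
by move: h2 h3; move: (_ / T) => v; rewrite /T; lra.
Qed.

Lemma squarefree_decomp n : (0 < n)%N -> exists l q,
  [/\ n = (l ^ 2 * q)%N, (0 < q)%N & forall p, prime p -> ~~ (p ^ 2 %| q)%N].
Proof.
have [k] := ubnP n; elim: k n => // k IH n; rewrite ltnS => nk n0.
have [/existsP[p /andP[pp pn]]|H] := boolP [exists p : 'I_n.+1, prime p && (p ^ 2 %| n)%N].
  have p1 := prime_gt1 pp; have p2 : (1 < p ^ 2)%N by rewrite -(exp1n 2) ltn_exp2r.
  have q0 : (0 < n %/ p ^ 2)%N by rewrite divn_gt0; [exact: dvdn_leq|exact: ltnW].
  have [|l [q [nE qq0 hq]]] := IH (n %/ p ^ 2)%N _ q0.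
    by apply: leq_trans nk; rewrite ltn_Pdiv.
  exists (p * l)%N, q; split => //.
  by rewrite -[LHS](divnK pn) nE expnMn mulnC mulnA.
exists 1%N, n; rewrite exp1n mul1n; split => // p pp.
apply/negP => pn; move/negP: H; apply; apply/existsP.
have pn' : (p < n.+1)%N.
  rewrite ltnS; apply: dvdn_leq => //; apply: dvdn_trans pn.
  by rewrite expnS dvdn_mulr.
by exists (Ordinal pn'); rewrite /= pp.
Qed.

End SmoothSums.

Section SieveMass.
Variable R : realType.
Implicit Types (n p m z Q : nat).

Definition sieve_primes z Q : {set 'I_Q.+1} :=
  [set p : 'I_Q.+1 | prime p && (z < p)%N]%SET.

Lemma sieve_primes_prime z Q (p : 'I_Q.+1) : p \in sieve_primes z Q -> prime p.
Proof. by rewrite finset.inE => /andP[]. Qed.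

Lemma prodset_primes Q q : (0 < q)%N -> (q <= Q)%N ->
  (forall p, prime p -> ~~ (p ^ 2 %| q)%N) ->
  prodset [set p : 'I_Q.+1 | (p : nat) \in primes q]%SET = q.
Proof.
move=> q0 qQ sf; rewrite -[RHS](partnT q0) (widen_partn _ qQ) big_mkord /prodset.
rewrite big_mkcond [RHS]big_mkcond /=; apply: eq_bigr => p _; rewrite finset.inE.
case: ifP => pq; last first.
  by move/negbT: pq; rewrite -logn_gt0 lt0n negbK => /eqP ->; rewrite expn0.
have pp : prime p by move: pq; rewrite mem_primes => /andP[].
have -> : logn p q = 1%N; last by rewrite expn1.
apply/eqP; rewrite eqn_leq logn_gt0 pq andbT leqNgt; apply/negP => h.
by move/negP: (sf p pp); apply; rewrite pfactor_dvdn.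
Qed.

(** Split off the z-smooth part and write the rest as l ^ 2 times a squarefree number. All primes of
    l exceed z, so l = 1 or l > z. *)
Lemma smooth_decomp z Q n : (0 < n)%N -> (n <= Q)%N ->
  exists w : 'I_Q.+1 * ('I_Q.+1 * {set 'I_Q.+1}),
  [/\ smooth z w.1, ((w.2.1 == 1 :> nat) || (z < w.2.1))%N, w.2.2 \subset sieve_primes z Q,
    (prodset w.2.2 <= Q)%N & n = (w.1 * (w.2.1 ^ 2 * prodset w.2.2))%N].
Proof.
move=> n0 nQ; pose pi : nat_pred := [pred p | (p <= z)%N].
have [l [q [nE q0 sf]]] := squarefree_decomp (part_gt0 pi^' n).
have rough p : prime p -> (p %| n`_pi^')%N -> (z < p)%N.
  move=> pp pn; have : p \in primes n`_pi^' by rewrite mem_primes pp part_gt0.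
  by rewrite primes_part mem_filter => /andP[]; rewrite !inE -ltnNge.
have le_part rho : (n`_rho <= n)%N by apply: dvdn_leq => //; exact: dvdn_part.
have l0 : (0 < l)%N by have := part_gt0 pi^' n; rewrite nE; case: (l).
have qn : (q <= n`_pi^')%N by rewrite nE leq_pmull // expn_gt0 l0.
have ln : (l <= n`_pi^')%N by rewrite nE -mulnn -mulnA leq_pmulr // muln_gt0 l0.
have qQ : (q <= Q)%N by apply: leq_trans qn (leq_trans (le_part _) nQ).
have mQ : (n`_pi < Q.+1)%N by rewrite ltnS (leq_trans (le_part _) nQ).
have lQ : (l < Q.+1)%N by rewrite ltnS (leq_trans ln (leq_trans (le_part _) nQ)).
exists (Ordinal mQ, (Ordinal lQ, [set p : 'I_Q.+1 | (p : nat) \in primes q]%SET)).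
have qE := prodset_primes q0 qQ sf; split => /=.
- rewrite /smooth part_gt0 primes_part /=; apply/allP => p; rewrite mem_filter => /andP[] //.
- have [l1|l1] := leqP l 1; first by rewrite eqn_leq l1 l0.
  rewrite orbC (leq_trans (rough (pdiv l) _ _)) ?pdiv_leq //; first by rewrite pdiv_prime.
  by rewrite nE dvdn_mulr // (dvdn_trans (pdiv_dvd l)) // -mulnn dvdn_mulr.
- apply/fintype.subsetP => p; rewrite !finset.inE mem_primes => /and3P[pp _ pq].
  by rewrite pp rough // nE dvdn_mull.
- by rewrite qE.
- by rewrite qE -nE partnC.
Qed.

(** [smooth_decomp] bounds the harmonic sum up to Q by a product of three sums; the one over l = 1
    or l > z is at most 1 + 1/z. *)
Lemma sieve_mass_ge z Q : (0 < z)%N ->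
  ln Q.+1%:R <= smooth_sum R z Q * (1 + z%:R^-1) * sieve_mass R (sieve_primes z Q) Q.
Proof.
move=> z0; apply: le_trans (harmonic_ge R Q) _; rewrite big_add1 /= big_mkord.
have [f fP] := boolp.choice (fun k : 'I_Q => @smooth_decomp z Q k.+1 isT (ltn_ord k)).
pose a (m : 'I_Q.+1) : R := if smooth z m then m%:R^-1 else 0.
pose c (l : 'I_Q.+1) : R := if ((l == 1 :> nat) || (z < l))%N then (l%:R ^+ 2)^-1 else 0.
pose wt := sieve_weight R (sieve_primes z Q) Q.
pose G (w : 'I_Q.+1 * ('I_Q.+1 * {set 'I_Q.+1})) := a w.1 * (c w.2.1 * wt w.2.2).
have a0 k : 0 <= a k by rewrite /a; case: ifP => // _; rewrite invr_ge0.
have c0 l : 0 <= c l by rewrite /c; case: ifP => // _; rewrite invr_ge0 exprn_ge0.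
have wt0 U : 0 <= wt U by exact: sieve_weight_ge0.
have G0 w : 0 <= G w by rewrite /G !mulr_ge0.
have injf : {in xpredT &, injective f}.
  move=> i j _ _ fij; apply: val_inj; apply: succn_inj.
  by have [_ _ _ _ ->] := fP i; have [_ _ _ _ ->] := fP j; rewrite fij.
have -> : \sum_(k < Q) k.+1%:R^-1 = \sum_(k < Q) G (f k).
  apply: eq_bigr => k _; have [h1 h2 h3 h4 h5] := fP k.
  by rewrite /G /a /c /wt /sieve_weight h1 h2 h3 h4 h5 2!natrM natrX 2!invfM.
apply: le_trans (ler_sum_inj injf G0) _.
have -> : \sum_w G w = (\sum_m a m) * ((\sum_l c l) * \sum_U wt U).
  rewrite [X in _ * X]big_distrlr pair_big big_distrlr pair_big /=.
  by apply: eq_bigr => -[m [l U]] _.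
have -> : \sum_m a m = smooth_sum R z Q by rewrite /smooth_sum [RHS]big_mkcond.
have -> : \sum_U wt U = sieve_mass R (sieve_primes z Q) Q.
  rewrite /sieve_mass [RHS]big_mkcond; apply: eq_bigr => U _.
  by rewrite /wt /sieve_weight; case: (U \subset _).
have S0 : 0 <= smooth_sum R z Q by apply: sumr_ge0 => m _; rewrite invr_ge0.
have m0 : 0 <= sieve_mass R (sieve_primes z Q) Q by apply: sumr_ge0 => U _; exact: sieve_weight_ge0.
rewrite -[leRHS]mulrA ler_wpM2l // ler_wpM2r //.
have cE : \sum_l c l = \sum_(0 <= l < Q.+1) (if ((l == 1) || (z < l))%N then (l%:R ^+ 2)^-1 else 0).
  by rewrite big_mkord.
apply: le_trans (_ : \sum_(0 <= l < Q.+1) ((l == 1)%N%:R +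
  (if (z < l)%N then (l%:R * (l%:R - 1))^-1 else 0)) <= _).
  rewrite cE; apply: ler_sum => l _; case: eqP => [->|_] /=.
    by rewrite expr1n invr1 lerDl; case: ifP => // _; rewrite subrr mulr0 invr0.
  rewrite add0r; case: ifP => // zl; have l2 : 2 <= l%:R :> R by rewrite (ler_nat R 2); lia.
  have h1 : 0 < l%:R * (l%:R - 1) :> R by apply: mulr_gt0; lra.
  have h2 : l%:R * (l%:R - 1) <= l%:R ^+ 2 :> R by rewrite expr2; nra.
  by rewrite lef_pV2 // posrE // (lt_le_trans h1).
rewrite big_split /=; apply: lerD.
  rewrite big_mkord -natr_sum
    (_ : (\sum_(i < Q.+1) (i == 1 :> nat))%N = \sum_(i < Q.+1 | i == 1 :> nat) 1)%N; last first.
    by rewrite [RHS]big_mkcond; apply: eq_bigr => i _; case: eqP.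
  rewrite sum1_card (ler_nat R _ 1); apply/card_le1_eqP => i j.
  by rewrite !unfold_in => /eqnP i1 /eqnP j1; apply: val_inj; rewrite /= i1 j1.
have [zQ|zQ] := leqP Q z.
  rewrite big1_seq ?invr_ge0 // => l; rewrite mem_index_iota => /andP[_ /andP[_ lQ]].
  by rewrite ltnNge (leq_trans _ zQ).
rewrite (big_cat_nat (n := z.+1)) //=; last by rewrite ltnS ltnW.
rewrite [X in X + _]big1_seq ?add0r; last first.
  by move=> l; rewrite mem_index_iota => /andP[_ /andP[_ lz]]; rewrite ltnNge -ltnS lz.
apply: le_trans (sum_inv_mul_pred R Q z0); rewrite !big_nat; apply: ler_sum => l /andP[zl _].
by rewrite zl.
Qed.

End SieveMass.

(** * From the dual to the primal inequality *)

Lemma coprime_prodset (b : nat) (A : {set 'I_b}) p :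
  (forall q, q \in A -> prime q) -> prime p -> (b <= p)%N -> coprime p (prodset A).
Proof.
move=> A_prime pp bp; rewrite /prodset; elim/big_ind: _ => [|m n hm hn|q qA].
- exact: coprimen1.
- by rewrite coprimeMr hm.
- rewrite prime_coprime // gtnNdvd ?prime_gt0 ?(A_prime q) //.
  exact: leq_trans (ltn_ord q) bp.
Qed.

Section PrimalForm.
Variable R : realType.
Local Notation nc := (@Normc.normc R).
Implicit Types (N delta B C : R) (X : set (RmodZ R)) (u : nat -> R[i]).

(* The c i are the conjugates of the exponential sums to be estimated. *)
Lemma primal_of_dual (I : finType) (x : I -> R) u B n : 0 <= B ->
  (forall c : I -> R[i], \sum_(0 <= p < n | prime p) nc (\sum_i c i * e (p%:R * x i)) ^+ 2
     <= B * \sum_i nc (c i) ^+ 2) ->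
  \sum_i nc (\sum_(0 <= p < n | prime p) u p * e (x i * p%:R)) ^+ 2 <=
  B * \sum_(0 <= p < n | prime p) nc (u p) ^+ 2.
Proof.
move=> B0 h; pose S i := \sum_(0 <= p < n | prime p) u p * e (x i * p%:R).
pose T p := \sum_i conjc (S i) * e (p%:R * x i).
rewrite -/S; set A := \sum_i _; set U := \sum_(0 <= p < n | prime p) _.
have A0 : 0 <= A by apply: sumr_ge0 => i _; exact: sqr_ge0.
have U0 : 0 <= U by apply: sumr_ge0 => i _; exact: sqr_ge0.
have AE : A%:C%C = \sum_(0 <= p < n | prime p) u p * T p.
  rewrite rmorph_sum /=; under eq_bigr => i _ do rewrite sqr_nc mulr_suml.
  rewrite exchange_big; apply: eq_bigr => p _ /=; rewrite mulr_sumr.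
  apply: eq_bigr => i _; rewrite -mulrA; congr (_ * _).
  by rewrite mulrC (mulrC (x i)).
have Ale : A <= \sum_(0 <= p < n | prime p) nc (u p) * nc (T p).
  apply: le_trans (ler_norm _) _; rewrite -nc_real AE.
  by apply: le_trans (nc_sum _ _ _) _; apply: ler_sum => p _; rewrite Normc.normcM.
have := h (fun i => conjc (S i)); rewrite -/T => hT.
have {}hT : \sum_(0 <= p < n | prime p) nc (T p) ^+ 2 <= B * A.
  by apply: le_trans hT _; under eq_bigr => i _ do rewrite ncJ.
have : A ^+ 2 <= U * (B * A).
  have cs := cauchy_schwarz (index_iota 0 n) (fun p => prime p) (fun p => nc (u p)) (fun p => nc (T p)).
  apply: le_trans (le_trans _ cs) _; last by rewrite ler_wpM2l.
  by rewrite ler_sqr ?nnegrE // (le_trans A0 Ale).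
have [->|An0] := eqVneq A 0; first by rewrite mulr_ge0.
by rewrite expr2 mulrA ler_pM2r ?lt_def ?An0 // mulrC.
Qed.

(** Only the cardinality and the spacing of X matter, so the dual bound is asked of any spaced
    finite family of reals of that size. *)
Lemma primes_large_sieve_le N delta X u C B :
  0 < delta -> well_spaced delta X -> 0 <= B ->
  B <= C * ((N + delta^-1) / ln N) * ln (2 * (#|` fset_set X|)%:R) ->
  (forall (I : finType) (x : I -> R), #|I| = #|` fset_set X| ->
     (forall j k, j != k -> delta <= dist_int (x j - x k)) ->
     forall c : I -> R[i],
     \sum_(0 <= p < (Num.truncn N).+1 | prime p) nc (\sum_i c i * e (p%:R * x i)) ^+ 2
     <= B * \sum_i nc (c i) ^+ 2) ->
  primes_large_sieve N delta X u C.
Proof.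
move=> d0 wX B0 hB h; have fX := well_spaced_finite d0 wX.
pose x (i : fset_set X) : R := repr (val i).
have xE (i : fset_set X) p : e_RmodZ (val i *+ p) = e (x i * p%:R).
  by rewrite -e_RmodZ_mulrn reprK.
have sp j k : j != k -> delta <= dist_int (x j - x k).
  move=> jk; rewrite -dist_RmodZ_pi !reprK; apply: wX.
  - by have := valP j; rewrite in_fset_set // inE.
  - by have := valP k; rewrite in_fset_set // inE.
  - by move=> /val_inj /eqP; rewrite (negbTE jk).
have {h} := primal_of_dual u B0 (h _ x (esym (cardfE (fset_set X))) sp).
rewrite /primes_large_sieve fsbig_finite //= => h.
rewrite big_seq_fsetE /=; apply: le_trans (_ : _ <= B * _) _; last first.
  by apply: ler_wpM2r hB; apply: sumr_ge0 => p _; exact: sqr_ge0.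
apply: le_trans h; apply: ler_sum => i _.
by under eq_bigr => p _ do rewrite xE.
Qed.

Section DualBounds.
Variables (I : finType) (x : I -> R) (delta : R).
Hypothesis delta_gt0 : 0 < delta.
Hypothesis x_spaced : forall j k, j != k -> delta <= dist_int (x j - x k).
Implicit Type c : I -> R[i].
Local Notation T c p := (nc (\sum_i c i * e (p%:R * x i))).

(** Pigeonhole: two points in the same cell of length delta would be too close. *)
Lemma spaced_card : #|I|%:R <= delta^-1 + 1.
Proof.
have di : 0 < delta^-1 by rewrite invr_gt0.
pose fr i := x i - (Num.floor (x i))%:~R.
have fr_itv i : 0 <= fr i < 1.
  by have := floor_itv (x i); rewrite /fr intrD => /andP[? ?]; lra.
pose J := Num.truncn delta^-1.
have cellP i := truncn_itv (mulr_ge0 (andP (fr_itv i)).1 (ltW di)).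
have cellJ i : (Num.truncn (fr i / delta) < J.+1)%N.
  rewrite ltnS /J; apply: le_truncn; rewrite ler_piMl ?(ltW di) //.
  by case/andP: (fr_itv i) => _ /ltW.
have inj : injective (fun i => Ordinal (cellJ i)).
  move=> i j [ij]; apply/eqP; apply: contraT => /x_spaced.
  apply: contraTT => _; rewrite -ltNge.
  apply: le_lt_trans (dist_int_le _ (Num.floor (x i) - Num.floor (x j))) _.
  have -> : x i - x j - (Num.floor (x i) - Num.floor (x j))%:~R = fr i - fr j.
    by rewrite /fr intrB; ring.
  move: (cellP i) (cellP j); rewrite ij -natr1 => /andP[h1 h2] /andP[h3 h4].
  have frE k : fr k = fr k / delta * delta by rewrite divfK ?gt_eqF.
  by rewrite (frE i) (frE j) -mulrBl normrM (gtr0_norm delta_gt0) gtr_pMl // ltr_norml; lra.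
have := leq_card _ inj; rewrite card_ord -(ler_nat R) => /le_trans; apply.
by rewrite -natr1 lerD2r; have /andP[] := truncn_itv (ltW di).
Qed.

Lemma dual_sum_prefix c n m (P : pred nat) : (n <= m)%N ->
  \sum_(0 <= p < n | P p) T c p ^+ 2 <= \sum_(p < m) T c p ^+ 2.
Proof.
move=> nm; rewrite -(big_mkord xpredT (fun p => T c p ^+ 2)).
rewrite [leRHS](big_cat_nat (n := n)) //= big_mkcond /=.
rewrite -[leLHS]addr0; apply: lerD; last by apply: sumr_ge0 => p _; exact: sqr_ge0.
by apply: ler_sum => p _; case: ifP => // _; exact: sqr_ge0.
Qed.

Lemma dual_trivial_term c p : T c p ^+ 2 <= #|I|%:R * \sum_i nc (c i) ^+ 2.
Proof.
have h : T c p <= \sum_i nc (c i).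
  apply: le_trans (nc_sum _ _ _) _; apply: ler_sum => i _.
  by rewrite Normc.normcM nc_e mulr1.
apply: le_trans (sqr_sum_le _); rewrite ler_sqr ?nnegrE ?nc_ge0 //.
by apply: sumr_ge0 => i _; exact: nc_ge0.
Qed.

Lemma dual_trivial c n : \sum_(0 <= p < n.+1 | prime p) T c p ^+ 2 <=
  #|I|%:R * prime_count R n * \sum_i nc (c i) ^+ 2.
Proof.
rewrite mulrAC /prime_count mulr_sumr; apply: ler_sum => p _; rewrite mulr1.
exact: dual_trivial_term.
Qed.

Lemma dual_large_sieve c n : \sum_(0 <= p < n.+1 | prime p) T c p ^+ 2 <=
  (n.+1%:R + 47 / 40 / delta + 3) * \sum_i nc (c i) ^+ 2.
Proof.
by apply: le_trans (dual_sum_prefix _ _ (leqnn _)) _; apply: large_sieve_dual.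
Qed.

(** Primes above Q are coprime to P and fall under the sieve; the terms up to Q are bounded
    trivially. The factor divided by ln(Q + 1) is the bound for 1 / G obtained from [smooth_sum_le],
    [mertens_le] and [sieve_mass_ge]. *)
Lemma dual_sieve c n z Q (eps : R) : (2601 <= z)%N -> (0 < Q)%N ->
  0 <= eps <= 1 / 4 -> 3 <= z%:R `^ eps ->
  \sum_(0 <= p < n.+1 | prime p) T c p ^+ 2 <=
  ((n.+1%:R + 47 / 40 / delta + 3
    + #|I|%:R * (5 / 2 * n.+1%:R * z%:R `^ (eps - 1)
       + 32 * (Q ^ 2)%:R * (Q ^ 2)%:R `^ eps * (1 + 2 * ln (2 * (Q ^ 2)%:R))))
    * ((2 * (ln z%:R + 1) + 2) * (1 + z%:R^-1) / ln Q.+1%:R) + #|I|%:R * Q.+1%:R)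
  * \sum_i nc (c i) ^+ 2.
Proof.
move=> z_ge Q0 heps hz; set C := \sum_i _; set B := _ + 3; set E := _ + 32 * _ * _ * _.
have C0 : 0 <= C by apply: sumr_ge0 => i _; exact: sqr_ge0.
have z0 : (0 < z)%N by lia.
have z1 : 1 <= z%:R :> R by rewrite ler1n.
have E0 : 0 <= E.
  have Q1 : 1 <= (Q ^ 2)%:R :> R by rewrite ler1n expn_gt0 Q0.
  have l0 : 0 <= ln (2 * (Q ^ 2)%:R) :> R by rewrite ln_ge0 //; lra.
  by rewrite /E addr_ge0 // !mulr_ge0 ?powR_ge0 //; lra.
have B0 : 0 <= B.
  have : 0 < 47 / 40 / delta by rewrite divr_gt0 //; lra.
  by rewrite /B; move: (ler0n R n.+1); lra.
pose A := sieve_primes z Q; pose m := sieve_mass R A Q.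
have lQ : 0 < ln Q.+1%:R :> R by rewrite ln_gt0 // ltr1n.
have L0 : 0 <= ln z%:R :> R by rewrite ln_ge0.
have hs : smooth_sum R z Q <= 2 * (ln z%:R + 1) + 2.
  by apply: smooth_sum_le; [lra|exact: mertens_le].
have m_ge : ln Q.+1%:R <= (2 * (ln z%:R + 1) + 2) * (1 + z%:R^-1) * m.
  apply: le_trans (sieve_mass_ge R Q z0) _.
  have m0 : 0 <= m by apply: sumr_ge0 => U _; exact: sieve_weight_ge0.
  by do 2![apply: ler_wpM2r => //]; rewrite addr_ge0 // invr_ge0.
have w0 : 0 < (2 * (ln z%:R + 1) + 2) * (1 + z%:R^-1) :> R.
  by rewrite mulr_gt0 ?ltr_wpDr ?invr_ge0 //; lra.
have m0 : 0 < m by rewrite -(pmulr_rgt0 _ w0) (lt_le_trans lQ).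
have mV : m^-1 <= (2 * (ln z%:R + 1) + 2) * (1 + z%:R^-1) / ln Q.+1%:R.
  by rewrite ler_pdivlMr // mulrC ler_pdivrMr.
have A_prime (p : 'I_Q.+1) : p \in A -> prime p := @sieve_primes_prime z Q p.
have A_large (p : 'I_Q.+1) : p \in A -> z%:R <= p%:R :> R.
  by rewrite finset.inE => /andP[_ /ltnW]; rewrite ler_nat.
have sv := sieve_dual A_prime (c := c) m0 (large_sieve_dual c n.+1 delta_gt0 x_spaced)
  (sieve_error Q A_prime A_large z1 heps hz n.+1).
rewrite mulrDl; apply: le_trans (_ : _ <= \sum_(p < n.+1 | coprime p (prodset A)) T c p ^+ 2
   + \sum_(p < Q.+1) T c p ^+ 2) _.
  have [nQ|Qn] := leqP n.+1 Q.+1.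
    rewrite -[leLHS]add0r; apply: lerD; last exact: dual_sum_prefix.
    by apply: sumr_ge0 => p _; exact: sqr_ge0.
  rewrite (big_cat_nat (n := Q.+1)) ?(ltnW Qn) //= addrC; apply: lerD.
    rewrite -(big_mkord (fun p => coprime p (prodset A)) (fun p => T c p ^+ 2)).
    rewrite [leRHS](big_cat_nat (n := Q.+1)) ?(ltnW Qn) //=.
    rewrite -[leLHS]add0r; apply: lerD; first by apply: sumr_ge0 => p _; exact: sqr_ge0.
    rewrite big_mkcond [leRHS]big_mkcond /=; apply: ler_sum_nat => p /andP[Qp _].
    case: ifP => [pp|_]; last by case: ifP => // _; exact: sqr_ge0.
    by rewrite (coprime_prodset A_prime).
  exact: dual_sum_prefix.
apply: lerD.
  apply: le_trans sv _; rewrite ler_wpM2r // -/B -/E ler_wpM2l //.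
  by rewrite addr_ge0 ?mulr_ge0.
apply: le_trans (_ : \sum_(p < Q.+1) #|I|%:R * C <= _); last first.
  by rewrite sumr_const card_ord -[_ *+ Q.+1]mulr_natr mulrAC.
by apply: ler_sum => p _; exact: dual_trivial_term.
Qed.

End DualBounds.
End PrimalForm.

Section PrimesLargeSieveCriteria.
Variables (R : realType) (N delta : R) (X : set (RmodZ R)) (u : nat -> R[i]) (C : R).
Hypothesis N_ge1 : 1 <= N.
Hypothesis delta_gt0 : 0 < delta.
Hypothesis X_spaced : well_spaced delta X.
Local Notation K := (#|` fset_set X|).
Local Notation rhs := (C * ((N + delta^-1) / ln N) * ln (2 * K%:R)).

Let N_bounds : (Num.truncn N)%:R <= N < (Num.truncn N).+1%:R.
Proof. by apply: truncn_itv; apply: le_trans N_ge1. Qed.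

Lemma well_spaced_card : K%:R <= delta^-1 + 1.
Proof.
rewrite cardfE; apply: (spaced_card (x := fun i : fset_set X => repr (val i)) delta_gt0).
move=> j k jk; rewrite -dist_RmodZ_pi !reprK; apply: X_spaced.
- by have := valP j; rewrite in_fset_set ?inE //; exact: well_spaced_finite X_spaced.
- by have := valP k; rewrite in_fset_set ?inE //; exact: well_spaced_finite X_spaced.
- by move=> /val_inj /eqP; rewrite (negbTE jk).
Qed.

Lemma primes_large_sieve_trivial :
  K%:R * prime_count R (Num.truncn N) <= rhs -> primes_large_sieve N delta X u C.
Proof.
move=> h; apply: primes_large_sieve_le h _ => //.
  by rewrite mulr_ge0 // prime_count_ge0.
by move=> I x <- _ c; exact: dual_trivial.
Qed.

Lemma primes_large_sieve_dense :
  N + 4 + 47 / 40 * delta^-1 <= rhs -> primes_large_sieve N delta X u C.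
Proof.
have di : 0 < delta^-1 by rewrite invr_gt0.
move=> h; apply: primes_large_sieve_le h _ => //; first by move: N_ge1; lra.
move=> I x _ sp c; apply: le_trans (dual_large_sieve delta_gt0 sp _ _) _.
rewrite ler_wpM2r ?sumr_ge0 // => [i _|]; first exact: sqr_ge0.
by have /andP[h1 _] := N_bounds; rewrite -natr1; lra.
Qed.

Lemma primes_large_sieve_sieve z Q (eps : R) : (2601 <= z)%N -> (0 < Q)%N ->
  0 <= eps <= 1 / 4 -> 3 <= z%:R `^ eps ->
  (N + 4 + 47 / 40 * delta^-1
    + K%:R * (5 / 2 * (N + 1) * z%:R `^ (eps - 1)
       + 32 * (Q ^ 2)%:R * (Q ^ 2)%:R `^ eps * (1 + 2 * ln (2 * (Q ^ 2)%:R))))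
    * ((2 * (ln z%:R + 1) + 2) * (1 + z%:R^-1) / ln Q.+1%:R) + K%:R * Q.+1%:R <= rhs ->
  primes_large_sieve N delta X u C.
Proof.
have di : 0 < delta^-1 by rewrite invr_gt0.
move=> z_ge Q0 heps hz h.
have z1 : 1 <= z%:R :> R by rewrite ler1n; exact: leq_trans z_ge.
have lQ : 0 < ln Q.+1%:R :> R by rewrite ln_gt0 // ltr1n.
have L0 : 0 <= ln z%:R :> R by rewrite ln_ge0.
have w0 : 0 <= (2 * (ln z%:R + 1) + 2) * (1 + z%:R^-1) / ln Q.+1%:R :> R.
  by rewrite !mulr_ge0 ?addr_ge0 ?invr_ge0 // ?ltW //; lra.
have Q1 : 1 <= (Q ^ 2)%:R :> R by rewrite ler1n expn_gt0 Q0.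
have l0 : 0 <= ln (2 * (Q ^ 2)%:R) :> R by rewrite ln_ge0 //; lra.
have E0 : 0 <= 32 * (Q ^ 2)%:R * (Q ^ 2)%:R `^ eps * (1 + 2 * ln (2 * (Q ^ 2)%:R)) :> R.
  by rewrite !mulr_ge0 ?powR_ge0 //; lra.
have p0 : 0 <= 5 / 2 * (N + 1) * z%:R `^ (eps - 1) :> R.
  by rewrite !mulr_ge0 ?powR_ge0 //; move: N_ge1; lra.
apply: primes_large_sieve_le h _ => //.
  by apply: addr_ge0; apply: mulr_ge0 => //; do ?apply: addr_ge0 => //;
    rewrite ?mulr_ge0 ?addr_ge0 //; move: N_ge1; lra.
move=> I x IK sp c; apply: le_trans (dual_sieve delta_gt0 sp _ _ z_ge Q0 heps hz) _.
have /andP[h1 _] := N_bounds.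
rewrite ler_wpM2r ?sumr_ge0 // => [i _|]; first exact: sqr_ge0.
rewrite IK lerD2r ler_wpM2r // lerD //; first by rewrite -natr1; lra.
by rewrite ler_wpM2l // lerD2r ler_wpM2r ?powR_ge0 // ler_wpM2l //; lra.
Qed.

End PrimesLargeSieveCriteria.

(** * The constant 19 *)

Section ConstantNineteen.
Variable R : realType.
Implicit Types (N delta : R) (X : set (RmodZ R)) (u : nat -> R[i]).

Lemma ln_ge_pow2 (j : nat) (x : R) : 2 ^+ j <= x -> j%:R * (69 / 100) <= ln x.
Proof.
move=> jx; have [h _] := andP (ln2_bounds R).
have p0 : 0 < 2 ^+ j :> R by rewrite exprn_gt0.
apply: le_trans (_ : ln (2 ^+ j) <= _); last by rewrite ler_ln ?posrE // (lt_le_trans p0).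
by rewrite lnXn // -[ln 2 *+ j]mulr_natl; apply: ler_wpM2l.
Qed.

Lemma ln_exprn (j : nat) (x : R) : 0 < x -> ln (x ^+ j) = j%:R * ln x.
Proof. by move=> x0; rewrite lnXn // -[ln x *+ j]mulr_natl. Qed.

Lemma powR_root (k : nat) N : 0 <= N -> (N `^ (k.+1%:R^-1)) ^+ k.+1 = N.
Proof. by move=> N0; rewrite -powR_mulrn ?powR_ge0 // -powRrM mulVf ?pnatr_eq0 // powRr1. Qed.

Lemma prime_count_le_root (k : nat) N (y kappa : R) : 1 < y -> y ^+ k.+2 = N ->
  k.+2%:R * ln y <= kappa * y ->
  prime_count R (Num.truncn N) <= (kappa + k.+2%:R / k.+1%:R * (14 / 10)) * N / ln N.
Proof.
move=> y1 yN hy; have y0 : 0 < y by lra.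
have ly : 0 < ln y by rewrite ln_gt0.
have N0 : 0 < N by rewrite -yN exprn_gt0.
have lN : ln N = k.+2%:R * ln y by rewrite -yN lnXn // -[_ *+ k.+2]mulr_natl.
have lN0 : 0 < ln N by rewrite lN mulr_gt0.
have yk1 : 1 < y ^+ k.+1 by rewrite exprn_egt1.
apply: le_trans (prime_count_le _ yk1) _.
have [_ l2] := andP (ln2_bounds R).
have l4 : ln 4 <= 14 / 10 :> R.
  have -> : 4 = 2 ^+ 2 :> R by ring.
  by rewrite lnXn // mulr2n; lra.
have tN : (Num.truncn N)%:R <= N by have /andP[] := truncn_itv (ltW N0).
have E1 : y ^+ k.+1 <= kappa * N / ln N.
  rewrite ler_pdivlMr // lN -yN [y ^+ k.+2]exprSr mulrCA [leRHS]mulrCA mulrC.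
  by rewrite -mulrA; apply: ler_wpM2l; rewrite ?exprn_ge0 ?(ltW y0) // mulrC.
have E2 : (Num.truncn N)%:R * ln 4 / ln (y ^+ k.+1) <= k.+2%:R / k.+1%:R * (14 / 10) * N / ln N.
  rewrite lnXn // -[_ *+ k.+1]mulr_natl lN.
  have -> : k.+2%:R / k.+1%:R * (14 / 10) * N / (k.+2%:R * ln y) = N * (14 / 10) / (k.+1%:R * ln y).
    by field; rewrite ?pnatr_eq0 ?gt_eqF.
  apply: ler_wpM2r; first by rewrite invr_ge0 mulr_ge0 ?(ltW ly).
  by apply: ler_pM => //; rewrite ln_ge0 // (ler_nat R 1 4).
by apply: le_trans (lerD E1 E2) _; rewrite -mulrDl -mulrDl.
Qed.

(** Cube roots: 1/2 + 3/2 * 1.4 = 13/5. The threshold 18 ^ 3 is below 10 ^ 4. *)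
Lemma prime_count_le_moderate N : 18 ^+ 3 <= N ->
  prime_count R (Num.truncn N) <= 13 / 5 * N / ln N.
Proof.
move=> hN; have N0 : 0 <= N by apply: le_trans hN; rewrite exprn_ge0.
have yN := powR_root 2 N0; set y := N `^ _ in yN.
have y18 : 18 <= y by rewrite -(@ler_pXn2r _ 3) ?nnegrE ?powR_ge0 // yN.
have N1 : 1 <= N by rewrite -yN exprn_ege1 //; lra.
apply: le_trans (prime_count_le_root (kappa := 1 / 2) _ yN _) _; first lra.
  by have := @ln_le_scaled R 4 y; rewrite -exprVn; lra.
by apply: ler_wpM2r; [rewrite invr_ge0 ln_ge0|apply: ler_wpM2r; lra].
Qed.

(** Sixth roots: 1/50 + 6/5 * 1.4 = 17/10. The threshold is 52 ^ 12 because the bound serves for N >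
    (2 |X|) ^ 12 with |X| >= 26. *)
Lemma prime_count_le_large N : (52 ^+ 2) ^+ 6 <= N ->
  prime_count R (Num.truncn N) <= 17 / 10 * N / ln N.
Proof.
move=> hN; have N0 : 0 <= N by apply: le_trans hN; rewrite !exprn_ge0.
have yN := powR_root 5 N0; set y := N `^ _ in yN.
have y52 : 52 ^+ 2 <= y by rewrite -(@ler_pXn2r _ 6) ?nnegrE ?powR_ge0 ?exprn_ge0 // yN.
have y1 : 2704 <= y by move: y52; rewrite expr2; lra.
have N1 : 1 <= N by rewrite -yN exprn_ege1 //; lra.
apply: le_trans (prime_count_le_root (kappa := 2 / 100) _ yN _) _; first lra.
  by have := @ln_le_scaled R 11 y; lra.
by apply: ler_wpM2r; [rewrite invr_ge0 ln_ge0|apply: ler_wpM2r; lra].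
Qed.

(* The constant 19 is enough for Chebyshev's bound up to |X| = 25, and up to |X| = 50
   for the N too large for the large sieve. *)
Section Nineteen.
Variables (N delta : R) (X : set (RmodZ R)) (u : nat -> R[i]).
Hypothesis N_ge : 10 ^+ 4 <= N.
Hypothesis delta_gt0 : 0 < delta.
Hypothesis X_neq0 : nonempty X.
Hypothesis X_spaced : well_spaced delta X.
Local Notation K := (#|` fset_set X|).

Let fX := well_spaced_finite delta_gt0 X_spaced.

Lemma card_spaced_gt0 : (0 < K)%N.
Proof.
case: X_neq0 => x Xx; rewrite cardfs_gt0; apply/fset0Pn; exists x.
by rewrite in_fset_set ?inE.
Qed.

Let N_gt18 : 18 ^+ 3 <= N.
Proof. by apply: le_trans N_ge; rewrite !exprS !expr0; lra. Qed.

Let N_ge1 : 1 <= N.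
Proof. by apply: le_trans N_gt18; rewrite exprn_ege1 //; lra. Qed.

Let D_gt0 : 0 < delta^-1. Proof. by rewrite invr_gt0. Qed.

Let lnN_gt0 : 0 < ln N.
Proof. by apply: ln_gt0; have := N_gt18; rewrite !exprS expr0; lra. Qed.

Let Y := (N + delta^-1) / ln N.

Let Y_ge : N / ln N <= Y.
Proof. by apply: ler_wpM2r; [rewrite invr_ge0 ltW|rewrite lerDl ltW]. Qed.

(** It is enough that |X| b <= 19 ln(2 |X|). On a range of |X| the left-hand side is taken at the
    upper end and the logarithm at the lower end. *)
Lemma nineteen_trivial (a : nat) (b h : R) : 0 <= b ->
  prime_count R (Num.truncn N) <= b * N / ln N -> h <= ln (2 * K%:R) ->
  (K <= a)%N -> a%:R * b <= 19 * h ->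
  primes_large_sieve N delta X u 19.
Proof.
move=> b0 hp hh Ka ha; have hb : K%:R * b <= 19 * h.
  by apply: le_trans ha; apply: ler_wpM2r => //; rewrite ler_nat.
apply: primes_large_sieve_trivial => //.
have K0 : 0 <= K%:R :> R by [].
apply: le_trans (_ : K%:R * (b * N / ln N) <= _); first exact: ler_wpM2l.
have Y0 : 0 <= N / ln N by rewrite divr_ge0 ?(ltW lnN_gt0) //; have := N_ge1; lra.
rewrite -/Y -[b * N / _]mulrA mulrA.
apply: le_trans (_ : 19 * ln (2 * K%:R) * (N / ln N) <= _); first by
  apply: ler_wpM2r => //; move: hb hh; move: (_ * b) (ln _) => p q; lra.
rewrite [leRHS]mulrAC; apply: ler_wpM2l Y_ge; rewrite mulr_ge0 //.
by have := mulr_ge0 K0 b0; move: hb hh; move: (_ * b) (ln _) => p q; lra.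
Qed.

Lemma nineteen_le25 : (K <= 25)%N -> primes_large_sieve N delta X u 19.
Proof.
move=> K25; have K1 := card_spaced_gt0; have hp := prime_count_le_moderate N_gt18.
have b0 : 0 <= 13 / 5 :> R by lra.
have main (a a' j : nat) : (2 ^ j <= 2 * a'.+1)%N -> (a' < K)%N -> (K <= a)%N ->
    a%:R * (13 / 5) <= 19 * (j%:R * (69 / 100)) :> R ->
    primes_large_sieve N delta X u 19.
  move=> ja aK; apply: (nineteen_trivial b0 hp (@ln_ge_pow2 j _ _)).
  by rewrite -natrX -natrM ler_nat (leq_trans ja) // leq_mul2l.
(* Five more points cost 5 * 13/5 = 13, one more factor 2 in 2 |X| brings 19 * 0.69 = 13.11: blocks
   of five suffice. *)
have [h|h] := leqP K 5; first by apply: (main 5 0 1 isT K1 h); lra.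
have [h'|h'] := leqP K 10; first by apply: (main 10 5 2 isT h h'); lra.
have [h2|h2] := leqP K 15; first by apply: (main 15 10 3 isT h' h2); lra.
have [h3|h3] := leqP K 20; first by apply: (main 20 15 4 isT h2 h3); lra.
by apply: (main 25 20 5 isT h3 K25); lra.
Qed.

(** Here ln N <= j ln(2 |X|), so the large sieve loses the factor j, and j = 15 is allowed since 15
    * 47/40 < 19. Larger N are left to Chebyshev's bound when j = 12 and to the sieve when j =
    15. *)
Lemma nineteen_dense (j : nat) : (j = 12%N /\ (26 <= K)%N) \/ (j = 15%N /\ (51 <= K)%N) ->
  N <= (2 * K%:R) ^+ j -> primes_large_sieve N delta X u 19.
Proof.
move=> hj hN; apply: primes_large_sieve_dense => //; rewrite -/Y.
have K1 := card_spaced_gt0; have K0 : 1 <= K%:R :> R by rewrite ler1n.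
have N0 : 0 < N by have := N_ge1; lra.
have DK := well_spaced_card delta_gt0 X_spaced.
have lN : ln N <= j%:R * ln (2 * K%:R).
  have K2 : 0 < 2 * K%:R :> R by lra.
  by rewrite -ln_exprn // ler_ln // posrE exprn_gt0.
have lN0 := lnN_gt0; have D0 := D_gt0; have N1 := N_gt18.
set h := ln (_ * _) in lN *.
have -> : 19 * Y * h = 19 * (N + delta^-1) * h / ln N by rewrite /Y mulrA mulrAC.
rewrite ler_pdivlMr //.
have N5832 : 5832 <= N by move: N1; rewrite !exprS expr0; lra.
have D0j : 0 < j%:R :> R by case: hj => -[-> _]; rewrite ltr0n.
have h0 : 0 <= h by rewrite -(pmulr_rge0 _ D0j) (le_trans (ltW lN0) lN).
have lin : (N + 4 + 47 / 40 / delta) * j%:R <= 19 * (N + delta^-1).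
  case: hj => -[-> jK].
    have : 26 <= K%:R :> R by rewrite (ler_nat R 26).
    by move: DK N5832; move: delta^-1 K%:R => D k; lra.
  have : 51 <= K%:R :> R by rewrite (ler_nat R 51).
  by move: DK N5832; move: delta^-1 K%:R => D k; lra.
apply: le_trans (ler_wpM2r h0 lin); rewrite -[leRHS]mulrA; apply: ler_wpM2l => //.
by move: D0 N5832; move: delta^-1 => D; lra.
Qed.

Lemma nineteen_le50 : (25 < K)%N -> (K <= 50)%N -> primes_large_sieve N delta X u 19.
Proof.
move=> K25 K50; have [hN|hN] := leP N ((2 * K%:R) ^+ 12).
  by apply: nineteen_dense hN; left.
have K26 : 26 <= K%:R :> R by rewrite (ler_nat R 26).
have hp : prime_count R (Num.truncn N) <= 17 / 10 * N / ln N.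
  apply: prime_count_le_large; apply: le_trans (ltW hN); rewrite -exprM.
  by rewrite ler_pXn2r ?nnegrE //; move: K26; move: K%:R => k; lra.
have b0 : 0 <= 17 / 10 :> R by lra.
have [K31|K31] := leqP K 31.
  apply: (nineteen_trivial b0 hp (@ln_ge_pow2 5 _ _) K31); last lra.
  by rewrite !exprS expr0; move: K26; move: K%:R => k; lra.
have K32 : 32 <= K%:R :> R by rewrite (ler_nat R 32).
have [K45|K45] := leqP K 45.
  apply: (nineteen_trivial b0 hp (@ln_ge_pow2 6 _ _) K45); last lra.
  by rewrite !exprS expr0; move: K32; move: K%:R => k; lra.
have K46 : 46 <= K%:R :> R by rewrite (ler_nat R 46).
have K2 : 92 <= 2 * K%:R :> R by move: K46; move: K%:R => k; lra.
(* Now ln(2 |X|) >= 85/19 is required, more than six factors 2 give; squaring provides six and a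
   half, as 92 ^ 2 >= 2 ^ 13. *)
have := @ln_ge_pow2 13 ((2 * K%:R) ^+ 2); rewrite ln_exprn; last by move: K2; move: (_ * _) => k; lra.
move=> h; apply: (nineteen_trivial b0 hp (h := 13 / 2 * (69 / 100)) _ K50); last lra.
suff : 2 ^+ 13 <= (2 * K%:R) ^+ 2 :> R by move=> /h; move: (ln _) => l; lra.
rewrite (_ : 2 ^+ 13 = 2 ^+ 6 * 2 ^+ 7); last by rewrite -exprD.
rewrite expr2; apply: le_trans (_ : 92 * 92 <= _); first by rewrite !exprS expr0; lra.
by apply: ler_pM.
Qed.

End Nineteen.
End ConstantNineteen.

(** * The sieve range for the constant 19 *)

Section SieveBoundNineteen.
Variable R : realType.

(** In the application |X| = s ^ 3 and z = s ^ 6, so |X| z ^ (-5/6) = s ^ -2; 13 is a lower bound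
    for 51 ^ (2/3). *)
Lemma sieve_near_term (s N : R) : 0 < s -> 13 <= s ^+ 2 -> 0 <= N ->
  s ^+ 3 * (5 / 2 * (N + 1) * (s ^+ 6) `^ (1 / 6 - 1)) <= 5 / 26 * (N + 1).
Proof.
move=> s0 s13 N0; have h : 6%:R * (1 / 6 - 1) = - 5%:R :> R by lra.
rewrite -(powR_mulrn 6 (ltW s0)) -powRrM h powRN (powR_mulrn 5 (ltW s0)).
have -> : s ^+ 3 * (5 / 2 * (N + 1) * (s ^+ 5)^-1) = 5 / 2 * (N + 1) * (s ^+ 2)^-1.
  by field; rewrite gt_eqF.
have sV : (s ^+ 2)^-1 <= 13^-1 by rewrite lef_pV2 ?posrE ?exprn_gt0.
apply: le_trans (ler_wpM2l _ sV) _; first by rewrite mulr_ge0 //; lra.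
by move: N0; clear; lra.
Qed.

(** In the application N = w ^ 45. The exponents 3 for |X|, 30 for Q ^ 2, 5 for its power 1/6 and 1
    for the logarithm add up to 39. *)
Lemma sieve_far_term (w k : R) (Q : nat) : 1 <= w -> 0 <= k -> 2 * k <= w ^+ 3 -> (0 < Q)%N ->
  Q%:R <= w ^+ 15 ->
  k * (32 * (Q ^ 2)%:R * (Q ^ 2)%:R `^ (1 / 6) * (1 + 2 * ln (2 * (Q ^ 2)%:R))) <= 960 * w ^+ 39.
Proof.
move=> w1 k0 kw Q0 Qw; have w0 : 0 < w by lra.
have Q1 : 1 <= Q%:R :> R by rewrite ler1n.
have Q2 : (Q ^ 2)%:R <= w ^+ 30 by rewrite natrX (exprM w 15 2) ler_pXn2r ?nnegrE ?exprn_ge0 // ltW.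
have Q2p : (Q ^ 2)%:R `^ (1 / 6) <= w ^+ 5.
  have -> : w ^+ 5 = (w ^+ 30) `^ (1 / 6).
    rewrite -(powR_mulrn 30 (ltW w0)) -powRrM -(powR_mulrn 5 (ltW w0)).
    by congr (_ `^ _); clear; lra.
  by apply: ge0_ler_powR; rewrite ?nnegrE ?exprn_ge0 ?(ltW w0) //; clear; lra.
have Q21 : 1 <= (Q ^ 2)%:R :> R by rewrite natrX exprn_ege1.
have lw1 : ln w <= w - 1 by have := @ln_le_scaled R 0 w w0; rewrite expr0; move: w1; clear; lra.
have lQ : 1 + 2 * ln (2 * (Q ^ 2)%:R) <= 60 * w.
  have Qp : 0 < Q%:R :> R by rewrite ltr0n.
  rewrite natrX lnM ?posrE ?exprn_gt0 // ln_exprn //.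
  have : ln Q%:R <= 15 * ln w by rewrite -ln_exprn // ler_ln ?posrE ?exprn_gt0.
  by have /andP[_] := ln2_bounds R; move: lw1; clear; lra.
have lQ0 : 0 <= 1 + 2 * ln (2 * (Q ^ 2)%:R) :> R.
  have : 0 <= ln (2 * (Q ^ 2)%:R) :> R.
    by rewrite ln_ge0 //; move: Q21; move: (_ %:R) => q; clear; lra.
  by clear; lra.
have p0 := powR_ge0 (Q ^ 2)%:R (1 / 6 : R).
have -> : 960 * w ^+ 39 = w ^+ 3 / 2 * (32 * w ^+ 30 * w ^+ 5 * (60 * w)) by clear; field.
have q0 : 0 <= 32 * (Q ^ 2)%:R :> R by rewrite mulr_ge0.
have q1 : 32 * (Q ^ 2)%:R <= 32 * w ^+ 30 by apply: ler_wpM2l.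
apply: ler_pM => //.
- by rewrite mulr_ge0 // mulr_ge0.
- by move: kw; clear; lra.
- by apply: ler_pM => //; apply: ler_pM.
Qed.

(** To be read with n = ln N, h = ln(2 |X|), l = ln |X|, q = ln(Q + 1), zi = 1/z for z = |X|^2; the
    first factor is 4 l + 4 <= 4 (h + 0.31). *)
Lemma sieve_weight_term (n h l q zi : R) :
  0 < n -> n <= 3 * q -> 4 <= h -> 0 <= l -> l <= h - 69 / 100 -> 0 <= zi -> 2500 * zi <= 1 ->
  (2 * (2 * l + 1) + 2) * (1 + zi) / q <= 1201 / 100 * (h + 31 / 100) / n.
Proof.
move=> n0 nq h4 l0 lh z0 z1.
have E1 : (2 * (2 * l + 1) + 2) * (1 + zi) <= 1201 / 100 * (h + 31 / 100) / 3 by nra.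
have q0 : 0 < q by lra.
rewrite ler_pdivrMr // mulrAC ler_pdivlMr //.
have E2 : 0 <= 1201 / 100 * (h + 31 / 100) by lra.
apply: le_trans (ler_wpM2r (ltW n0) E1) _.
by have := ler_wpM2l E2 nq; lra.
Qed.

(** The total is about 1.46 * 12.01 (h + 0.31) < 17.54 h + 5.44, and h >= 4 leaves room below 19
    h. *)
Lemma sieve_total (n h N D W x a b r : R) : 4 <= h -> 0 <= D -> 1000 <= N -> 0 < n ->
  0 <= W -> W <= 1201 / 100 * (h + 31 / 100) / n ->
  x * a <= 5 / 26 * (N + 1) -> x * b <= 93 / 1000 * N -> r <= 1 / 100 * N / n ->
  (N + 4 + 47 / 40 * D + x * (a + b)) * W + r <= 19 * ((N + D) / n) * h.
Proof.
move=> h4 D0 N0 n0 W0 Wle near far rest.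
have main : N + 4 + 47 / 40 * D + x * (a + b) <= 146 / 100 * (N + D) by rewrite mulrDr; lra.
apply: le_trans (lerD (ler_wpM2r W0 main) rest) _.
apply: le_trans (lerD (ler_wpM2l _ Wle) (lexx _)) _; first by move: D0 N0; clear => ? ?; apply: mulr_ge0; lra.
have -> : 146 / 100 * (N + D) * (1201 / 100 * (h + 31 / 100) / n) + 1 / 100 * N / n =
  ((146 / 100 * (1201 / 100) * (h + 31 / 100)) * (N + D) + 1 / 100 * N) / n by ring.
have -> : 19 * ((N + D) / n) * h = 19 * h * (N + D) / n by ring.
apply: ler_wpM2r; first by rewrite invr_ge0 ltW.
have : 0 <= (h - 4) * (N + D) by move: h4 D0 N0; clear => ? ? ?; apply: mulr_ge0; lra.
by move: D0 N0; clear; lra.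
Qed.

(** The choices are z = |X|^2, eps = 1/6 and Q = N^(1/3). Then z ^ eps = |X|^(1/3) > 3, and N > (2
    |X|)^15 keeps |X| Q^2 below N^(11/15). *)
Lemma sieve_bound_nineteen (K : nat) (N D : R) :
  (50 < K)%N -> (2 * K%:R) ^+ 15 < N -> 0 <= D -> exists z Q,
  [/\ (2601 <= z)%N, (0 < Q)%N, 3 <= z%:R `^ (1 / 6) :> R &
  (N + 4 + 47 / 40 * D
    + K%:R * (5 / 2 * (N + 1) * z%:R `^ (1 / 6 - 1)
       + 32 * (Q ^ 2)%:R * (Q ^ 2)%:R `^ (1 / 6) * (1 + 2 * ln (2 * (Q ^ 2)%:R))))
    * ((2 * (ln z%:R + 1) + 2) * (1 + z%:R^-1) / ln Q.+1%:R) + K%:R * Q.+1%:R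
  <= 19 * ((N + D) / ln N) * ln (2 * K%:R)].
Proof.
move=> K51 hN D0; pose z := (K ^ 2)%N.
have : 51 <= K%:R :> R by rewrite (ler_nat R 51).
have : z%:R = K%:R ^+ 2 :> R by rewrite natrX.
have : (2601 <= z)%N by apply: leq_trans (_ : 51 ^ 2 <= _)%N; rewrite // leq_sqr.
move: z hN => z hN z2601; move: hN; set k : R := K%:R => hN zk k51; clear K51.
have k0 : 0 <= k by lra.
have k2 : 102 <= 2 * k by lra.
have k2p : 0 < 2 * k by lra.
have k2_ge1 : 1 <= 2 * k by lra.
have N_ge : 2 * k <= N.
  by apply: le_trans (ltW hN); rewrite -[leLHS]expr1; apply: ler_weXn2l.
have N1 : 1 <= N by exact: le_trans N_ge.
have N0 : 0 <= N by exact: le_trans N1.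
(* The roots w = N^(1/45) and s = |X|^(1/3) make every exponent integral. *)
have wN := powR_root 44 N0; have w0 := powR_ge0 N (45%:R^-1); set w := N `^ _ in wN w0.
have kw : 2 * k <= w ^+ 3.
  rewrite -(@ler_pXn2r _ 15) ?nnegrE ?exprn_ge0 ?(ltW k2p) //.
  by rewrite -exprM wN ltW.
clear hN; have w1 : 1 <= w.
  rewrite leNgt; apply/negP => w1; have := exprn_ile1 3 w0 (ltW w1).
  by move: kw k2; clear; lra.
have sk := powR_root 2 k0.
have s0 := powR_ge0 k (3%:R^-1); set s := k `^ _ in sk s0.
have s13 : 13 <= s ^+ 2.
  rewrite -(@ler_pXn2r _ 3) ?nnegrE ?exprn_ge0 // -exprM mulnC exprM sk.
  apply: le_trans (_ : 51 ^+ 2 <= _); first by rewrite !exprS expr0; clear; lra.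
  by rewrite ler_pXn2r ?nnegrE.
have s3 : 3 <= s by rewrite leNgt; apply/negP => s3; move: s13 s0 s3; clear; rewrite expr2; nra.
have sp : 0 < s by apply: lt_le_trans s3.
pose Q := Num.truncn (w ^+ 15).
have zs : z%:R = s ^+ 6 :> R by rewrite zk -sk -exprM.
have z0 : 0 < z%:R :> R by rewrite zs exprn_gt0.
have z1 : 1 <= z%:R :> R by rewrite ler1n; apply: leq_trans z2601.
have w15 : 1 <= w ^+ 15 by rewrite exprn_ege1.
have /andP[Qw wQ] := truncn_itv (le_trans ler01 w15); rewrite -/Q in Qw wQ.
have Q0 : (0 < Q)%N.
  by rewrite lt0n; apply/eqP => Q0; move: wQ; rewrite Q0 ltNge w15.
have Q1 : 1 <= Q%:R :> R by rewrite ler1n.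
have Qp : 0 < Q.+1%:R :> R by [].
exists z, Q; split => //.
  by rewrite zs -(powR_mulrn 6 s0) -powRrM mul1r mulfV ?pnatr_eq0 // powRr1.
have wp : 0 < w by apply: lt_le_trans w1.
have h4 : 4 <= ln (2 * k).
  have := @ln_ge_pow2 R 6 (2 * k); suff -> : 2 ^+ 6 <= 2 * k by move=> /(_ isT); clear; lra.
  by rewrite !exprS expr0; move: k2; clear; lra.
have lN : ln N = 45 * ln w by rewrite -wN ln_exprn.
have lN0 : 0 < ln N by
  apply: lt_le_trans (_ : ln (2 * k) <= _); [apply: lt_le_trans h4|
  rewrite ler_ln ?posrE // (lt_le_trans k2p)].
have lw1 : ln w <= w - 1 by have := @ln_le_scaled R 0 w wp; rewrite expr0; clear; lra.
have w6 : 102 * 102 <= w ^+ 6.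
  by rewrite (exprM w 3 2) expr2; apply: ler_pM => //; apply: le_trans kw.
have w39 : 1 <= w ^+ 39 by exact: exprn_ege1.
have NE : N = w ^+ 6 * w ^+ 39 by rewrite -exprD.
have lk0 : 0 <= ln k by rewrite ln_ge0 //; move: k51; clear; lra.
apply: sieve_total => //.
- by rewrite NE; move: w6 w39; move: (w ^+ 6) (w ^+ 39) => a b; clear; nra.
- have lz := ln_ge0 z1; have lQ : 0 <= ln Q.+1%:R :> R by rewrite ln_ge0 // ler1n.
  by rewrite divr_ge0 // mulr_ge0 ?addr_ge0 ?invr_ge0 ?mulr_ge0 ?addr_ge0 // ltW.
- have kp : 0 < k by apply: lt_le_trans k51.
  rewrite [ln z%:R](_ : _ = 2 * ln k); last by rewrite zk ln_exprn.
  apply: sieve_weight_term lN0 _ h4 lk0 _ _ _.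
  + have : 15 * ln w <= ln Q.+1%:R.
      by rewrite -ln_exprn // ler_ln ?posrE ?exprn_gt0 // ltW.
    by rewrite lN; move: (ln _) (ln _) => a b; clear; lra.
  + rewrite lnM ?posrE //; have /andP[] := ln2_bounds R.
    by move: (ln _) (ln _) => a b; clear; lra.
  + by rewrite invr_ge0 (ltW z0).
  + by rewrite (ler_pdivrMr _ _ z0) mul1r zk expr2; move: k51; clear; nra.
- by rewrite zs -[in leLHS]sk; exact: sieve_near_term.
- apply: le_trans (sieve_far_term w1 k0 kw Q0 Qw) _; rewrite [in leRHS]NE [leRHS]mulrA.
  apply: ler_wpM2r; first by rewrite exprn_ge0.
  by move: w6; move: (w ^+ 6) => a; clear; lra.
- rewrite ler_pdivlMr //.
  apply: le_trans (_ : w ^+ 3 / 2 * (2 * w ^+ 15) * (45 * w) <= _).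
    apply: ler_pM; rewrite ?mulr_ge0 // ?(ltW lN0) //; last by rewrite lN; move: lw1; clear; lra.
    apply: ler_pM => //; first by move: kw; clear; lra.
    by rewrite -natr1; move: w15 Qw; move: (w ^+ 15) => a; clear; lra.
  have -> : w ^+ 3 / 2 * (2 * w ^+ 15) * (45 * w) = 45 * w ^+ 19 by clear; field.
  rewrite NE; have h1 : w ^+ 19 <= w ^+ 39 by exact: ler_weXn2l.
  by move: h1 w39 w6; move: (w ^+ 19) (w ^+ 39) (w ^+ 6) => a b c; clear; nra.
Qed.
End SieveBoundNineteen.

Theorem primes_large_sieve_nineteen (R : realType) (N delta : R) (X : set (RmodZ R))
  (u : nat -> R[i]) : 10 ^+ 4 <= N -> 0 < delta -> nonempty X -> well_spaced delta X ->
  primes_large_sieve N delta X u 19.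
Proof.
move=> N_ge d0 X0 wX.
have [|K25] := leqP (#|` fset_set X|) 25; first exact: nineteen_le25.
have [|K50] := leqP (#|` fset_set X|) 50; first exact: nineteen_le50.
have N1 : 1 <= N by apply: le_trans N_ge; rewrite exprn_ege1 //; clear; lra.
have [hN|hN] := leP N ((2 * (#|` fset_set X|)%:R) ^+ 15).
  by apply: nineteen_dense hN => //; right.
have D0 : 0 <= delta^-1 by rewrite invr_ge0 ltW.
have [z [Q [hz hQ hp hb]]] := sieve_bound_nineteen K50 hN D0.
have he : 0 <= (1 / 6 : R) <= 1 / 4 by apply/andP; split; clear; lra.
exact: (@primes_large_sieve_sieve R N delta X u 19 N1 d0 wX z Q (1 / 6) hz hQ he hp hb).
Qed.

(** * The asymptotic constant *)

Section AsymptoticUpperBound.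
Variable R : realType.

(** In the application N = w ^ 88. The exponents 16 for |X|, 68 for Q ^ 2, at most 2 for its power
    1/66 and 1 for the logarithm add up to 87, one less than for N. *)
Lemma far_term_asymptotic (w k : R) (Q : nat) : 1 <= w -> 0 <= k -> 2 * k <= w ^+ 16 -> (0 < Q)%N ->
  Q%:R <= w ^+ 34 ->
  k * (32 * (Q ^ 2)%:R * (Q ^ 2)%:R `^ (1 / 66) * (1 + 2 * ln (2 * (Q ^ 2)%:R))) <= 2176 * w ^+ 87.
Proof.
move=> w1 k0 kw Q0 Qw; have w0 : 0 < w by lra.
have Q1 : 1 <= Q%:R :> R by rewrite ler1n.
have Q2 : (Q ^ 2)%:R <= w ^+ 68 by rewrite natrX (exprM w 34 2) ler_pXn2r ?nnegrE ?exprn_ge0 // ltW.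
have Q2p : (Q ^ 2)%:R `^ (1 / 66) <= w ^+ 2.
  apply: le_trans (_ : (w ^+ 68) `^ (1 / 66) <= _).
    by apply: ge0_ler_powR; rewrite ?nnegrE ?exprn_ge0 ?(ltW w0) //; clear; lra.
  rewrite -(powR_mulrn 68 (ltW w0)) -powRrM -(powR_mulrn 2 (ltW w0)).
  by apply: ler_powR => //; clear; lra.
have Q21 : 1 <= (Q ^ 2)%:R :> R by rewrite natrX exprn_ege1.
have lw1 : ln w <= w - 1 by have := @ln_le_scaled R 0 w w0; rewrite expr0; move: w1; clear; lra.
have lQ : 1 + 2 * ln (2 * (Q ^ 2)%:R) <= 136 * w.
  have Qp : 0 < Q%:R :> R by rewrite ltr0n.
  rewrite natrX lnM ?posrE ?exprn_gt0 // ln_exprn //.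
  have : ln Q%:R <= 34 * ln w by rewrite -ln_exprn // ler_ln ?posrE ?exprn_gt0.
  by have /andP[_] := ln2_bounds R; move: lw1; clear; lra.
have lQ0 : 0 <= 1 + 2 * ln (2 * (Q ^ 2)%:R) :> R.
  have : 0 <= ln (2 * (Q ^ 2)%:R) :> R.
    by rewrite ln_ge0 //; move: Q21; move: (_ %:R) => q; clear; lra.
  by clear; lra.
have p0 := powR_ge0 (Q ^ 2)%:R (1 / 66 : R).
have -> : 2176 * w ^+ 87 = w ^+ 16 / 2 * (32 * w ^+ 68 * w ^+ 2 * (136 * w)) by clear; field.
have q0 : 0 <= 32 * (Q ^ 2)%:R :> R by rewrite mulr_ge0.
have q1 : 32 * (Q ^ 2)%:R <= 32 * w ^+ 68 by apply: ler_wpM2l.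
apply: ler_pM => //.
- by rewrite mulr_ge0 // mulr_ge0.
- by move: kw; clear; lra.
- by apply: ler_pM => //; apply: ler_pM.
Qed.

(** To be read with n = ln N, q = ln(Q + 1), lz = ln z and l = ln r where |X| = r ^ 64. The excess
    of 351 over 132 * 88/34 = 341.7 absorbs the constants once l >= 3. *)
Lemma weight_term_asymptotic (n l lz q zi : R) :
  0 < n -> 34 * n <= 88 * q -> 3 <= l -> 0 <= lz -> lz <= 66 * l + 7 / 10 -> 0 <= zi -> 1000 * zi <= 1 ->
  (2 * (lz + 1) + 2) * (1 + zi) / q <= 351 * l / n.
Proof.
move=> n0 nq l3 lz0 lzl z0 z1.
have E1 : (2 * (lz + 1) + 2) * (1 + zi) <= (132 * l + 54 / 10) * (1001 / 1000).
  by apply: ler_pM; lra.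
have q0 : 0 < q by lra.
rewrite ler_pdivrMr // mulrAC ler_pdivlMr //.
apply: le_trans (ler_wpM2r (ltW n0) E1) _.
have : l * n * 34 <= l * (88 * q) by rewrite -mulrA; move: l3 nq; clear => ? ?; apply: ler_wpM2l; lra.
have : 3 * n <= l * n by move: l3 n0; clear => ? ?; apply: ler_wpM2r; lra.
by move: n0; clear; lra.
Qed.

(** The margin is 1.18 * 351 = 414.18 against 64 * 13/2 = 416. *)
Lemma total_asymptotic (n h l N D W x a b r : R) : 3 <= l -> 64 * l <= h -> 0 <= D -> 1000 <= N -> 0 < n ->
  0 <= W -> W <= 351 * l / n ->
  x * a <= 5 / 2 * (N + 1) / 1000 -> x * b <= 1 / 1000 * N -> r <= 1 / 1000 * N / n ->
  (N + 4 + 47 / 40 * D + x * (a + b)) * W + r <= 13 / 2 * ((N + D) / n) * h.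
Proof.
move=> l3 lh D0 N0 n0 W0 Wle near far rest.
have main : N + 4 + 47 / 40 * D + x * (a + b) <= 118 / 100 * (N + D) by rewrite mulrDr; lra.
apply: le_trans (lerD (ler_wpM2r W0 main) rest) _.
apply: le_trans (lerD (ler_wpM2l _ Wle) (lexx _)) _; first by move: D0 N0; clear => ? ?; apply: mulr_ge0; lra.
have -> : 118 / 100 * (N + D) * (351 * l / n) + 1 / 1000 * N / n =
  (118 / 100 * 351 * (l * (N + D)) + 1 / 1000 * N) / n by ring.
have -> : 13 / 2 * ((N + D) / n) * h = 13 / 2 * (h * (N + D)) / n by ring.
apply: ler_wpM2r; first by rewrite invr_ge0 ltW.
have : 64 * (l * (N + D)) <= h * (N + D) by rewrite mulrA; move: lh D0 N0; clear => ? ? ?; apply: ler_wpM2r; lra.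
have : 3 * (N + D) <= l * (N + D) by move: l3 D0 N0; clear => ? ? ?; apply: ler_wpM2r; lra.
by move: D0 N0; clear; lra.
Qed.

(** With |X| = r ^ 64 and N = w ^ 88 the choices are z near r ^ 66, eps = 1/66 and Q near w ^ 34,
    while 2 |X| <= w ^ 16. Then |X| z ^ (eps - 1) is at most 1/r, and the leading constant 2 * 66/64
    * 88/34 * 47/40 = 6.27 is below 13/2. *)
Lemma sieve_bound_asymptotic (K : nat) (N D : R) :
  1000 <= K%:R `^ (64%:R^-1) :> R -> (2 * K%:R) ^+ 11 < N ^+ 2 -> 1 <= N -> 0 <= D -> exists z Q,
  [/\ (2601 <= z)%N, (0 < Q)%N, 3 <= z%:R `^ (1 / 66) :> R &
  (N + 4 + 47 / 40 * D
    + K%:R * (5 / 2 * (N + 1) * z%:R `^ (1 / 66 - 1)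
       + 32 * (Q ^ 2)%:R * (Q ^ 2)%:R `^ (1 / 66) * (1 + 2 * ln (2 * (Q ^ 2)%:R))))
    * ((2 * (ln z%:R + 1) + 2) * (1 + z%:R^-1) / ln Q.+1%:R) + K%:R * Q.+1%:R
  <= 13 / 2 * ((N + D) / ln N) * ln (2 * K%:R)].
Proof.
set k : R := K%:R; move: (k `^ _) (powR_root 63 (ler0n R K)) (powR_ge0 k (64%:R^-1)) => r.
rewrite -/k => rk r0 r1000 hN N1 D0.
have k0 : 0 <= k by exact: ler0n.
have t0 : 0 <= 1000 :> R by exact: ler0n.
have r1 : 1 <= r by move: r1000; clear; lra.
have rp : 0 < r by apply: lt_le_trans r1.
have kp : 0 < k by rewrite -rk exprn_gt0.
have k1 : 1 <= k by rewrite -rk exprn_ege1.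
have k2p : 0 < 2 * k by rewrite mulr_gt0.
have N0 : 0 <= N by exact: le_trans N1.
have wN := powR_root 87 N0; have w0 := powR_ge0 N (88%:R^-1); set w := N `^ _ in wN w0.
have kw : 2 * k <= w ^+ 16.
  by rewrite -(@ler_pXn2r _ 11) ?nnegrE ?exprn_ge0 ?(ltW k2p) // -exprM (exprM w 88 2) wN ltW.
clear hN; have rw : r ^+ 4 <= w.
  rewrite -(@ler_pXn2r _ 16) ?nnegrE ?exprn_ge0 // -exprM rk.
  by apply: le_trans kw; move: k0; clear; lra.
have w_ge_r : r <= w by apply: le_trans rw; rewrite -[leLHS]expr1; apply: ler_weXn2l.
have w1 : 1 <= w by exact: le_trans w_ge_r.
have wp : 0 < w by apply: lt_le_trans w1.
pose z := (Num.truncn (r ^+ 66)).+1; pose Q := Num.truncn (w ^+ 34).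
have r66 : 1 <= r ^+ 66 by exact: exprn_ege1.
have /andP[zr rz] := truncn_itv (le_trans ler01 r66).
have z0 : 0 < z%:R :> R by rewrite ltr0n.
have z1 : 1 <= z%:R :> R by rewrite ler1n.
have w34 : 1 <= w ^+ 34 by exact: exprn_ege1.
have /andP[Qw wQ] := truncn_itv (le_trans ler01 w34); rewrite -/Q in Qw wQ.
have Q0 : (0 < Q)%N.
  by rewrite lt0n; apply/eqP => Q0; move: wQ; rewrite Q0 ltNge w34.
have Qp : 0 < Q.+1%:R :> R by [].
have r_le_z : r <= z%:R.
  by apply: le_trans (ltW rz); rewrite -[leLHS]expr1; apply: ler_weXn2l.
have z_big : 1000 * 1000 <= z%:R :> R.
  apply: le_trans (ltW rz); apply: le_trans (_ : r ^+ 2 <= _); last exact: ler_weXn2l.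
  by rewrite expr2; exact: (ler_pM t0 t0 r1000 r1000).
exists z, Q; split => //.
- apply: (@leq_trans (51 * 51)); first by [].
  by rewrite -(ler_nat R) natrM; apply: le_trans z_big; apply: ler_pM; clear; lra.
- apply: le_trans (_ : r <= _); first by move: r1000; clear; lra.
  have {1}-> : r = (r ^+ 66) `^ (1 / 66).
    by rewrite -(powR_mulrn 66 r0) -powRrM mul1r mulfV ?pnatr_eq0 // powRr1.
  by apply: ge0_ler_powR; rewrite ?nnegrE ?(ltW rz) ?(ltW z0) ?exprn_ge0 //; clear; lra.
have l3 : 3 <= ln r.
  have := @ln_ge_pow2 R 9 r; suff -> : 2 ^+ 9 <= r by move=> /(_ isT); clear; lra.
  by rewrite !exprS expr0; move: r1000; clear; lra.
have lN : ln N = 88 * ln w by rewrite -wN ln_exprn.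
have lw_gt0 : 0 < ln w by apply: lt_le_trans (_ : ln r <= _); [apply: lt_le_trans l3|rewrite ler_ln ?posrE].
have lN0 : 0 < ln N by rewrite lN mulr_gt0.
have lw1 : ln w <= w - 1 by have := @ln_le_scaled R 0 w wp; rewrite expr0; clear; lra.
have NE : N = w * w ^+ 87 by rewrite -exprS.
have w3 : 1000 * (1000 * 1000) <= w.
  apply: le_trans rw; apply: le_trans (_ : r ^+ 3 <= _); last exact: ler_weXn2l.
  by rewrite !exprS expr0 mulr1; exact: (ler_pM t0 (mulr_ge0 t0 t0) r1000 (ler_pM t0 t0 r1000 r1000)).
have w87 : 1 <= w ^+ 87 by exact: exprn_ege1.
apply: (total_asymptotic l3) => //.
- rewrite lnM ?posrE // -rk ln_exprn //; have /andP[] := ln2_bounds R.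
  by move: (ln _) (ln _) => a b; clear; lra.
- by rewrite NE; move: w3 w87; move: (w ^+ 87) => a; clear; nra.
- have lz := ln_ge0 z1; have lQ : 0 <= ln Q.+1%:R :> R by rewrite ln_ge0 // ler1n.
  by rewrite divr_ge0 // mulr_ge0 ?addr_ge0 ?invr_ge0 ?mulr_ge0 ?addr_ge0 // ltW.
- apply: (weight_term_asymptotic lN0 _ l3 (ln_ge0 z1)).
  + have : 34 * ln w <= ln Q.+1%:R.
      by rewrite -ln_exprn // ler_ln ?posrE ?exprn_gt0 // ltW.
    by rewrite lN; move: (ln _) (ln _) => a b; clear; lra.
  + apply: le_trans (_ : ln (2 * r ^+ 66) <= _).
      rewrite ler_ln ?posrE ?mulr_gt0 ?exprn_gt0 // /z -natr1.
      by move: zr r66; move: (_ ^+ _) => a; clear; lra.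
    rewrite lnM ?posrE ?exprn_gt0 // ln_exprn //; have /andP[_] := ln2_bounds R.
    by move: (ln _) (ln _) => a b; clear; lra.
  + by rewrite invr_ge0 (ltW z0).
  + by rewrite (ler_pdivrMr _ _ z0) mul1r; exact: (le_trans r1000).
- have zp : z%:R `^ (1 / 66 - 1) <= r ^- 65.
    have e66 : 66%:R * (1 / 66 - 1) = - 65%:R :> R by clear; lra.
    have -> : r ^- 65 = (r ^+ 66) `^ (1 / 66 - 1).
      by rewrite -(powR_mulrn 66 r0) -powRrM e66 powRN (powR_mulrn 65 r0).
    have -> : (1 / 66 - 1 : R) = - (1 - 1 / 66) by clear; lra.
    rewrite !powRN lef_pV2 ?posrE ?powR_gt0 ?exprn_gt0 //.
    by apply: ge0_ler_powR; rewrite ?nnegrE ?(ltW rz) ?(ltW z0) ?exprn_ge0 //; clear; lra.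
  apply: le_trans (_ : k * (5 / 2 * (N + 1) * r ^- 65) <= _).
    apply: ler_wpM2l => //; apply: ler_wpM2l => //.
    by move: N0; clear => ?; rewrite mulr_ge0 //; lra.
  have -> : k * (5 / 2 * (N + 1) * r ^- 65) = 5 / 2 * (N + 1) / r.
    by rewrite -rk; field; rewrite gt_eqF.
  apply: ler_wpM2l; first by move: N0; clear => ?; rewrite mulr_ge0 //; lra.
  have t1 : (1000 : R) \in Num.pos by rewrite posrE; exact: ltr0Sn.
  by rewrite (lef_pV2 (rp : r \in Num.pos) t1).
- apply: le_trans (far_term_asymptotic w1 k0 kw Q0 Qw) _; rewrite [in leRHS]NE [leRHS]mulrA.
  apply: ler_wpM2r; first by rewrite exprn_ge0.
  by move: w3; clear; lra.
- rewrite ler_pdivlMr //.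
  apply: le_trans (_ : w ^+ 16 / 2 * (2 * w ^+ 34) * (88 * w) <= _).
    apply: ler_pM; rewrite ?mulr_ge0 // ?(ltW lN0) //; last by rewrite lN; move: lw1; clear; lra.
    apply: ler_pM => //; first by move: kw; clear; lra.
    by rewrite -natr1; move: w34 Qw; move: (w ^+ 34) => a; clear; lra.
  have -> : w ^+ 16 / 2 * (2 * w ^+ 34) * (88 * w) = 88 * w ^+ 51 by clear; field.
  rewrite NE; have h1 : w ^+ 51 <= w ^+ 87 by exact: ler_weXn2l.
  by move: h1 w87 w3; move: (w ^+ 51) (w ^+ 87) => a b; clear; nra.
Qed.

Lemma prime_count_le_id n : prime_count R n <= n%:R.
Proof.
rewrite /prime_count big_mkcond big_nat_recl //= add0r.
apply: le_trans (_ : \sum_(0 <= i < n) (1 : R) <= _); first by apply: ler_sum => p _; case: ifP.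
by rewrite sumr_const_nat subn0.
Qed.

(** There are no primes below 2. This covers N = 1, where [ln N] is 0 and the quotient by it is 0 by
    convention. *)
Lemma primes_large_sieve_lt2 (N delta : R) (X : set (RmodZ R)) u C : 1 <= N -> N < 2 -> 0 < delta ->
  well_spaced delta X -> 0 <= C * ((N + delta^-1) / ln N) * ln (2 * (#|` fset_set X|)%:R) ->
  primes_large_sieve N delta X u C.
Proof.
move=> N1 N2 d0 wX h; apply: primes_large_sieve_trivial => //.
suff -> : prime_count R (Num.truncn N) = 0 by rewrite mulr0.
have /andP[tN _] := truncn_itv (le_trans ler01 N1).
rewrite /prime_count big_nat_cond big1 // => p /andP[/andP[_ pN] pp].
have p2 : 2 <= (Num.truncn N)%:R :> R by rewrite (ler_nat R 2) (leq_trans (prime_gt1 pp)).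
by have := le_trans p2 tN; move: N2; clear; lra.
Qed.

(** From pi(N) <= N. It supplies the values of o(1) for bounded |X|, where no decay is demanded. *)
Lemma primes_large_sieve_crude (N delta : R) (X : set (RmodZ R)) u C : 1 <= N -> 0 < delta ->
  nonempty X -> well_spaced delta X -> (#|` fset_set X|)%:R * ln N / ln 2 <= C ->
  primes_large_sieve N delta X u C.
Proof.
move=> N1 d0 X0 wX hC; have K0 := card_spaced_gt0 d0 X0 wX.
set k : R := _%:R in hC.
have k1 : 1 <= k by rewrite ler1n.
have D0 : 0 < delta^-1 by rewrite invr_gt0.
have N0 : 0 <= N by lra.
have /andP[tN Nt] := truncn_itv N0.
have l2 : 0 < ln 2 :> R by rewrite ln_gt0 // ltr1n.
have lN := ln_ge0 N1.
have lk : ln 2 <= ln (2 * k) by rewrite ler_ln ?posrE; lra.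
have C0 : 0 <= C by apply: le_trans hC; rewrite divr_ge0 // ?mulr_ge0 //; lra.
have Y0 : 0 <= (N + delta^-1) / ln N by rewrite divr_ge0 // addr_ge0 // ltW.
have [N2|N2] := ltP N 2.
  by apply: primes_large_sieve_lt2 => //; apply: (mulr_ge0 (mulr_ge0 C0 Y0)); lra.
have lN0 : 0 < ln N by rewrite ln_gt0 //; lra.
apply: primes_large_sieve_trivial => //; rewrite -/k.
apply: le_trans (_ : k * N <= _).
  by apply: ler_wpM2l; [lra|apply: le_trans (prime_count_le_id _) tN].
apply: le_trans (_ : k * ln N / ln 2 * ((N + delta^-1) / ln N) * ln 2 <= _).
  have -> : k * ln N / ln 2 * ((N + delta^-1) / ln N) * ln 2 = k * (N + delta^-1).
    by field; rewrite !gt_eqF.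
  by apply: ler_wpM2l; lra.
apply: ler_pM => //; first by rewrite !mulr_ge0 ?invr_ge0 //; lra.
  by lra.
exact: ler_wpM2r.
Qed.

(** The large sieve is used up to N = (2 |X|)^(11/2), which is affordable since 11/2 * 47/40 = 6.46
    < 13/2. *)
Lemma primes_large_sieve_asymptotic (N delta : R) (X : set (RmodZ R)) u : 1 <= N -> 0 < delta ->
  well_spaced delta X -> 1000 <= (#|` fset_set X|)%:R `^ (64%:R^-1) :> R ->
  primes_large_sieve N delta X u (13 / 2).
Proof.
move=> N1 d0 wX K_ge; have D0 : 0 < delta^-1 by rewrite invr_gt0.
have DK := well_spaced_card d0 wX.
have [hN|hN] := leP (N ^+ 2) ((2 * (#|` fset_set X|)%:R) ^+ 11); last first.
  have [z [Q [hz hQ hp hb]]] := sieve_bound_asymptotic K_ge hN N1 (ltW D0).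
  have he : 0 <= (1 / 66 : R) <= 1 / 4 by apply/andP; split; clear; lra.
  exact: (@primes_large_sieve_sieve R N delta X u _ N1 d0 wX z Q (1 / 66) hz hQ he hp hb).
have k1000 : 1000 <= (#|` fset_set X|)%:R :> R.
  have := powR_root 63 (ler0n R (#|` fset_set X|)); move: K_ge; move: (_ `^ _) => r r1000 <-.
  have r1 : 1 <= r by apply: (le_trans _ r1000); rewrite ler1n.
  by apply: (le_trans r1000); rewrite -[leLHS]expr1; apply: ler_weXn2l.
have [N2|N2] := ltP N 2.
  apply: primes_large_sieve_lt2 => //; rewrite mulr_ge0 //.
    by rewrite mulr_ge0 ?divr_ge0 ?ln_ge0 // ?addr_ge0 ?(ltW D0) //; move: N1; clear; lra.
  by rewrite ln_ge0 //; move: k1000; move: (#|` fset_set X|%:R) => k; clear; lra.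
clear K_ge; apply: primes_large_sieve_dense => //.
move: hN k1000 DK; move: (#|` fset_set X|%:R) => k hN k1000 DK.
have k2p : 0 < 2 * k by lra.
have lN2 : 2 * ln N <= 11 * ln (2 * k).
  by rewrite -!ln_exprn ?(lt_le_trans _ N1) // ler_ln ?posrE ?exprn_gt0 // (lt_le_trans _ N1).
have lN : 0 < ln N by rewrite ln_gt0 //; lra.
set h := ln (2 * k) in lN2 *.
have -> : 13 / 2 * ((N + delta^-1) / ln N) * h = 13 / 2 * (N + delta^-1) * h / ln N by rewrite mulrA mulrAC.
rewrite ler_pdivlMr //.
have h0 : 0 <= h by lra.
have lin : (N + 4 + 47 / 40 / delta) * (11 / 2) <= 13 / 2 * (N + delta^-1) by lra.
apply: le_trans (ler_wpM2r h0 lin); rewrite -[leRHS]mulrA; apply: ler_wpM2l; lra.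
Qed.

End AsymptoticUpperBound.

Lemma primes_large_sieve_ler (R : realType) (N delta : R) (X : set (RmodZ R)) u (C C' : R) :
  1 <= N -> 0 < delta -> C <= C' ->
  primes_large_sieve N delta X u C -> primes_large_sieve N delta X u C'.
Proof.
move=> N1 d0 CC' h; apply: le_trans h _; apply: ler_wpM2r.
  by apply: sumr_ge0 => p _; exact: sqr_ge0.
apply: ler_wpM2r.
  have [->|] := eqVneq (#|` fset_set X|) 0%N; first by rewrite mulr0 ln0.
  rewrite -lt0n -(ler_nat R) => K1; apply: ln_ge0; lra.
apply: ler_wpM2r => //; rewrite divr_ge0 ?ln_ge0 // addr_ge0 ?invr_ge0 ?(ltW d0) //; lra.
Qed.

Lemma asymptotic_constant_four_expR_gamma (R : realType) :
  asymptotic_constant (4 * expR (euler_gamma R)).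
Proof.
exists (fun (N : R) K => if (1000 : R) <= K%:R `^ (64%:R^-1) then 0 else K%:R * ln N / ln 2); split.
  move=> V /nbhs_ballP[r /= r0 rV]; exists (setT, [set K | (Num.truncn ((1000 : R) ^+ 64) < K)%N]%classic).
    by split; [exact: filterT|exact: nbhs_infty_gt].
  move=> [N K] [_ /= hK]; rewrite /= ifT; first by apply: rV; exact: ballxx.
  have t0 : 0 <= (1000 : R) by exact: ler0n.
  have : (1000 : R) ^+ 64 <= K%:R.
    have /andP[_ h] := truncn_itv (exprn_ge0 64 t0).
    by apply: le_trans (ltW h) _; rewrite ler_nat.
  rewrite -{1}(powR_root 63 (ler0n R K)) ler_pXn2r // nnegrE ?powR_ge0 //.
move=> N delta X u N1 d0 X0 wX; case: ifP => hK.
  apply: (@primes_large_sieve_ler _ _ _ _ _ (13 / 2)) => //.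
    by rewrite addr0 four_expR_euler_gamma_ge.
  exact: primes_large_sieve_asymptotic.
apply: (primes_large_sieve_crude u N1 d0 X0 wX); rewrite lerDr.
have := four_expR_euler_gamma_ge R; lra.
Qed.

(** * The lower bound *)

Section ExtremalSet.
Variables (R : realType) (Q : nat).
Local Notation nc := (@Normc.normc R).
Local Notation A := (sieve_primes 0 Q).
Local Notation P := (prodset A).
Implicit Types (U V : {set 'I_Q.+1}).

Let A_prime (p : 'I_Q.+1) : p \in A -> prime p := @sieve_primes_prime 0 Q p.

Definition prime_set m : {set 'I_Q.+1} := [set p : 'I_Q.+1 | (p : nat) \in primes m]%SET.

Lemma prime_set_sub m : prime_set m \subset A.
Proof.
apply/fintype.subsetP => p; rewrite !finset.inE mem_primes => /and3P[pp _ _].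
by rewrite pp prime_gt0.
Qed.

Lemma prodset_prime_set m : (0 < m)%N -> (prodset (prime_set m) <= m)%N.
Proof.
move=> m0; apply: dvdn_leq => //; apply: (prodset_dvd A_prime (prime_set_sub m)) => p.
by rewrite finset.inE mem_primes => /and3P[].
Qed.

(** The part of the harmonic sum up to Q formed by the m whose radical is the product over U. *)
Definition radical_sum U : R := \sum_(m < Q.+1 | (0 < m)%N && (prime_set m == U)) m%:R^-1.

(* Every m with set of prime divisors U is p k, where k has either the same set of
   prime divisors or one without p. *)
Lemma radical_sum_step U (p : 'I_Q.+1) : U \subset A -> p \in U ->
  p%:R * radical_sum U <= radical_sum U + radical_sum (U :\ p).
Proof.
move=> UA pU; have pp : prime p by apply: A_prime; exact: (fintype.subsetP UA).
have p0 : 0 < p%:R :> R by rewrite ltr0n prime_gt0.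
pose f (m : 'I_Q.+1) : 'I_Q.+1 := inord (m %/ p).
have fE m : f m = (m %/ p)%N :> nat.
  by rewrite inordK // ltnS (leq_trans (leq_div _ _)) // -ltnS.
pose G (k : 'I_Q.+1) : R :=
  (if (0 < k)%N && (prime_set k == U) then k%:R^-1 else 0) +
  (if (0 < k)%N && (prime_set k == U :\ p) then k%:R^-1 else 0).
have G0 k : 0 <= G k by rewrite /G; apply: addr_ge0; case: ifP => // _; rewrite invr_ge0.
have dv (m : 'I_Q.+1) : prime_set m == U -> (p %| m)%N.
  by move=> /eqP mU; move: pU; rewrite -mU finset.inE mem_primes => /and3P[].
have injf : {in (fun m : 'I_Q.+1 => (0 < m)%N && (prime_set m == U)) &, injective f}.
  move=> m n /andP[_ /dv pm] /andP[_ /dv pn] /(congr1 val) /=; rewrite !fE => h.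
  by apply: val_inj; rewrite -[val m](divnK pm) -[val n](divnK pn) h.
have GE : \sum_k G k = radical_sum U + radical_sum (U :\ p).
  by rewrite /G big_split /radical_sum; congr (_ + _); rewrite [RHS]big_mkcond.
have := ler_sum_inj injf G0; rewrite GE; apply: le_trans.
rewrite /radical_sum mulr_sumr; apply: ler_sum => m /andP[m0 mU].
have pm := dv m mU; have fm0 : (0 < f m)%N by rewrite fE divn_gt0 ?prime_gt0 // dvdn_leq.
have mE : m%:R = p%:R * (f m)%:R :> R by rewrite -natrM fE mulnC divnK.
have -> : p%:R * m%:R^-1 = (f m)%:R^-1 :> R.
  by rewrite mE invfM mulrA mulfV ?mul1r // gt_eqF.
have fm_ge0 : 0 <= (f m)%:R^-1 :> R by rewrite invr_ge0.
rewrite /G fm0 /=.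
have : (prime_set (f m) == U) || (prime_set (f m) == U :\ p).
  have UE : U = p |: prime_set (f m).
    rewrite -(eqP mU); apply/finset.setP => q; rewrite !finset.inE.
    have -> : (m : nat) = (p * f m)%N by rewrite fE mulnC divnK.
    by rewrite (primesM _ (prime_gt0 pp) fm0) (primes_prime pp) seq.inE.
  have [pf|pf] := boolP (p \in prime_set (f m)).
    by rewrite {1}UE (finset.setUidPr _) ?eqxx // finset.sub1set.
  by rewrite {2}UE finset.setU1K // eqxx orbT.
move=> /orP[] ->; first by rewrite lerDl; case: ifP.
by rewrite lerDr; case: ifP.
Qed.

(** [radical_sum_step] says that removing p from U costs at most the factor 1 / (p - 1); for the
    empty set only m = 1 remains. *)
Lemma radical_sum_le U : U \subset A -> radical_sum U <= \prod_(p in U) (p%:R - 1)^-1.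
Proof.
have [n] := ubnP #|U|; elim: n U => // n IH U; rewrite ltnS => Un UA.
case: (finset.set_0Vmem U) => [U0|[p pU]].
  rewrite U0 finset.big_set0 /radical_sum.
  apply: le_trans (_ : \sum_(m < Q.+1 | m == 1 :> nat) (1 : R) <= _); last first.
    rewrite sumr_const (ler_nat R _ 1); apply/card_le1_eqP => i j.
    by rewrite !unfold_in => /eqnP i1 /eqnP j1; apply: val_inj; rewrite /= i1 j1.
  rewrite big_mkcond [leRHS]big_mkcond /=; apply: ler_sum => m _.
  case: ifP => [/andP[m0 /eqP mU]|_]; last by case: ifP.
  have [m1|m1] := leqP m 1.
    have mE : (m : nat) = 1%N by apply/eqP; rewrite eqn_leq m1.
    by rewrite mE invr1; exact: lexx.
  have pm : (pdiv m < Q.+1)%N by apply: leq_ltn_trans (ltn_ord m); exact: pdiv_leq.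
  have : Ordinal pm \in prime_set m.
    by rewrite finset.inE mem_primes pdiv_prime // pdiv_dvd m0.
  by rewrite mU finset.in_set0.
have pp : prime p by apply: A_prime; exact: (fintype.subsetP UA).
have p1 : 2 <= p%:R :> R by rewrite (ler_nat R 2) prime_gt1.
rewrite (finset.big_setD1 p pU) /=.
have UD : U :\ p \subset A by apply: fintype.subset_trans UA; exact: finset.subsetDl.
have /IH /(_ UD) h : (#|U :\ p| < n)%N by rewrite (cardsD1 p) pU in Un.
apply: le_trans (_ : (p%:R - 1)^-1 * radical_sum (U :\ p) <= _); last first.
  by apply: ler_wpM2l h; rewrite invr_ge0; lra.
rewrite mulrC ler_pdivlMr; last lra.
by have := radical_sum_step UA pU; lra.
Qed.

(** The bound is phi(q). By the Chinese remainder theorem c is determined by its residues modulo the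
    primes of A, which vanish outside U and are nonzero in U. *)
Lemma card_supp_eq U : U \subset A ->
  (#|[set c : 'I_P.-1.+1 | supp c == U]%SET| <= \prod_(p in U) p.-1)%N.
Proof.
move=> UA; have UAp := fintype.subsetP UA.
have P0 : (0 < P)%N by exact: (prodset_gt0 A_prime (fintype.subxx A)).
have lt_mod (c : 'I_P.-1.+1) (p : 'I_Q.+1) : p \in U -> (c %% p < Q.+1)%N.
  move=> /UAp /A_prime pp; apply: leq_trans (ltn_ord p); rewrite ltnS ltnW //.
  by rewrite ltn_mod prime_gt0.
pose f (c : 'I_P.-1.+1) : {ffun 'I_Q.+1 -> 'I_Q.+1} :=
  [ffun p => if p \in U then inord (c %% p) else p].
pose F (p : 'I_Q.+1) : {set 'I_Q.+1} :=
  if p \in U then [set j : 'I_Q.+1 | (0 < j < p)%N]%SET else [set p]%SET.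
have injf : {in [set c : 'I_P.-1.+1 | supp c == U]%SET &, injective f}.
  move=> c d; rewrite !finset.inE => /eqP cU /eqP dU fcd.
  have mods (p : 'I_Q.+1) : p \in A -> c = d %[mod p].
    move=> pA; have [pU|pU] := boolP (p \in U).
      move/ffunP: fcd => /(_ p); rewrite !ffunE pU => /(congr1 val) /=.
      by rewrite !inordK ?lt_mod.
    have pc : (p %| c)%N by apply: contraR pU => pc; rewrite -cU finset.inE pA.
    have pd : (p %| d)%N by apply: contraR pU => pd; rewrite -dU finset.inE pA.
    by rewrite (eqP pc) (eqP pd).
  apply: val_inj => /=.
  wlog cd : c d cU dU fcd mods / (c <= d)%N.
    move=> H; have [cd|cd] := leqP c d; first exact: H.
    by symmetry; apply: H; rewrite ?(ltnW cd) // => p /mods.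
  have : (P %| d - c)%N.
    apply: (prodset_dvd A_prime (fintype.subxx _)) => p /mods h.
    by rewrite -eqn_mod_dvd //; apply/eqP.
  have dP : (d < P)%N by have := ltn_ord d; rewrite {2}(prednK P0).
  have [dc|dc] := posnP (d - c)%N; first by move=> _; apply/eqP; rewrite eqn_leq cd -subn_eq0 dc.
  by move=> /(dvdn_leq dc); rewrite leqNgt (leq_ltn_trans (leq_subr _ _)).
rewrite -(card_in_imset injf).
have sub : (f @: [set c : 'I_P.-1.+1 | supp c == U]%SET)%SET \subset family (fun p => mem (F p)).
  apply/fintype.subsetP => h /finset.imsetP[c + ->]; rewrite finset.inE => /eqP cU.
  apply/familyP => p; rewrite ffunE /F; case: ifP => pU; last by rewrite finset.set11.
  rewrite finset.inE inordK ?lt_mod //; apply/andP; split; last first.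
    by rewrite ltn_mod prime_gt0 // A_prime // UAp.
  by move: pU; rewrite -cU finset.inE => /andP[_]; rewrite lt0n.
apply: leq_trans (subset_leq_card sub) _.
rewrite card_family foldrE big_map big_enum /= [leqRHS]big_mkcond /=.
apply: leq_prod => p _; rewrite /F; case: ifP => pU; last by rewrite cards1.
have pp : prime p by apply: A_prime; exact: UAp.
pose g (i : 'I_p.-1) : 'I_Q.+1 := inord i.+1.
rewrite -[leqRHS]card_ord -cardsT; apply: leq_trans (leq_imset_card g _).
apply: subset_leq_card; apply/fintype.subsetP => j; rewrite finset.inE => /andP[j0 jp].
have jp' : (j.-1 < p.-1)%N by rewrite -ltnS !prednK // prime_gt0.
apply/finset.imsetP; exists (Ordinal jp'); rewrite ?finset.inE //.
by rewrite /g /= (prednK j0) inord_val.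
Qed.

(** The weight 1 / phi(q): its squares over the at most phi(q) residues of denominator q sum to at
    most 1 / phi(q), so Cauchy-Schwarz costs only the mass. *)
Definition extremal_weight U : R :=
  if (U \subset A) && (prodset U <= Q)%N then \prod_(p in U) (p%:R - 1)^-1 else 0.

Definition extremal_mass : R := \sum_(U : {set 'I_Q.+1} | U \subset A) extremal_weight U.

Let prime_factor_bounds U (p : 'I_Q.+1) : U \subset A -> p \in U -> 0 <= ((p%:R : R) - 1)^-1 <= 1.
Proof.
move=> /fintype.subsetP UA /UA /A_prime pp.
have p1 : 2 <= p%:R :> R by rewrite (ler_nat R 2) prime_gt1.
by rewrite invr_ge0 invf_le1; [apply/andP; split; lra|lra].
Qed.

Lemma extremal_weight_bounds U : 0 <= extremal_weight U <= 1.
Proof.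
rewrite /extremal_weight; case: ifP => [/andP[UA _]|_]; last by rewrite lexx ler01.
have h p : p \in U -> 0 <= ((p%:R : R) - 1)^-1 <= 1 by exact: prime_factor_bounds UA.
by rewrite prodr_ile1 // andbT; apply: prodr_ge0 => p /h /andP[].
Qed.

Lemma extremal_mass_ge : ln Q.+1%:R <= extremal_mass.
Proof.
apply: le_trans (harmonic_ge R Q) _; rewrite big_add1 /= big_mkord.
have -> : \sum_(i < Q) i.+1%:R^-1 = \sum_(m < Q.+1 | (0 < m)%N) m%:R^-1 :> R.
  by rewrite [RHS]big_mkcond big_ord_recl /= add0r.
rewrite (partition_big (fun m : 'I_Q.+1 => prime_set m)
  (fun U => (U \subset A) && (prodset U <= Q)%N)) /=; last first.
  by move=> m m0; rewrite prime_set_sub (leq_trans (prodset_prime_set m0)) // -ltnS.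
rewrite /extremal_mass [leRHS](bigID (fun U => (prodset U <= Q)%N)) /=.
rewrite -[leLHS]addr0; apply: lerD; last first.
  by apply: sumr_ge0 => U _; have /andP[] := extremal_weight_bounds U.
by apply: ler_sum => U /[dup] UAQ /andP[UA _]; rewrite /extremal_weight UAQ; exact: radical_sum_le.
Qed.

Lemma extremal_sqr_sum : \sum_(c : 'I_P.-1.+1) extremal_weight (supp c) ^+ 2 <= extremal_mass.
Proof.
rewrite (partition_big (fun c => supp c) (fun U => U \subset A)) /=; last by move=> c _; exact: supp_sub.
apply: ler_sum => U UA; have /andP[w0 w1] := extremal_weight_bounds U.
rewrite (eq_bigr (fun=> extremal_weight U ^+ 2)) => [|c /eqP -> //].
rewrite sumr_const -[_ *+ #|_|]mulr_natr expr2 -mulrA ler_piMr //.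
rewrite {1}/extremal_weight; case: ifP => [_|_]; last by rewrite mul0r.
have := card_supp_eq UA; rewrite cardsE -(ler_nat R) => h.
have p0 : 0 < \prod_(p in U) (p%:R - 1) :> R.
  apply: prodr_gt0 => p /(fintype.subsetP UA) /A_prime pp.
  by rewrite subr_gt0 ltr1n prime_gt1.
rewrite prodfV mulrC ler_pdivrMr // mul1r; apply: le_trans h _.
rewrite natr_prod; apply: ler_prod => p /(fintype.subsetP UA) /A_prime pp.
by rewrite ler0n -subn1 natrB ?prime_gt0 //=.
Qed.

(** The identity h = G at n = 1, with all weights at most 1. Together with [extremal_mass_ge] it
    makes |X| tend to infinity with Q. *)
Lemma extremal_mass_le_card :
  extremal_mass <= #|[set c : 'I_P.-1.+1 | (prodset (supp c) <= Q)%N]%SET|%:R.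
Proof.
have cop : coprime 1 P by rewrite coprime1n.
have := ramanujan_sum_coprime A_prime extremal_weight cop; rewrite -/extremal_mass => h.
have m0 : 0 <= extremal_mass by apply: sumr_ge0 => U _; have /andP[] := extremal_weight_bounds U.
rewrite -(ger0_norm m0) -nc_real -h; apply: le_trans (nc_sum _ _ _) _.
rewrite -sum1_card natr_sum big_mkcond [leRHS]big_mkcond; apply: ler_sum => c _.
have /andP[w0 w1] := extremal_weight_bounds (supp c).
rewrite Normc.normcM nc_chi mulr1 nc_real normrM normrX normrN1 expr1n mul1r ger0_norm //.
rewrite finset.inE; case: ifP => // cQ.
by rewrite /extremal_weight cQ andbF.
Qed.

Definition rough_prime_sum n (t : R) : R[i] :=
  \sum_(0 <= p < n.+1 | prime p) (if (Q < p)%N then 1 else 0) * e (t * p%:R).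

Lemma extremal_lower_bound n :
  extremal_mass * (\sum_(0 <= p < n.+1 | prime p) (if (Q < p)%N then 1 else 0)) ^+ 2 <=
  \sum_(c : 'I_P.-1.+1 | (prodset (supp c) <= Q)%N) nc (rough_prime_sum n (c%:R / P%:R)) ^+ 2.
Proof.
set pi' := \sum_(0 <= p < n.+1 | _) _; set S := \sum_(c | _) _.
pose w (c : 'I_P.-1.+1) := extremal_weight (supp c).
have w_ge0 c : 0 <= w c by have /andP[] := extremal_weight_bounds (supp c).
have m0 : 0 <= extremal_mass by apply: sumr_ge0 => U _; have /andP[] := extremal_weight_bounds U.
have pi0 : 0 <= pi' by apply: sumr_ge0 => p _; case: ifP.
have S0 : 0 <= S by apply: sumr_ge0 => c _; exact: sqr_ge0.
have E : (extremal_mass * pi')%:C%C =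
  \sum_c ((-1) ^+ #|supp c| * w c)%:C%C * rough_prime_sum n (c%:R / P%:R).
  under eq_bigr => c _ do rewrite /rough_prime_sum mulr_sumr.
  rewrite exchange_big /= /pi' mulr_sumr rmorph_sum /=; apply: eq_bigr => p pp.
  case: ifP => Qp; last by rewrite mulr0 big1 // => c _; rewrite mul0r mulr0.
  have cop : coprime p P by exact: (coprime_prodset A_prime pp Qp).
  rewrite mulr1 -(ramanujan_sum_coprime A_prime extremal_weight cop).
  by apply: eq_bigr => c _; rewrite mul1r /chi mulrC [p%:R * _]mulrC mulrC.
have le1 : extremal_mass * pi' <= \sum_(c | (prodset (supp c) <= Q)%N)
    w c * nc (rough_prime_sum n (c%:R / P%:R)).
  apply: le_trans (ler_norm _) _; rewrite -nc_real E; apply: le_trans (nc_sum _ _ _) _.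
  rewrite [leRHS]big_mkcond; apply: ler_sum => c _.
  rewrite Normc.normcM nc_real normrM normrX normrN1 expr1n mul1r ger0_norm //.
  by case: ifP => // cQ; rewrite /w /extremal_weight cQ andbF mul0r.
have cs := cauchy_schwarz (index_enum _) (fun c : 'I_P.-1.+1 => (prodset (supp c) <= Q)%N) w
  (fun c => nc (rough_prime_sum n (c%:R / P%:R))).
have le2 : (extremal_mass * pi') ^+ 2 <= extremal_mass * S.
  apply: le_trans (le_trans _ cs) _.
    by rewrite ler_sqr ?nnegrE ?mulr_ge0 // (le_trans _ le1) // mulr_ge0.
  apply: ler_wpM2r => //; apply: le_trans extremal_sqr_sum.
  rewrite [leRHS](bigID (fun c : 'I_P.-1.+1 => (prodset (supp c) <= Q)%N)) /= lerDl.
  by apply: sumr_ge0 => c _; exact: sqr_ge0.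
have [->|mn0] := eqVneq extremal_mass 0; first by rewrite mul0r.
have mp : 0 < extremal_mass by rewrite lt_def mn0.
by rewrite -(ler_pM2l mp) mulrA -expr2 -exprMn.
Qed.

End ExtremalSet.

(** * The extremal set in R/Z and the inequality it yields *)

Section ExtremalInequality.
Variables (R : realType) (Q : nat).
Hypothesis Q_gt0 : (0 < Q)%N.
Local Notation A := (sieve_primes 0 Q).
Local Notation P := (prodset A).
Local Notation C0 := [set c : 'I_P.-1.+1 | (prodset (supp c) <= Q)%N]%SET.

Let A_prime (p : 'I_Q.+1) : p \in A -> prime p := @sieve_primes_prime 0 Q p.

Definition farey_point (c : 'I_P.-1.+1) : RmodZ R := (\pi_(RmodZ R) (c%:R / P%:R : R))%qT.

Definition farey_set : set (RmodZ R) := [set` [seq farey_point c | c <- enum C0]]%classic.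

Lemma farey_dist c d : c != d -> c \in C0 -> d \in C0 ->
  (Q%:R ^+ 2)^-1 <= dist_RmodZ (farey_point c) (farey_point d).
Proof.
rewrite !finset.inE => cd cQ dQ; rewrite dist_RmodZ_pi -mulrBl.
apply: le_trans (supp_dist R A_prime cd).
rewrite lef_pV2 ?posrE ?exprn_gt0 ?ltr0n ?muln_gt0 ?(prodset_gt0 A_prime (supp_sub _)) //.
by rewrite -natrX ler_nat -mulnn leq_mul.
Qed.

Let Q2_gt0 : 0 < (Q%:R ^+ 2)^-1 :> R.
Proof. by rewrite invr_gt0 exprn_gt0 // ltr0n. Qed.

Lemma farey_point_inj : {in C0 &, injective farey_point}.
Proof.
move=> c d cC dC cd; apply/eqP; apply: contraT => /farey_dist /(_ cC dC).
rewrite cd /farey_point dist_RmodZ_pi subrr => h.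
have d0 : dist_int (0 : R) = 0 by rewrite /dist_int floor0 subrr subr0 minElt ltr01.
by move: (lt_le_trans Q2_gt0 h); rewrite d0 ltxx.
Qed.

Lemma farey_set_spaced : well_spaced (Q%:R ^+ 2)^-1 farey_set.
Proof.
move=> _ _ /= /mapP[c + ->] /mapP[d + ->]; rewrite !mem_enum => cC dC cd.
by apply: farey_dist => //; apply/eqP => cd'; apply: cd; rewrite cd'.
Qed.

Lemma farey_set_finite : finite_set farey_set.
Proof. exact: well_spaced_finite Q2_gt0 farey_set_spaced. Qed.

Lemma farey_perm : perm_eq (enum_fset (fset_set farey_set)) [seq farey_point c | c <- enum C0].
Proof.
apply: uniq_perm; first exact: fset_uniq.
  rewrite map_inj_in_uniq ?enum_uniq // => c d; rewrite !mem_enum; exact: farey_point_inj.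
move=> x; rewrite in_fset_set ?mem_setE //; exact: farey_set_finite.
Qed.

Lemma card_farey_set : #|` fset_set farey_set| = #|C0|.
Proof. by rewrite (perm_size farey_perm) size_map -cardE. Qed.

Lemma farey_set_neq0 : nonempty farey_set.
Proof.
exists (farey_point 0) => /=; apply: map_f; rewrite mem_enum finset.inE supp0 prodset0.
exact: Q_gt0.
Qed.

(** The number of primes in (Q, N] enters squared on the left and, as the sum of the |u_p|^2, once
    on the right. One factor cancels, and the other is at least pi(N) - Q. *)
Lemma extremal_inequality (N : nat) (C : R) : (Q <= N)%N -> Q%:R < prime_count R N ->
  primes_large_sieve N%:R ((Q%:R ^+ 2)^-1) farey_set
    (fun p => if (Q < p)%N then 1 else 0) C ->
  ln Q.+1%:R * (prime_count R N - Q%:R) <=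
  C * ((N%:R + Q%:R ^+ 2) / ln N%:R) * ln (2 * #|C0|%:R).
Proof.
move=> QN QpN; rewrite /primes_large_sieve natrK invrK card_farey_set.
set Y := C * _ * _; pose pi' : R := \sum_(0 <= p < N.+1 | prime p) (if (Q < p)%N then 1 else 0).
have -> : \sum_(0 <= p < N.+1 | prime p) Normc.normc (if (Q < p)%N then 1 else 0 : R[i]) ^+ 2 = pi'.
  apply: eq_bigr => p _; case: ifP => _; first by rewrite Normc.normc1 expr1n.
  by rewrite Normc.normc0 expr0n.
rewrite (fsbig_finite _ _ farey_set_finite) /= (perm_big _ farey_perm) big_map big_enum /=.
have -> : \sum_(c in C0) Normc.normc (\sum_(0 <= p < N.+1 | prime p)
    (if (Q < p)%N then 1 else 0) * e_RmodZ (farey_point c *+ p)) ^+ 2 =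
  \sum_(c : 'I_P.-1.+1 | (prodset (supp c) <= Q)%N)
    Normc.normc (rough_prime_sum Q N (c%:R / P%:R)) ^+ 2 :> R.
  apply: eq_big => [c|c _]; first by rewrite finset.inE.
  congr (Normc.normc _ ^+ 2); apply: eq_bigr => p _.
  by rewrite /farey_point e_RmodZ_mulrn.
move=> /(le_trans (extremal_lower_bound R Q N)); rewrite -/pi' => h.
have pi_ge : prime_count R N - Q%:R <= pi'.
  rewrite lerBlDr addrC /pi' /prime_count [leLHS](big_cat_nat (n := Q.+1)) //=.
  apply: lerD; first exact: (prime_count_le_id R Q).
  rewrite [leRHS](big_cat_nat (n := Q.+1)) //= -[leLHS]add0r; apply: lerD.
    by apply: sumr_ge0 => p _; case: ifP.
  rewrite big_mkcond [leRHS]big_mkcond /=; apply: ler_sum_nat => p /andP[Qp _].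
  by rewrite Qp.
have pi0 : 0 < pi' by apply: lt_le_trans pi_ge; rewrite subr_gt0.
apply: le_trans (_ : extremal_mass R Q * pi' <= _).
  apply: ler_pM => //; first by rewrite ln_ge0 // ler1n.
    by rewrite subr_ge0 ltW.
  exact: extremal_mass_ge.
by rewrite -(ler_pM2r pi0) -mulrA -expr2.
Qed.

Lemma card_farey_le : #|C0|%:R <= Q%:R ^+ 2 + 1 :> R.
Proof.
by have := well_spaced_card Q2_gt0 farey_set_spaced; rewrite card_farey_set invrK.
Qed.

Lemma card_farey_ge : ln Q.+1%:R <= #|C0|%:R :> R.
Proof. exact: le_trans (extremal_mass_ge R Q) (extremal_mass_le_card R Q). Qed.

End ExtremalInequality.

(** [ln_le_scaled] with slope 2 ^ -k <= a / 2; the other half of a n absorbs the constant term. *)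
Lemma ln_eventually_le (R : realType) (a : R) : 0 < a ->
  exists n0, forall n, (n0 <= n)%N -> ln n%:R <= a * n%:R.
Proof.
move=> a0; pose k := (Num.truncn (2 / a)).+1.
have ak : 2 / a <= 2 ^+ k.
  have /andP[_ /ltW h] := truncn_itv (divr_ge0 (ler0n R 2) (ltW a0)).
  by apply: le_trans h _; rewrite -natrX ler_nat ltnW // ltn_expl.
exists (Num.truncn (2 * k%:R / a)).+1 => n n_ge.
have c0 : 0 <= 2 * k%:R / a by rewrite divr_ge0 ?mulr_ge0 // ltW.
have hn : 2 * k%:R / a <= n%:R.
  by have /andP[_ /ltW h] := truncn_itv c0; apply: le_trans h _; rewrite ler_nat.
have n0 : 0 < n%:R :> R by rewrite ltr0n; apply: leq_trans n_ge.
apply: le_trans (ln_le_scaled k n0) _.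
have p0 : 0 < 2 ^+ k :> R by rewrite exprn_gt0.
have h1 : n%:R / 2 ^+ k <= a / 2 * n%:R.
  rewrite mulrC; apply: ler_wpM2r; first exact: ltW.
  by rewrite -div1r ler_pdivrMr //; move: ak; rewrite ler_pdivrMr //; lra.
have h2 : 2 * k%:R <= n%:R * a by rewrite -ler_pdivrMr.
have h3 : 0 <= k%:R :> R by [].
move: h1 h2 h3; move: (n%:R / 2 ^+ k) => x; clear; lra.
Qed.

Import numFieldNormedType.Exports.
Local Open Scope classical_set_scope.

Lemma asymptotic_constant_ge_half (R : realType) (c : R) : asymptotic_constant c -> 1 / 2 <= c.
Proof.
move=> [eps [eps0 heps]]; rewrite leNgt; apply/negP => c_lt.
(* C lies strictly between c and 1/2, and the maximum with 1/4 keeps it positive. *)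
pose C := Num.max ((c + 1 / 2) / 2) (1 / 4).
have C_c : (c + 1 / 2) / 2 <= C by rewrite le_max lexx.
have C_gt : 1 / 4 <= C by rewrite le_max lexx orbT.
have C_lt : C < 1 / 2 by rewrite gt_max; apply/andP; split; lra.
pose tau := (1 / 2 - c) / 2; have tau0 : 0 < tau by rewrite /tau; lra.
have nb : nbhs (0 : R) (ball (0 : R) tau) by exact: nbhsx_ballx.
have [[S1 S2] /= [[N0 [_ hN0]] [K0 _ hK0]] hS] := eps0 _ nb.
(* Then C = (1 - 8 kappa) / 2, which contradicts the final comparison 1 - 2 kappa <= C (1 + kappa)
   (2 + kappa). *)
pose kappa := (1 - 2 * C) / 8; have k0 : 0 < kappa by rewrite /kappa; lra.
(* Q is fixed before N. That ln Q >= K0 makes |X| large enough for the error to be below tau, and ln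
   Q >= 2 / kappa absorbs the constant in ln(2 |X|); N is then taken so large that Q ln N and Q ^ 2
   are at most kappa N. *)
pose Q := (Num.truncn (expR (K0%:R + 2 / kappa : R))).+1.
have Q_gt0 : (0 < Q)%N by [].
have Q_big : K0%:R + 2 / kappa <= ln Q%:R :> R.
  have /andP[_ /ltW h] := truncn_itv (expR_ge0 (K0%:R + 2 / kappa : R)).
  by rewrite -[leLHS]expRK ler_ln // posrE ?expR_gt0 ?ltr0n.
move: Q Q_gt0 Q_big => Q Q_gt0 Q_big.
have Q0 : 0 < Q%:R :> R by rewrite ltr0n.
have [n1 hn1] := ln_eventually_le (divr_gt0 k0 Q0).
pose n2 := (maxn 3 (maxn n1 (maxn Q (maxn (Num.truncn N0).+1 (Num.truncn (Q%:R ^+ 2 / kappa)).+1))))%N.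
have [n n_ge hpi] := prime_count_limsup n2 k0.
move: n_ge; rewrite /n2 !geq_max => /and5P[n3 nn1 nQ nN0 nQ2].
have n_gt0 : 0 < n%:R :> R by rewrite ltr0n; apply: leq_trans n3.
have ln0 : 0 < ln n%:R :> R by rewrite ln_gt0 // ltr1n; apply: leq_trans n3.
have Qln : Q%:R * ln n%:R <= kappa * n%:R.
  by have := hn1 n nn1; rewrite mulrAC ler_pdivlMr // mulrC.
have Q2n : Q%:R ^+ 2 <= kappa * n%:R.
  have c0 : 0 <= Q%:R ^+ 2 / kappa by rewrite divr_ge0 ?exprn_ge0 // ltW.
  have /andP[_ h] := truncn_itv c0; rewrite mulrC -ler_pdivrMr //.
  by apply: le_trans (ltW h) _; rewrite ler_nat.
have l_ge : ln Q%:R <= ln Q.+1%:R :> R by rewrite ler_ln ?posrE ?ltr0n // ler_nat.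
pose K := #|` fset_set (@farey_set R Q)|.
have K_ge : (K0 <= K)%N.
  rewrite -(ler_nat R) /K card_farey_set //; apply: le_trans (card_farey_ge R Q).
  apply: le_trans l_ge; apply: le_trans Q_big; rewrite lerDl; exact: (divr_ge0 (ler0n R 2) (ltW k0)).
have eps_lt : eps n%:R K < tau.
  have : S1 n%:R by apply: hN0; have [N00|N00] := ltP N0 0;
    [exact: lt_trans n_gt0|have /andP[_ h] := truncn_itv N00; apply: lt_le_trans h _; rewrite ler_nat].
  move=> S1n; have := hS (n%:R, K) (conj S1n (hK0 K K_ge)); rewrite /ball /= sub0r normrN.
  exact: le_lt_trans (ler_norm _).
have n1R : 1 <= n%:R :> R by rewrite ler1n; apply: leq_trans n3.
have Qi0 : 0 < (Q%:R ^+ 2)^-1 :> R by rewrite invr_gt0 exprn_gt0.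
have pls := heps n%:R _ _ (fun p => if (Q < p)%N then 1 else 0) n1R Qi0
  (farey_set_neq0 R Q_gt0) (@farey_set_spaced R Q Q_gt0).
have {}pls : primes_large_sieve n%:R (Q%:R ^+ 2)^-1 (@farey_set R Q)
    (fun p => if (Q < p)%N then 1 else 0) C.
  by apply: primes_large_sieve_ler pls => //; move: eps_lt; rewrite -/K /tau; lra.
have kappa_le : kappa <= 1 / 16 by rewrite /kappa; lra.
have Qpi : Q%:R < prime_count R n.
  rewrite -(ltr_pM2r ln0); apply: le_lt_trans Qln _; apply: lt_le_trans hpi.
  by rewrite ltr_pM2r //; move: kappa_le; clear; lra.
have := extremal_inequality Q_gt0 nQ Qpi pls.
set L := ln (2 * _); set lq := ln Q.+1%:R => h.
pose l : R := ln Q%:R.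
have l_big : 2 / kappa <= l by apply: le_trans Q_big; rewrite lerDr ler0n.
have l0 : 0 < l by apply: lt_le_trans l_big; rewrite divr_gt0.
have kl : 2 <= kappa * l by rewrite mulrC -ler_pdivrMr.
have Q1 : 1 <= Q%:R :> R by rewrite ler1n.
have L_le : L <= 2 * l + 14 / 10.
  apply: le_trans (_ : ln (2 * (2 * Q%:R ^+ 2)) <= _).
    have C0 := card_farey_le R Q_gt0.
    have C1 : 0 < (#|[set c : 'I_(prodset (sieve_primes 0 Q)).-1.+1 |
        (prodset (supp c) <= Q)%N]%SET|%:R : R).
      by apply: lt_le_trans (card_farey_ge R Q); rewrite ln_gt0 // ltr1n.
    have Q21 : 1 <= Q%:R ^+ 2 :> R by rewrite exprn_ege1.
    rewrite ler_ln ?posrE ?mulr_gt0 ?exprn_gt0 //.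
    by apply: ler_wpM2l => //; apply: le_trans C0 _; move: Q21; clear; lra.
  have Q2p : 0 < Q%:R ^+ 2 :> R by rewrite exprn_gt0.
  rewrite lnM ?posrE ?mulr_gt0 // lnM ?posrE // ln_exprn // -/l; have /andP[_] := ln2_bounds R; clear; lra.
have L_le' : L <= (2 + kappa) * l by move: L_le kl; clear; lra.
have lhs : l * ((1 - 2 * kappa) * n%:R) <= lq * (prime_count R n - Q%:R) * ln n%:R.
  rewrite -mulrA; apply: ler_pM => //; first exact: ltW.
    by rewrite mulr_ge0 ?(ltW n_gt0) //; move: kappa_le; clear; lra.
  by rewrite mulrBl; move: hpi Qln; move: (ln n%:R) (prime_count R n) => a b; clear; lra.
have rhs : lq * (prime_count R n - Q%:R) * ln n%:R <= C * ((1 + kappa) * n%:R) * ((2 + kappa) * l).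
  apply: le_trans (ler_wpM2r (ltW ln0) h) _.
  have -> : C * ((n%:R + Q%:R ^+ 2) / ln n%:R) * L * ln n%:R = C * (n%:R + Q%:R ^+ 2) * L.
    by field; rewrite gt_eqF.
  have C0 : 0 <= C by apply: le_trans C_gt; clear; lra.
  have kl0 : 0 <= (2 + kappa) * l by rewrite mulr_ge0 ?(ltW l0) // addr_ge0 // ltW.
  apply: le_trans (ler_wpM2l _ L_le') _; first by rewrite mulr_ge0 // addr_ge0 ?exprn_ge0 // ltW.
  apply: ler_wpM2r => //; apply: ler_wpM2l => //; move: Q2n; move: (_ ^+ 2) => a; clear; lra.
have := le_trans lhs rhs.
have -> : C * ((1 + kappa) * n%:R) * ((2 + kappa) * l) =
  l * (C * (1 + kappa) * (2 + kappa) * n%:R) by ring.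
rewrite (ler_pM2l l0) (ler_pM2r n_gt0).
have -> : C = (1 - 8 * kappa) / 2 by rewrite /kappa; field.
have kk : 0 <= kappa * kappa by rewrite mulr_ge0 // ltW.
have kkk : 0 <= kappa * (kappa * kappa) by rewrite mulr_ge0 // ltW.
by move: k0 kk kkk; clear; lra.
Qed.

Theorem theorem5 (R : realType) :
  asymptotic_constant (4 * expR (euler_gamma R))
  /\ (forall (N delta : R) (X : set (RmodZ R)) (u : nat -> R[i]),
        10 ^+ 4 <= N -> 0 < delta -> X !=set0 -> well_spaced delta X ->
        primes_large_sieve N delta X u 19)
  /\ (forall c : R, asymptotic_constant c -> 1 / 2 <= c).
Proof.
split; first exact: asymptotic_constant_four_expR_gamma.
split=> [N delta X u|c]; first exact: primes_large_sieve_nineteen.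
exact: asymptotic_constant_ge_half.
Qed.
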